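(* Let $R$ be a ring and let $X$ be a locally finite simplicial complex of dimension $n$ with local homology sheaf $h_n$ and local cohomology cosheaf $h^n$ over $R$. Let $L$ be a full subcomplex of $X$, with vertex-complement $L^{\mathrm{vc}}$, and pick an orientation of $X$ so that $L^{\mathrm{vc}}$ is before $L$. Then the following maps, induced by taking the cap product with the fundamental class $[\bar X]\in H_n^{\mathrm{lf}}(X;h^n)$, are all isomorphisms of $R$-bimodules: 1.a. when $X$ is locally Cohen--Macaulay at $L$: (i) $H^l_c(L;h_n|_L)\xrightarrow{[\bar X]\cap-}H_{n-l}(X,L^{\mathrm{vc}};R)$, (ii) $H^l(L;h_n|_L)\xrightarrow{[\bar X]\cap-}H^{\mathrm{lf}}_{n-l}(X,L^{\mathrm{vc}};R)$; 1.b. when $X$ is locally Cohen--Macaulay: (i) $H^l_c(X,L;h_n)\xrightarrow{[\bar X]\cap-}H_{n-l}(L^{\mathrm{vc}};R)$, (ii) $H^l(X,L;h_n)\xrightarrow{[\bar X]\cap-}H^{\mathrm{lf}}_{n-l}(L^{\mathrm{vc}};R)$; 2.a. when $X$ is locally Cohen--Macaulay at $L^{\mathrm{vc}}$: (i) $H^l_c(X,L;R)\xrightarrow{[\bar X]\cap-}H_{n-l}(L^{\mathrm{vc}};h^n|_{L^{\mathrm{vc}}})$, (ii) $H^l(X,L;R)\xrightarrow{[\bar X]\cap-}H^{\mathrm{lf}}_{n-l}(L^{\mathrm{vc}};h^n|_{L^{\mathrm{vc}}})$; 2.b. when $X$ is locally Cohen--Macaulay: (i) $H^l_c(L;R)\xrightarrow{[\bar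 X]\cap-}H_{n-l}(X,L^{\mathrm{vc}};h^n)$, (ii) $H^l(L;R)\xrightarrow{[\bar X]\cap-}H^{\mathrm{lf}}_{n-l}(X,L^{\mathrm{vc}};h^n)$. If $X$ is locally Cohen--Macaulay at $L$ over a cosheaf $\mathcal G$, the maps from 1 (that is, 1.a and 1.b) are isomorphisms with $h_n$ replaced by $(h_{\mathcal G})_n$ and $R$ by $\mathcal G$. Similarly, if $X$ is locally Cohen--Macaulay at $L$ over a sheaf $\mathcal F$, the maps from 2 (that is, 2.a and 2.b) are isomorphisms with $h^n$ replaced by $(h^{\mathcal F})^n$ and $R$ by $\mathcal F$.
   Context: $R$ may be noncommutative. An orientation of $X$ is a total order on the vertices of each simplex such that face inclusions are order preserving. $X_k$ is the set of $k$-simplices; for $\sigma\in X_k$, $\sigma_{\langle j\rangle}$ is the face omitting the $j$-th vertex, $\sigma_{\leq j}$ the face spanned by vertices $0,\dots,j$, and $\sigma_{\geq j}$ the face spanned by vertices $j,\dots,k$. $L^{\mathrm{vc}}$ is the full subcomplex spanned by the vertices of $X$ not in $L$; ''$L^{\mathrm{vc}}$ is before $L$'' means that in each simplex the vertices of $L^{\mathrm{vc}}$ come before those of $L$. A combinatorial sheaf $\mathcal F$ is a covariant functor from the poset of simplices of $X$ (ordered by inclusion) to $R$-modules (left modules for coefficient sheaves), and a cosheaf $\mathcal G$ is a contravariant functor to $R$-modules (right modules for coefficient cosheaves). $C^k(X;\mathcal F)=\prod_{\sigma\in X_k}\mathcal F(\sigma)$ with $(\delta\phi)_\sigma=\sum_i(-1)^i\mathcal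 F(\sigma_{\langle i\rangle}<\sigma)\phi_{\sigma_{\langle i\rangle}}$, and $C_c^k$ is the same with $\bigoplus$. $C_k(X;\mathcal G)=\bigoplus_{\sigma\in X_k}\mathcal G(\sigma)$ with differential sending $a\in\mathcal G(\sigma)$ to $\sum_i(-1)^i\mathcal G(\sigma>\sigma_{\langle i\rangle})a$, and $C_k^{\mathrm{lf}}$ is the same with $\prod$. Their (co)homologies are $H^*,H^*_c,H_*,H^{\mathrm{lf}}_*$. For a subcomplex $K$, relative cochains $C^*(X,K;\mathcal F)$ are the kernel of restriction to $C^*(K;\mathcal F|_K)$, and relative chains $C_*(X,K;\mathcal G)$ are the cokernel of the inclusion of $C_*(K;\mathcal G|_K)$ (similarly for the compactly supported and locally finite versions). Coefficients $R$ mean the constant (co)sheaf. Let $X-\mathring{\mathrm{st}}(\sigma)$ be the subcomplex of simplices not having $\sigma$ as a face. For a cosheaf $\mathcal G$, $(h_{\mathcal G})_k(\sigma)=H_k(X,X-\mathring{\mathrm{st}}(\sigma);\mathcal G)$ (a sheaf), and for a sheaf $\mathcal F$, $(h^{\mathcal F})^k(\sigma)=H^k(X,X-\mathring{\mathrm{st}}(\sigma);\mathcal F)$ (a cosheaf), with maps induced by inclusions of pairs $(X,X-\mathring{\mathrm{st}}(\sigma))\to(X,X-\mathring{\mathrm{st}}(\tau))$ for $\sigma<\tau$; for constant coefficients $R$ these are the $R$-bimodules $h_k$ and $h^k$. The chain group of $(X,X-\mathring{\mathrm{st}}(\sigma))$ in degree $k$ is $\bigoplus_{\alpha\in X_k,\alpha\geq\sigma}\mathcal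 G(\alpha)$, and the cochain group is $\prod_{\alpha\in X_k,\alpha\geq\sigma}\mathcal F(\alpha)$; write $\sigma\triangleleft x$ for the element given by $x$ in the $\alpha$-summand, and $\sigma\triangleleft\alpha$, $\sigma\triangleleft\alpha^*$ for the basis elements when the coefficients are $R$. $X$ is locally Cohen--Macaulay (of dimension $n$) at a subcomplex $K$ if $h_k(\sigma)=0$ for all $\sigma\in K$ and $k\neq n$; over $\mathcal G$ (resp. $\mathcal F$) this means that $(h_{\mathcal G})_k(\sigma)=0$ (resp. $(h^{\mathcal F})^k(\sigma)=0$) for all $\sigma\in K$ and $k\ne n$. ''Locally Cohen--Macaulay'' without a subcomplex means $K=X$. Throughout, the dimension in these conditions is $n$. The fundamental class $[\bar X]$ is represented by the locally finite cycle $\bar X=\sum_{\alpha\in X_n}\alpha\triangleleft\alpha^*$. The cap product of $\eta\in C^{\mathrm{lf}}_k(X;h^n)$ with $\phi\in C^l(X;h_n)$ is given on generators by $\sigma\triangleleft\alpha^*\cap\tau\triangleleft\beta=\sigma_{\leq k-l}$ if $\sigma_{\geq k-l}=\tau$ and $\alpha=\beta$, and $0$ otherwise; with $C^l(X;R)$ by $\sigma\triangleleft\alpha^*\cap\tau^*=\sigma_{\leq k-l}\triangleleft\alpha^*$ if $\sigma_{\geq k-l}=\tau$ and $0$ otherwise. With coefficients: $\sigma\triangleleft\alpha^*\cap\tau\triangleleft x=\mathcal G(\alpha>\sigma_{\leq k-l})x$ (in the $\sigma_{\leq k-l}$ summand) for $x\in\mathcal G(\alpha)$ and $\tau=\sigma_{\geq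 k-l}$, zero if $\tau\ne\sigma_{\geq k-l}$ or $x$ lies in a summand $\mathcal G(\beta)$ with $\beta\ne\alpha$; and $\sigma\triangleleft\alpha^*\cap y=\sigma_{\leq k-l}\triangleleft\mathcal F(\sigma_{\geq k-l}<\alpha)y$ for $y\in\mathcal F(\sigma_{\geq k-l})$, zero for $y\in\mathcal F(\tau)$ with $\tau\neq\sigma_{\geq k-l}$. Explicitly, writing $\phi_\sigma=\sum_\alpha\phi^\sigma_\alpha\,\sigma\triangleleft\alpha$, $\bar X\cap\phi=\sum_{\alpha\in X_n}\phi^{\alpha_{\geq n-l}}_\alpha\,\alpha_{\leq n-l}$ and $\bar X\cap\psi=\sum_{\alpha\in X_n}\psi(\alpha_{\geq n-l})\,\alpha_{\leq n-l}\triangleleft\alpha^*$. Because $L^{\mathrm{vc}}$ is before $L$, these formulas induce well-defined maps on the relative (co)chain groups and (co)homology in all items.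
   Formalization: In the last paragraph, ''locally Cohen–Macaulay at L over G (or F)'' is false as a hypothesis for 1.b, 2.a and 2.b (e.g. L empty); here 1.a assumes it at L over G, 1.b everywhere over G, 2.a at L^vc over F, and 2.b everywhere over F. *)

(* Defs.v *)
From HB Require Import structures.
From mathcomp Require Import all_boot all_order all_algebra.
From mathcomp Require Import ring_quotient.
From mathcomp Require Import finmap.
From mathcomp Require Import boolp classical_sets functions cardinality.

Set Implicit Arguments.
Unset Strict Implicit.
Unset Printing Implicit Defensive.
Import GRing.Theory.
Local Open Scope ring_scope.

(** * Bimodules *)

HB.mixin Record Lmodule_isBimodule (A B : pzRingType) M of GRing.Lmodule A M := {
  rscale : M -> B -> M;
  rscaleA : forall x b c, rscale (rscale x b) c = rscale x (b * c);
  rscale1 : forall x, rscale x 1 = x;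
  rscaleDl : forall b, {morph rscale^~ b : x y / x + y};
  rscaleDr : forall x, {morph rscale x : b c / b + c};
  scale_rscale : forall a x b, a *: rscale x b = rscale (a *: x) b
}.

#[short(type="bimodType")]
HB.structure Definition Bimodule (A B : pzRingType) :=
  {M of Lmodule_isBimodule A B M & GRing.Lmodule A M}.

Section RegularBimodule.
Variable R : pzRingType.
HB.instance Definition _ := Lmodule_isBimodule.Build R R R^o
  (rscale := fun (x : R^o) (b : R) => (x : R) * b)
  (fun x b c => esym (mulrA (x : R) b c)) (fun x => mulr1 (x : R))
  (fun b x y => mulrDl (x : R) y b) (fun x b c => mulrDr (x : R) b c)
  (fun a x b => mulrA a (x : R) b).
End RegularBimodule.

Record bihom (A B : pzRingType) (M N : bimodType A B) := Bihom {
  bihom_fun :> M -> N;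
  bihom_linear : linear bihom_fun;
  bihom_rscale : forall b, {morph bihom_fun : x / rscale x b}
}.

Section BihomTheory.
Variables A B : pzRingType.
Implicit Types M N P : bimodType A B.

HB.instance Definition _ M N (f : bihom M N) :=
  GRing.isLinear.Build A M N *:%R (bihom_fun f) (@bihom_linear _ _ _ _ f).

Lemma rscale0l M (b : B) : rscale (0 : M) b = 0.
Proof. by apply: (addIr (rscale 0 b)); rewrite -rscaleDl !add0r. Qed.

Lemma bihom0 M N (f : bihom M N) : f 0 = 0. Proof. exact: linear0. Qed.
Lemma bihomB M N (f : bihom M N) : {morph f : x y / x - y}.
Proof. exact: linearB. Qed.
Lemma bihomD M N (f : bihom M N) : {morph f : x y / x + y}.
Proof. exact: linearD. Qed.
Lemma bihomZ M N (f : bihom M N) a : {morph f : x / a *: x}.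
Proof. exact: linearZ. Qed.

Definition bihom_id M : bihom M M.
Proof. by exists id. Defined.

Definition bihom_zero M N : bihom M N.
Proof.
exists (fun=> 0); first by move=> a x y; rewrite scaler0 addr0.
by move=> b x; rewrite rscale0l.
Defined.

Definition bihom_comp M N P (g : bihom N P) (f : bihom M N) : bihom M P.
Proof.
exists (g \o f); first by move=> a x y /=; rewrite !linearP.
by move=> b x /=; rewrite !bihom_rscale.
Defined.

End BihomTheory.

(** ** Products *)

Section Product.
Variables (A B : pzRingType) (I : Type) (M : I -> bimodType A B).

Definition bprod := forall i, M i.

HB.instance Definition _ := Choice.on bprod.

Implicit Types f g h : bprod.

Let padd f g : bprod := fun i => f i + g i.
Let popp f : bprod := fun i => - f i.
Let pzero : bprod := fun=> 0.

Fact bprod_addA : associative padd.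
Proof. by move=> f g h; apply: functional_extensionality_dep => i; exact: addrA. Qed.
Fact bprod_addC : commutative padd.
Proof. by move=> f g; apply: functional_extensionality_dep => i; exact: addrC. Qed.
Fact bprod_add0 : left_id pzero padd.
Proof. by move=> f; apply: functional_extensionality_dep => i; exact: add0r. Qed.
Fact bprod_addN : left_inverse pzero popp padd.
Proof. by move=> f; apply: functional_extensionality_dep => i; exact: addNr. Qed.

HB.instance Definition _ :=
  GRing.isZmodule.Build bprod bprod_addA bprod_addC bprod_add0 bprod_addN.

Let pscale (a : A) f : bprod := fun i => a *: f i.

Fact bprod_scaleA a b f : pscale a (pscale b f) = pscale (a * b) f.
Proof. by apply: functional_extensionality_dep => i; exact: scalerA. Qed.
Fact bprod_scale1 : left_id 1 pscale.
Proof. by move=> f; apply: functional_extensionality_dep => i; exact: scale1r. Qed.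
Fact bprod_scaleDr : right_distributive pscale +%R.
Proof. by move=> a f g; apply: functional_extensionality_dep => i; exact: scalerDr. Qed.
Fact bprod_scaleDl f : {morph pscale^~ f : a b / a + b}.
Proof. by move=> a b; apply: functional_extensionality_dep => i; exact: scalerDl. Qed.

HB.instance Definition _ := GRing.Zmodule_isLmodule.Build A bprod
  bprod_scaleA bprod_scale1 bprod_scaleDr bprod_scaleDl.

Let prscale f (b : B) : bprod := fun i => rscale (f i) b.

Fact bprod_rscaleA f b c : prscale (prscale f b) c = prscale f (b * c).
Proof. by apply: functional_extensionality_dep => i; exact: rscaleA. Qed.
Fact bprod_rscale1 f : prscale f 1 = f.
Proof. by apply: functional_extensionality_dep => i; exact: rscale1. Qed.
Fact bprod_rscaleDl b : {morph prscale^~ b : f g / f + g}.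
Proof. by move=> f g; apply: functional_extensionality_dep => i; exact: rscaleDl. Qed.
Fact bprod_rscaleDr f : {morph prscale f : b c / b + c}.
Proof. by move=> b c; apply: functional_extensionality_dep => i; exact: rscaleDr. Qed.
Fact bprod_scale_rscale a f b : a *: prscale f b = prscale (a *: f) b.
Proof. by apply: functional_extensionality_dep => i; exact: scale_rscale. Qed.

HB.instance Definition _ := Lmodule_isBimodule.Build A B bprod
  bprod_rscaleA bprod_rscale1 bprod_rscaleDl bprod_rscaleDr bprod_scale_rscale.

Lemma bprodDE f g i : (f + g) i = f i + g i. Proof. by []. Qed.
Lemma bprod0E i : (0 : bprod) i = 0. Proof. by []. Qed.
Lemma bprodZE a f i : (a *: f) i = a *: f i. Proof. by []. Qed.
Lemma bprodRE f b i : (rscale f b) i = rscale (f i) b. Proof. by []. Qed.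

End Product.

(** ** Sub-bimodules and quotients *)

Section SubQuotient.
Variables A B : pzRingType.

Record subbimod (M : bimodType A B) := Subbimod {
  subbimod_mem : {pred M};
  subbimod_closed : submod_closed subbimod_mem;
  subbimod_rscale : forall b x, x \in subbimod_mem -> rscale x b \in subbimod_mem
}.

HB.instance Definition _ (M : bimodType A B) (N : subbimod M) :=
  GRing.isSubmodClosed.Build A M (subbimod_mem N) (subbimod_closed N).

Section Sub.
Variables (M : bimodType A B) (N : subbimod M).

Definition submod := {x : M | x \in subbimod_mem N}.
HB.instance Definition _ := [isSub of submod for @sval _ _].
HB.instance Definition _ := [Choice of submod by <:].
HB.instance Definition _ := [SubChoice_isSubLmodule of submod by <:].

Definition sub_rscale (x : submod) (b : B) : submod :=
  Sub (rscale (val x) b) (subbimod_rscale b (valP x)).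

Fact sub_rscaleA x b c : sub_rscale (sub_rscale x b) c = sub_rscale x (b * c).
Proof. by apply: val_inj; exact: rscaleA. Qed.
Fact sub_rscale1 x : sub_rscale x 1 = x.
Proof. by apply: val_inj; exact: rscale1. Qed.
Fact sub_rscaleDl b : {morph sub_rscale^~ b : x y / x + y}.
Proof. by move=> x y; apply: val_inj; exact: rscaleDl. Qed.
Fact sub_rscaleDr x : {morph sub_rscale x : b c / b + c}.
Proof. by move=> b c; apply: val_inj; exact: rscaleDr. Qed.
Fact sub_scale_rscale a x b : a *: sub_rscale x b = sub_rscale (a *: x) b.
Proof. by apply: val_inj; exact: scale_rscale. Qed.

HB.instance Definition _ := Lmodule_isBimodule.Build A B submod
  sub_rscaleA sub_rscale1 sub_rscaleDl sub_rscaleDr sub_scale_rscale.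

Definition sub_incl : bihom submod M.
Proof. by exists val; [exact: linearP|]. Defined.

End Sub.

Definition sub_corestr (M P : bimodType A B) (N : subbimod P) (f : bihom M P)
  (fN : forall x, f x \in subbimod_mem N) : bihom M (submod N).
Proof.
exists (fun x => Sub (f x) (fN x)).
  by move=> a x y; apply: val_inj; rewrite /= !linearP.
by move=> b x; apply: val_inj; exact: bihom_rscale.
Defined.

Section Quotient.
Variables (M : bimodType A B) (N : subbimod M).
Local Open Scope quotient_scope.

Definition quotmod := Quotient.quot (subbimod_mem N).
HB.instance Definition _ := GRing.Zmodule.on quotmod.
HB.instance Definition _ := EqQuotient.on quotmod.

Lemma quotmod_eq (x y : M) :
  (x == y %[mod quotmod]) = (x - y \in subbimod_mem N).
Proof. by rewrite Quotient.idealrBE. Qed.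

Lemma quotmodP (x y : M) :
  reflect (\pi_quotmod x = \pi_quotmod y) (x - y \in subbimod_mem N).
Proof. by rewrite -quotmod_eq; exact: eqP. Qed.

Lemma quotmodD x y : \pi_quotmod (x + y) = \pi_quotmod x + \pi_quotmod y.
Proof. by rewrite !piE. Qed.

Let qscale (a : A) (x : quotmod) : quotmod := \pi_quotmod (a *: repr x).
Let qrscale (x : quotmod) (b : B) : quotmod := \pi_quotmod (rscale (repr x) b).

Fact repr_quotmod x : repr (\pi_quotmod x) - x \in subbimod_mem N.
Proof. by apply/quotmodP; rewrite reprK. Qed.

Fact quotmodZ a x : qscale a (\pi_quotmod x) = \pi_quotmod (a *: x).
Proof.
apply/quotmodP; rewrite -scalerBr.
by case: (subbimod_closed N) => N0 NP; rewrite -[_ *: _]addr0 NP ?repr_quotmod.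
Qed.

Lemma rscaleN (P : bimodType A B) (x : P) b : rscale (- x) b = - rscale x b.
Proof. by apply/eqP; rewrite -addr_eq0 -rscaleDl addNr rscale0l. Qed.

Fact quotmodR x b : qrscale (\pi_quotmod x) b = \pi_quotmod (rscale x b).
Proof.
apply/quotmodP; rewrite -rscaleN -rscaleDl; apply: subbimod_rscale.
exact: repr_quotmod.
Qed.

Lemma quotmod_ind (P : quotmod -> Prop) :
  (forall x, P (\pi_quotmod x)) -> forall x, P x.
Proof. by move=> Ppi x; rewrite -[x]reprK. Qed.

Fact quot_scaleA a b x : qscale a (qscale b x) = qscale (a * b) x.
Proof. by elim/quotmod_ind: x => x; rewrite !quotmodZ scalerA. Qed.
Fact quot_scale1 : left_id 1 qscale.
Proof. by elim/quotmod_ind=> x; rewrite !quotmodZ scale1r. Qed.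
Fact quot_scaleDr : right_distributive qscale +%R.
Proof.
move=> a; elim/quotmod_ind=> x; elim/quotmod_ind=> y; rewrite -quotmodD !quotmodZ.
by rewrite scalerDr quotmodD.
Qed.
Fact quot_scaleDl x : {morph qscale^~ x : a b / a + b}.
Proof. by elim/quotmod_ind: x => x a b; rewrite !quotmodZ scalerDl quotmodD. Qed.

HB.instance Definition _ := GRing.Zmodule_isLmodule.Build A quotmod
  quot_scaleA quot_scale1 quot_scaleDr quot_scaleDl.

Fact quot_rscaleA x b c : qrscale (qrscale x b) c = qrscale x (b * c).
Proof. by elim/quotmod_ind: x => x; rewrite !quotmodR rscaleA. Qed.
Fact quot_rscale1 x : qrscale x 1 = x.
Proof. by elim/quotmod_ind: x => x; rewrite !quotmodR rscale1. Qed.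
Fact quot_rscaleDl b : {morph qrscale^~ b : x y / x + y}.
Proof.
elim/quotmod_ind=> x; elim/quotmod_ind=> y; rewrite -quotmodD !quotmodR.
by rewrite rscaleDl quotmodD.
Qed.
Fact quot_rscaleDr x : {morph qrscale x : b c / b + c}.
Proof. by elim/quotmod_ind: x => x b c; rewrite !quotmodR rscaleDr quotmodD. Qed.
Fact quot_scale_rscale a x b : a *: qrscale x b = qrscale (a *: x) b.
Proof.
elim/quotmod_ind: x => x; rewrite quotmodR -[LHS]/(qscale _ _) -[a *: _]/(qscale _ _).
by rewrite !quotmodZ quotmodR scale_rscale.
Qed.

HB.instance Definition _ := Lmodule_isBimodule.Build A B quotmod
  quot_rscaleA quot_rscale1 quot_rscaleDl quot_rscaleDr quot_scale_rscale.

Definition quot_pi : bihom M quotmod.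
Proof.
exists \pi_quotmod; first by move=> a x y; rewrite quotmodD -quotmodZ.
by move=> b x; rewrite -quotmodR.
Defined.

Lemma quot_piK : cancel (repr : quotmod -> M) quot_pi.
Proof. exact: reprK. Qed.

Lemma quot_piP x y : reflect (quot_pi x = quot_pi y) (x - y \in subbimod_mem N).
Proof. exact: quotmodP. Qed.

Lemma repr_quot0 : repr (0 : quotmod) \in subbimod_mem N.
Proof.
rewrite -[X in X \in _]subr0; apply/quot_piP.
by rewrite quot_piK bihom0.
Qed.

Section Lift.
Variables (P : bimodType A B) (f : bihom M P).
Hypothesis fN : forall x, x \in subbimod_mem N -> f x = 0.

Lemma quot_lift_repr x : f (repr (quot_pi x)) = f x.
Proof. by apply/eqP; rewrite -subr_eq0 -bihomB fN// repr_quotmod. Qed.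

Definition quot_lift : bihom quotmod P.
Proof.
exists (fun x => f (repr x)).
  move=> a x y; rewrite -[x]quot_piK -[y]quot_piK -(bihom_linear quot_pi).
  by rewrite !quot_lift_repr bihom_linear.
move=> b x; rewrite -[x]quot_piK -(bihom_rscale quot_pi).
by rewrite !quot_lift_repr bihom_rscale.
Defined.

Lemma quot_liftE x : quot_lift (quot_pi x) = f x.
Proof. exact: quot_lift_repr. Qed.

End Lift.
End Quotient.
End SubQuotient.

(** ** Homology *)

Section Homology.
Variables A B : pzRingType.

Definition kernel (M P : bimodType A B) (g : bihom M P) : subbimod M.
Proof.
refine (@Subbimod _ _ _ [pred x | g x == 0] _ _) => [|b x]; last first.
  by rewrite !inE bihom_rscale => /eqP->; rewrite rscale0l.
split=> [|a x y]; rewrite !inE ?bihom0// bihom_linear => /eqP-> /eqP->.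
by rewrite scaler0 addr0.
Defined.

(* The image of [f], seen inside the kernel of [g]. *)
Definition boundaries (L M P : bimodType A B) (f : bihom L M) (g : bihom M P) :
  subbimod (submod (kernel g)).
Proof.
refine (@Subbimod _ _ _
  [pred z : submod (kernel g) | `[< exists y, val z = f y >]] _ _) => [|b x]; last first.
  move=> /asboolP[y xy]; apply/asboolP; exists (rscale y b).
  by rewrite bihom_rscale -xy.
split=> [|a x x'].
  by apply/asboolP; exists 0; rewrite bihom0.
move=> /asboolP[y xy] /asboolP[y' xy']; apply/asboolP; exists (a *: y + y').
by rewrite bihom_linear -xy -xy'.
Defined.

Definition homology (L M P : bimodType A B) (f : bihom L M) (g : bihom M P) :
  bimodType A B := quotmod (boundaries f g).

(* The class of a cycle; junk outside the kernel of [g]. *)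
Definition hclass (L M P : bimodType A B) (f : bihom L M) (g : bihom M P)
  (x : M) : homology f g := quot_pi (boundaries f g) (insubd 0 x).

Definition hrepr (L M P : bimodType A B) (f : bihom L M) (g : bihom M P)
  (c : homology f g) : M := val (repr c).

Section Theory.
Variables (L M P : bimodType A B) (f : bihom L M) (g : bihom M P).

Lemma hrepr_cycle (c : homology f g) : g (hrepr c) = 0.
Proof. exact/eqP/(valP (repr c)). Qed.

Lemma hreprK : cancel (@hrepr _ _ _ f g) (hclass f g).
Proof. by move=> c; rewrite /hclass valKd; exact: quot_piK. Qed.

Lemma hclass0 : hclass f g 0 = 0.
Proof.
rewrite /hclass -[RHS](bihom0 (quot_pi _)); congr (quot_pi _ _).
by apply: val_inj; rewrite insubdK// inE bihom0.
Qed.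

Lemma hclassP x y : g x = 0 -> g y = 0 ->
  hclass f g x = hclass f g y <-> exists z, x - y = f z.
Proof.
move=> gx gy.
have vx : val (insubd (0 : submod (kernel g)) x) = x.
  by rewrite insubdK// inE gx.
have vy : val (insubd (0 : submod (kernel g)) y) = y.
  by rewrite insubdK// inE gy.
split=> [/quot_piP/asboolP[z]|[z xyz]].
  by rewrite linearB /= vx vy => ?; exists z.
by apply/quot_piP/asboolP; exists z; rewrite linearB /= vx vy.
Qed.

Lemma hrepr0 : (forall y : L, y = 0) -> hrepr (0 : homology f g) = 0.
Proof.
move=> L0; have h0 : hclass f g (hrepr (0 : homology f g)) = hclass f g 0.
  by rewrite hreprK hclass0.
have [y] := (hclassP (hrepr_cycle _) (bihom0 g)).1 h0.
by rewrite subr0 (L0 y) bihom0.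
Qed.

End Theory.

Section Map.
Variables (L M P L' M' P' : bimodType A B).
Variables (f : bihom L M) (g : bihom M P) (f' : bihom L' M') (g' : bihom M' P').
Variable h : bihom M M'.
Hypothesis h_cycle : forall x, g x = 0 -> g' (h x) = 0.
Hypothesis h_boundary : forall y, exists y', h (f y) = f' y'.

Definition cycles_map : bihom (submod (kernel g)) (submod (kernel g')).
Proof.
apply: (@sub_corestr _ _ _ _ _ (bihom_comp h (sub_incl (kernel g)))) => x.
by apply/eqP/h_cycle/eqP/(valP x).
Defined.

Definition homology_map : bihom (homology f g) (homology f' g').
Proof.
apply: (@quot_lift _ _ _ _ _ (bihom_comp (quot_pi _) cycles_map)) => x.
move=> /asboolP[y xy]; have [y' hy'] := h_boundary y.
rewrite /= -(bihom0 (quot_pi (boundaries f' g'))); apply/quot_piP/asboolP.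
by exists y'; rewrite subr0 /= -hy' -xy.
Defined.

Lemma homology_mapE x : g x = 0 ->
  homology_map (hclass f g x) = hclass f' g' (h x).
Proof.
move=> gx; rewrite /homology_map /hclass quot_liftE.
apply: (congr1 (quot_pi (boundaries f' g'))).
by apply: val_inj; rewrite /= !insubdK// ?inE ?gx ?h_cycle.
Qed.

End Map.

Lemma homology_map_id (L M P : bimodType A B) (f : bihom L M) (g : bihom M P)
    (h : bihom M M) hc hb (c : homology f g) :
  h =1 id -> @homology_map L M P L M P f g f g h hc hb c = c.
Proof.
move=> hid; rewrite -[in LHS](hreprK c) homology_mapE ?hrepr_cycle//.
by rewrite hid hreprK.
Qed.

Lemma homology_map_comp (L M P L' M' P' L2 M2 P2 : bimodType A B)
    (f : bihom L M) (g : bihom M P) (f' : bihom L' M') (g' : bihom M' P')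
    (f2 : bihom L2 M2) (g2 : bihom M2 P2)
    (h : bihom M M') (h' : bihom M' M2) (h2 : bihom M M2)
    hc hb hc' hb' hc2 hb2 (c : homology f g) :
  h' \o h =1 h2 ->
  @homology_map _ _ _ _ _ _ f' g' f2 g2 h' hc' hb'
    (@homology_map _ _ _ _ _ _ f g f' g' h hc hb c) =
  @homology_map _ _ _ _ _ _ f g f2 g2 h2 hc2 hb2 c.
Proof.
move=> hh; rewrite -(hreprK c) !homology_mapE ?hrepr_cycle//.
  by rewrite -hh.
by apply: hc; exact: hrepr_cycle.
Qed.

(* [induces_iso f g f' g' h] says that the map [h] from the middle term of
   [f, g] to that of [f', g'] induces a well-defined isomorphism of bimodules
   from ker g / im f to ker g' / im f'. *)
Definition induces_iso (L M P L' M' P' : bimodType A B)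
  (f : bihom L M) (g : bihom M P) (f' : bihom L' M') (g' : bihom M' P')
  (h : M -> M') : Prop :=
  exists Phi : bihom (homology f g) (homology f' g'),
    bijective Phi /\
    forall z, g z = 0 -> g' (h z) = 0 /\ Phi (hclass f g z) = hclass f' g' (h z).

(** ** Direct sums and direct products *)

Section DirectSum.
Variables (fin : bool) (I : choiceType) (M : I -> bimodType A B).

Definition support (c : bprod M) : set I := [set i | c i != 0].

Definition supp_cond : subbimod (bprod M).
Proof.
refine (@Subbimod _ _ _
  [pred c : bprod M | fin ==> `[< finite_set (support c) >]] _ _) => [|b c].
  split=> [|a c c']; rewrite !inE; case: fin => //=.
    by apply/asboolP; apply: sub_finite_set (finite_set0 _) => i /eqP.
  move=> /asboolP fc /asboolP fc'; apply/asboolP.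
  apply: (@sub_finite_set _ _ (support c `|` support c')%classic).
    move=> i; rewrite /support /= bprodDE bprodZE => ci.
    have [ci0|] := eqVneq (c i) 0; [right|by left].
    by move: ci; rewrite ci0 scaler0 add0r.
  by rewrite finite_setU.
rewrite !inE; case: fin => //= /asboolP fc; apply/asboolP.
apply: (@sub_finite_set _ _ (support c)) fc.
move=> i; rewrite /support /= bprodRE; apply: contra_neq => ->.
by rewrite rscale0l.
Defined.

(* The direct sum of the M_i if [fin] holds, their product otherwise. *)
Definition dsum : bimodType A B := submod supp_cond.

Definition mk_dsum (c : bprod M) (cP : c \in subbimod_mem supp_cond) : dsum :=
  exist _ c cP.

Definition coeff (c : dsum) : bprod M := val c.

Lemma coeff_linear : linear coeff. Proof. by []. Qed.
Lemma coeff0 i : coeff 0 i = 0. Proof. by []. Qed.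
Lemma coeffP a c c' i : coeff (a *: c + c') i = a *: coeff c i + coeff c' i.
Proof. by []. Qed.
Lemma coeffR b c i : coeff (rscale c b) i = rscale (coeff c i) b.
Proof. by []. Qed.
Lemma coeff_fin (c : dsum) : fin -> finite_set (support (coeff c)).
Proof. by move=> finT; have /implyP/(_ finT)/asboolP := valP c. Qed.
Lemma coeff_inj : injective coeff. Proof. exact: val_inj. Qed.

End DirectSum.
End Homology.

(** * Simplicial complexes *)

Local Open Scope fset_scope.

(* Locally finite simplicial complexes of dimension n with vertices in V.
   Not every element of V has to be a vertex. *)
Record lfcomplex (V : choiceType) (n : nat) := Lfcomplex {
  sc_mem : pred {fset V};
  sc_neq0 : forall s, sc_mem s -> s != fset0;
  sc_closed : forall s t, t `<=` s -> t != fset0 -> sc_mem s -> sc_mem t;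
  sc_locfin : forall v, finite_set [set s | sc_mem s /\ v \in s];
  sc_dim_le : forall s, sc_mem s -> (#|` s| <= n.+1)%N;
  sc_dim_eq : exists2 s, sc_mem s & #|` s| = n.+1
}.

Section Complexes.
Variables (V : choiceType) (n : nat) (X : lfcomplex V n).

Definition simplex := {s : {fset V} | sc_mem X s}.
HB.instance Definition _ := [isSub of simplex for @sval _ _].
HB.instance Definition _ := [Choice of simplex by <:].

Definition dim (s : simplex) : int := #|` val s|%:Z - 1.

(* s is a face of t, possibly t itself *)
Definition sle (s t : simplex) : bool := val s `<=` val t.

Lemma sle_refl s : sle s s. Proof. exact: fsubset_refl. Qed.
Lemma sle_trans s t u : sle s t -> sle t u -> sle s u.
Proof. exact: fsubset_trans. Qed.

Record subcomplex := Subcomplex {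
  sub_mem : {pred simplex};
  sub_closed : forall s t, sle s t -> t \in sub_mem -> s \in sub_mem
}.

Definition full_sub : subcomplex.
Proof. by exists predT. Defined.

Definition vertex_of (K : subcomplex) (v : V) : bool :=
  `[< exists2 s, s \in sub_mem K & v \in val s >].

Definition is_full (K : subcomplex) : Prop :=
  forall s : simplex, {in val s, forall v, vertex_of K v} -> s \in sub_mem K.

Definition vertex_complement (K : subcomplex) : subcomplex.
Proof.
exists [pred s : simplex | `[< {in val s, forall v, ~~ vertex_of K v} >]].
move=> s t /fsubsetP st /asboolP tK; apply/asboolP => v vs.
exact/tK/st.
Defined.

(* X minus the open star of s *)
Definition off_star (s : simplex) : subcomplex.
Proof.
exists [pred t | ~~ sle s t] => t u tu; rewrite !inE; apply: contra => st.
exact: sle_trans tu.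
Defined.

Lemma off_starS s t : sle s t ->
  {subset sub_mem (off_star s) <= sub_mem (off_star t)}.
Proof. by move=> st u; rewrite !inE; apply: contra; exact: sle_trans. Qed.

Lemma finite_star (s : simplex) : finite_set [set t : simplex | sle s t].
Proof.
have /fset0Pn[v vs] := sc_neq0 (valP s).
apply: (@sub_finite_set _ _ (val @^-1` [set t | sc_mem X t /\ v \in t])%classic).
  by move=> t /fsubsetP st; split; [exact: valP|exact: st].
apply: finite_preimage (sc_locfin X v) => t u _ _; exact: val_inj.
Qed.

Lemma finite_faces (s : simplex) : finite_set [set t : simplex | sle t s].
Proof.
apply: (@sub_finite_set _ _ (val @^-1` [set` fpowerset (val s)])%classic).
  by move=> t ts; rewrite /= fpowersetE.
by apply: finite_preimage => // t u _ _; exact: val_inj.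
Qed.

Definition star (s : simplex) : {fset simplex} :=
  fset_set [set t : simplex | sle s t].

(* k-simplices of the subcomplex K *)
Definition simp (K : subcomplex) (k : int) :=
  {s : simplex | (s \in sub_mem K) && (dim s == k)}.
HB.instance Definition _ K k := [isSub of simp K k for @sval _ _].
HB.instance Definition _ K k := [Choice of simp K k by <:].

Definition find_simp (K : subcomplex) (k : int) (s : {fset V}) :
  option (simp K k) := obind insub (insub s : option simplex).

(* If finitely many simplices are given, only finitely many simplices are faces
   of a simplex having one of these as a face. *)
Lemma finite_near (K K' : subcomplex) k l (D : set (simp K k)) :
  finite_set D ->
  finite_set [set t : simp K' l | exists2 s, D s &
    exists2 u, sle (val s) u & sle (val t) u].
Proof.
move=> finD; apply: (@sub_finite_set _ _ (val @^-1`
  (\bigcup_(s in D) \bigcup_(u in [set u | sle (val s) u])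
     [set t | sle t u]))%classic).
  by move=> t [s Ds [u su tu]]; exists s => //; exists u.
apply: finite_preimage => [t t' _ _|]; first exact: val_inj.
apply: bigcup_finite => // s _; apply: bigcup_finite => [|u _].
  exact: finite_star.
exact: finite_faces.
Qed.

(** ** Orientations *)

Record orientation := Orientation {
  ord : simplex -> rel V;
  ord_refl : forall s, {in val s, reflexive (ord s)};
  ord_anti : forall s, {in val s &, antisymmetric (ord s)};
  ord_trans : forall s, {in val s & &, transitive (ord s)};
  ord_total : forall s, {in val s &, total (ord s)};
  ord_face : forall s t, sle s t -> {in val s &, ord s =2 ord t}
}.

Definition is_before (o : orientation) (K K' : subcomplex) : Prop :=
  forall (s : simplex) v w, v \in val s -> w \in val s ->
    vertex_of K v -> vertex_of K' w -> v != w /\ ord o s v w.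

Definition vertices (o : orientation) (s : simplex) : seq V :=
  sort (ord o s) (val s).

(* the face omitting the i-th vertex *)
Definition omit o (i : nat) (s : simplex) : {fset V} :=
  [fset v in take i (vertices o s) ++ drop i.+1 (vertices o s)].
(* the face spanned by the vertices 0, ..., i *)
Definition front o (i : nat) (s : simplex) : {fset V} :=
  [fset v in take i.+1 (vertices o s)].
(* the face spanned by the vertices i, ..., dim s *)
Definition back o (i : nat) (s : simplex) : {fset V} :=
  [fset v in drop i (vertices o s)].

Lemma omit_sub o i s : omit o i s `<=` val s.
Proof.
apply/fsubsetP => v; rewrite in_fset mem_cat => /orP[/mem_take|/mem_drop];
by rewrite mem_sort.
Qed.

Lemma front_sub o i s : front o i s `<=` val s.
Proof. by apply/fsubsetP => v; rewrite in_fset => /mem_take; rewrite mem_sort. Qed.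

Lemma back_sub o i s : back o i s `<=` val s.
Proof. by apply/fsubsetP => v; rewrite in_fset => /mem_drop; rewrite mem_sort. Qed.

Lemma omit_sle o i s t : omit o i s = val t -> sle t s.
Proof. by rewrite /sle => <-; exact: omit_sub. Qed.

Lemma find_simpE K k s (t : simp K k) :
  find_simp K k s = Some t -> val (val t) = s.
Proof.
rewrite /find_simp; case: insubP => //= u _ <-.
by case: insubP => //= t' _ <- [->].
Qed.

Lemma find_simpK K k (t : simp K k) : find_simp K k (val (val t)) = Some t.
Proof. by rewrite /find_simp valK /= valK. Qed.

(** ** Sheaves and cosheaves *)

Record sheaf (A B : pzRingType) := Sheaf {
  sh_ob :> simplex -> bimodType A B;
  sh_map : forall s t, sle s t -> bihom (sh_ob s) (sh_ob t);
  sh_map_id : forall s (ss : sle s s) x, sh_map ss x = x;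
  sh_map_comp : forall s t u (st : sle s t) (tu : sle t u) (su : sle s u) x,
    sh_map tu (sh_map st x) = sh_map su x
}.

Record cosheaf (A B : pzRingType) := Cosheaf {
  cosh_ob :> simplex -> bimodType A B;
  cosh_map : forall s t, sle s t -> bihom (cosh_ob t) (cosh_ob s);
  cosh_map_id : forall s (ss : sle s s) x, cosh_map ss x = x;
  cosh_map_comp : forall s t u (st : sle s t) (tu : sle t u) (su : sle s u) x,
    cosh_map st (cosh_map tu x) = cosh_map su x
}.

(* An abelian group has exactly one Z-module structure, and it commutes with
   every additive action: left R-modules are (R, Z)-bimodules and right
   R-modules are (Z, R)-bimodules, with the same morphisms. *)
Definition left_sheaf (R : pzRingType) := sheaf R int.
Definition right_cosheaf (R : pzRingType) := cosheaf int R.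

Definition const_sheaf A B (M : bimodType A B) : sheaf A B.
Proof. by exists (fun=> M) (fun _ _ _ => bihom_id M). Defined.

Definition const_cosheaf A B (M : bimodType A B) : cosheaf A B.
Proof. by exists (fun=> M) (fun _ _ _ => bihom_id M). Defined.

Section Sheaves.
Variables A B : pzRingType.

(* F(s < t), or 0 if s is not a face of t *)
Definition shm (F : sheaf A B) (s t : simplex) : bihom (F s) (F t) :=
  if @idP (sle s t) is ReflectT st then sh_map F st else bihom_zero _ _.

(* G(t > s), or 0 if s is not a face of t *)
Definition coshm (G : cosheaf A B) (t s : simplex) : bihom (G t) (G s) :=
  if @idP (sle s t) is ReflectT st then cosh_map G st else bihom_zero _ _.

Lemma shmE F s t (st : sle s t) : shm F s t = sh_map F st.
Proof.
rewrite /shm; case: {-}_ / idP => [st'|//].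
by rewrite (bool_irrelevance st st').
Qed.

Lemma coshmE G s t (st : sle s t) : coshm G t s = cosh_map G st.
Proof.
rewrite /coshm; case: {-}_ / idP => [st'|//].
by rewrite (bool_irrelevance st st').
Qed.

End Sheaves.

(** ** Chains and cochains *)

Section Chains.
Variables (o : orientation) (fin : bool) (A B : pzRingType).

Section Cochains.
Variable F : sheaf A B.

(* C^k_c(K; F) if [fin] holds, C^k(K; F) otherwise *)
Definition cochains (K : subcomplex) (k : int) : bimodType A B :=
  dsum fin (fun s : simp K k => F (val s)).

Section Coboundary.
Variables (K : subcomplex) (k k' : int).

Definition cobound_fun (phi : bprod (fun s : simp K k => F (val s))) :
    bprod (fun s : simp K k' => F (val s)) := fun s =>
  \sum_(i < #|` val (val s)|)
    oapp (fun t : simp K k => (-1) ^+ i *: shm F (val t) (val s) (phi t)) 0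
         (find_simp K k (omit o i (val s))).

Fact cobound_linear : linear cobound_fun.
Proof.
move=> a x y; apply: functional_extensionality_dep => s.
rewrite /cobound_fun bprodDE bprodZE scaler_sumr -big_split.
apply: eq_bigr => i _ /=; case: find_simp => [t|] /=; last first.
  by rewrite scaler0 addr0.
by rewrite bihom_linear scalerDr !scalerA commr_sign.
Qed.

Fact cobound_rscale b : {morph cobound_fun : x / rscale x b}.
Proof.
move=> x; apply: functional_extensionality_dep => s.
rewrite /cobound_fun bprodRE (big_morph (fun x => rscale x b)
  (@rscaleDl _ _ _ b) (rscale0l _ b)).
apply: eq_bigr => i _ /=; case: find_simp => [t|] /=; last by rewrite rscale0l.
by rewrite bprodRE bihom_rscale scale_rscale.
Qed.

Fact cobound_supp (phi : cochains K k) :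
  cobound_fun (coeff phi) \in subbimod_mem (supp_cond fin _).
Proof.
rewrite inE; apply/implyP => finT; apply/asboolP.
have /(finite_near K k') := coeff_fin phi finT.
apply: sub_finite_set => s /=; apply: contra_neqP => phi0.
apply: big1 => i _; case E: find_simp => [t|] //=.
have [->|t0] := eqVneq (coeff phi t) 0; first by rewrite bihom0 scaler0.
case: phi0; exists t => //; exists (val s); last exact: sle_refl.
by rewrite /sle (find_simpE E) omit_sub.
Qed.

End Coboundary.

(* The coboundary C^k -> C^{k+1}; the map from degree k to degree k' is zero
   unless k' = k + 1. *)
Definition cobound K k k' : bihom (cochains K k) (cochains K k').
Proof.
apply: (@sub_corestr _ _ _ _ _
  (bihom_comp (Bihom (@cobound_linear K k k') (@cobound_rscale K k k'))
              (sub_incl _))).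
exact: cobound_supp.
Defined.

End Cochains.

Section ChainGroups.
Variable G : cosheaf A B.

(* C_k(K; G) if [fin] holds, C_k^lf(K; G) otherwise *)
Definition chains (K : subcomplex) (k : int) : bimodType A B :=
  dsum fin (fun s : simp K k => G (val s)).

Section Boundary.
Variables (K : subcomplex) (k k' : int).

(* The coefficient at t collects the terms (-1)^i G(s > t) c_s such that t is
   the i-th facet of s; the sum is finite because the star of t is. *)
Definition bound_fun (c : bprod (fun s : simp K k => G (val s))) :
    bprod (fun s : simp K k' => G (val s)) := fun t =>
  \sum_(s0 <- star (val t)) oapp (fun s : simp K k =>
    \sum_(i < #|` val (val s)| | omit o i (val s) == val (val t))
      (-1) ^+ i *: coshm G (val s) (val t) (c s)) 0 (insub s0).

Fact bound_linear : linear bound_fun.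
Proof.
move=> a x y; apply: functional_extensionality_dep => t.
rewrite /bound_fun bprodDE bprodZE scaler_sumr -big_split.
apply: eq_bigr => s0 _ /=; case: insub => [s|] /=; last first.
  by rewrite scaler0 addr0.
rewrite scaler_sumr -big_split; apply: eq_bigr => i _ /=.
by rewrite bihom_linear scalerDr !scalerA commr_sign.
Qed.

Fact bound_rscale b : {morph bound_fun : x / rscale x b}.
Proof.
have rs (M : bimodType A B) I (r : seq I) P (F : I -> M) :
    rscale (\sum_(i <- r | P i) F i) b = \sum_(i <- r | P i) rscale (F i) b.
  by rewrite (big_morph (fun x => rscale x b) (@rscaleDl _ _ _ b) (rscale0l _ b)).
move=> x; apply: functional_extensionality_dep => t.
rewrite /bound_fun bprodRE rs.
apply: eq_bigr => s0 _ /=; case: insub => [s|] /=; last by rewrite rscale0l.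
rewrite rs; apply: eq_bigr => i _.
by rewrite bprodRE bihom_rscale scale_rscale.
Qed.

Fact bound_supp (c : chains K k) :
  bound_fun (coeff c) \in subbimod_mem (supp_cond fin _).
Proof.
rewrite inE; apply/implyP => finT; apply/asboolP.
have /(finite_near K k') := coeff_fin c finT.
apply: sub_finite_set => t /=; apply: contra_neqP => c0.
apply: big1 => s0 _; case: insub => [s|] //=.
apply: big1 => i /eqP st.
have [->|s0'] := eqVneq (coeff c s) 0; first by rewrite bihom0 scaler0.
case: c0; exists s => //; exists (val s); first exact: sle_refl.
exact: omit_sle st.
Qed.

(* The boundary C_k -> C_{k-1}; the map from degree k to degree k' is zero
   unless k' = k - 1. *)
Definition bound : bihom (chains K k) (chains K k').
Proof.
apply: (@sub_corestr _ _ _ _ _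
  (bihom_comp (Bihom bound_linear bound_rscale) (sub_incl _))).
exact: bound_supp.
Defined.

End Boundary.
End ChainGroups.

(** ** Relative groups of (X, K) *)

Section RelativeCochains.
Variables (F : sheaf A B) (K : subcomplex).

(* the kernel of restriction to K *)
Definition vanish_on (k : int) : subbimod (cochains F full_sub k).
Proof.
refine (@Subbimod _ _ _ [pred phi : cochains F full_sub k |
  `[< forall s : simp full_sub k, val s \in sub_mem K -> coeff phi s = 0 >]] _ _) => [|b x].
  split=> [|a x y]; first exact/asboolP.
  move=> /asboolP x0 /asboolP y0; apply/asboolP => s sK.
  by rewrite coeffP x0// y0// scaler0 addr0.
move=> /asboolP x0; apply/asboolP => s sK.
by rewrite coeffR x0// rscale0l.
Defined.

(* C^k_c(X, K; F) if [fin] holds, C^k(X, K; F) otherwise *)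
Definition rel_cochains (k : int) : bimodType A B := submod (vanish_on k).

Fact cobound_vanish k k' (phi : rel_cochains k) :
  cobound F full_sub k k' (val phi) \in subbimod_mem (vanish_on k').
Proof.
apply/asboolP => s sK; apply: big1 => i _.
case E: find_simp => [t|] //=.
have phit : coeff (val phi) t = 0.
  have /asboolP := valP phi; apply; apply: sub_closed sK.
  by rewrite /sle (find_simpE E) omit_sub.
by rewrite [X in shm _ _ _ X]phit bihom0 scaler0.
Qed.

Definition rel_cobound (k k' : int) :
  bihom (rel_cochains k) (rel_cochains k').
Proof.
apply: (@sub_corestr _ _ _ _ _
  (bihom_comp (cobound F full_sub k k') (sub_incl _))).
exact: cobound_vanish.
Defined.

End RelativeCochains.

Section RelativeChains.
Variables (G : cosheaf A B) (K : subcomplex).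

(* the image of the chains of K *)
Definition chains_in (k : int) : subbimod (chains G full_sub k).
Proof.
refine (@Subbimod _ _ _ [pred c : chains G full_sub k |
  `[< forall s : simp full_sub k, val s \notin sub_mem K -> coeff c s = 0 >]] _ _) => [|b x].
  split=> [|a x y]; first exact/asboolP.
  move=> /asboolP x0 /asboolP y0; apply/asboolP => s sK.
  by rewrite coeffP x0// y0// scaler0 addr0.
move=> /asboolP x0; apply/asboolP => s sK.
by rewrite coeffR x0// rscale0l.
Defined.

(* C_k(X, K; G) if [fin] holds, C_k^lf(X, K; G) otherwise *)
Definition rel_chains (k : int) : bimodType A B := quotmod (chains_in k).

Fact bound_in k k' (c : chains G full_sub k) :
  c \in subbimod_mem (chains_in k) ->
  bound G full_sub k k' c \in subbimod_mem (chains_in k').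
Proof.
move=> /asboolP c0; apply/asboolP => t tK.
apply: big1 => s0 _; case: insub => [s|] //=; apply: big1 => i /eqP st.
have cs : coeff c s = 0.
  by apply: c0; apply: contra tK; apply: sub_closed; exact: omit_sle st.
by rewrite [X in coshm _ _ _ X]cs bihom0 scaler0.
Qed.

Definition rel_bound (k k' : int) : bihom (rel_chains k) (rel_chains k').
Proof.
apply: (@quot_lift _ _ _ _ _
  (bihom_comp (quot_pi (chains_in k')) (bound G full_sub k k'))) => c cK.
rewrite /= -(bihom0 (quot_pi (chains_in k'))); apply/quot_piP.
by rewrite subr0; exact: bound_in.
Defined.

Lemma rel_boundE k k' c :
  rel_bound k k' (quot_pi _ c) = quot_pi _ (bound G full_sub k k' c).
Proof. exact: quot_liftE. Qed.

End RelativeChains.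

(** ** Maps induced by inclusions of pairs (X, K) -> (X, K') *)

Section Inclusion.
Variables (K K' : subcomplex).
Hypothesis KK' : {subset sub_mem K <= sub_mem K'}.

Definition rel_chains_incl (G : cosheaf A B) k :
  bihom (rel_chains G K k) (rel_chains G K' k).
Proof.
apply: (@quot_lift _ _ _ _ _ (quot_pi (chains_in G K' k))) => c.
move=> /asboolP c0; rewrite -(bihom0 (quot_pi (chains_in G K' k))).
apply/quot_piP/asboolP => s sK'; rewrite subr0 c0//.
by apply: contra sK'; exact: KK'.
Defined.

Lemma rel_chains_inclE G k c :
  rel_chains_incl G k (quot_pi _ c) = quot_pi _ c.
Proof. exact: quot_liftE. Qed.

Lemma rel_chains_incl_bound G k k' c :
  rel_chains_incl G k' (rel_bound G K k k' c) =
  rel_bound G K' k k' (rel_chains_incl G k c).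
Proof.
by rewrite -[c]quot_piK rel_boundE !rel_chains_inclE rel_boundE.
Qed.

Definition rel_cochains_incl (F : sheaf A B) k :
  bihom (rel_cochains F K' k) (rel_cochains F K k).
Proof.
apply: (@sub_corestr _ _ _ _ _ (sub_incl (vanish_on F K' k))) => phi.
apply/asboolP => s /KK' sK'; have /asboolP := valP phi; exact.
Defined.

Lemma rel_cochains_incl_cobound F k k' phi :
  rel_cochains_incl F k' (rel_cobound F K' k k' phi) =
  rel_cobound F K k k' (rel_cochains_incl F k phi).
Proof. exact: val_inj. Qed.

End Inclusion.
End Chains.

(** ** Local (co)homology *)

Section LocalHomology.
Variables (o : orientation) (A B : pzRingType).

(* H_k(X, X - st(s); G) *)
Definition loc_hom (G : cosheaf A B) (k : int) (s : simplex) : bimodType A B :=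
  homology (rel_bound o true G (off_star s) (k + 1) k)
           (rel_bound o true G (off_star s) k (k - 1)).

(* H^k(X, X - st(s); F) *)
Definition loc_cohom (F : sheaf A B) (k : int) (s : simplex) : bimodType A B :=
  homology (rel_cobound o false F (off_star s) (k - 1) k)
           (rel_cobound o false F (off_star s) k (k + 1)).

Definition loc_hom_map G k s t (st : sle s t) :
  bihom (loc_hom G k s) (loc_hom G k t).
Proof.
apply: (@homology_map _ _ _ _ _ _ _ _ _ _ _ _
  (rel_chains_incl true (off_starS st) G k)) => [c c0|c].
  by rewrite -rel_chains_incl_bound c0 bihom0.
by exists (rel_chains_incl true (off_starS st) G _ c);
  rewrite rel_chains_incl_bound.
Defined.

Definition loc_cohom_map F k s t (st : sle s t) :
  bihom (loc_cohom F k t) (loc_cohom F k s).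
Proof.
apply: (@homology_map _ _ _ _ _ _ _ _ _ _ _ _
  (rel_cochains_incl false (off_starS st) F k)) => [c c0|c].
  by rewrite -rel_cochains_incl_cobound c0 bihom0.
by exists (rel_cochains_incl false (off_starS st) F _ c);
  rewrite rel_cochains_incl_cobound.
Defined.

Lemma loc_hom_mapE G k s t (st : sle s t) c :
  rel_bound o true G (off_star s) k (k - 1) c = 0 ->
  loc_hom_map G k st (hclass _ _ c) =
  hclass _ _ (rel_chains_incl true (off_starS st) G k c).
Proof. exact: homology_mapE. Qed.

Lemma loc_cohom_mapE F k s t (st : sle s t) c :
  rel_cobound o false F (off_star t) k (k + 1) c = 0 ->
  loc_cohom_map F k st (hclass _ _ c) =
  hclass _ _ (rel_cochains_incl false (off_starS st) F k c).
Proof. exact: homology_mapE. Qed.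

Definition loc_hom_sheaf (G : cosheaf A B) (k : int) : sheaf A B.
Proof.
exists (loc_hom G k) (loc_hom_map G k) => [s ss|s t u st tu su] x.
  by apply: homology_map_id => c; rewrite -[c]quot_piK rel_chains_inclE.
apply: homology_map_comp => c.
by rewrite -[c]quot_piK /comp !rel_chains_inclE.
Defined.

Definition loc_cohom_cosheaf (F : sheaf A B) (k : int) : cosheaf A B.
Proof.
exists (loc_cohom F k) (loc_cohom_map F k) => [s ss|s t u st tu su] x.
  by apply: homology_map_id => c; exact: val_inj.
by apply: homology_map_comp => c; exact: val_inj.
Defined.

Definition CM_at_cosheaf (G : cosheaf A B) (K : subcomplex) : Prop :=
  forall s (k : int), s \in sub_mem K -> k != n -> forall x : loc_hom G k s, x = 0.

Definition CM_at_sheaf (F : sheaf A B) (K : subcomplex) : Prop :=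
  forall s (k : int), s \in sub_mem K -> k != n -> forall x : loc_cohom F k s, x = 0.

(** ** Cap product with the fundamental class *)

(* The fundamental class is represented by the locally finite cycle given by
   the sum of a <| a^* over the n-simplices a, where s <| a^* in H^n(X, X - st(s))
   is the class of the cochain with value 1 on a and 0 elsewhere. *)

(* The coefficient of s <| a in a representative of c; for k = n and s <= a it
   does not depend on the representative. *)
Definition loc_coeff (G : cosheaf A B) k s (c : loc_hom G k s)
  (a : simp full_sub k) : G (val a) := coeff (repr (hrepr c)) a.

Lemma simp_top (K : subcomplex) : simp K (n%:Z + 1) -> False.
Proof.
move=> t; have /andP[_] := valP t; rewrite /dim subr_eq => /eqP[] tn.
by have := sc_dim_le (valP (val t)); rewrite tn !addn1 ltnn.
Qed.

Lemma rel_chains_top (G : cosheaf A B) (K : subcomplex)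
  (c : rel_chains true G K (n%:Z + 1)) : c = 0.
Proof.
rewrite -[c]quot_piK -[RHS](bihom0 (quot_pi _)); congr (quot_pi _ _).
apply: coeff_inj; apply: functional_extensionality_dep => t.
by case: (simp_top t).
Qed.

Lemma loc_coeff0 G s (a : simp full_sub n) : sle s (val a) ->
  loc_coeff (0 : loc_hom G n s) a = 0.
Proof.
move=> sa; rewrite /loc_coeff hrepr0; last exact: rel_chains_top.
have /asboolP := repr_quot0 (chains_in true G (off_star s) n).
by apply; rewrite !inE negbK.
Qed.

Section Cap.
Variables (fin : bool) (K K' : subcomplex) (l : int).

Section CapSheaf.
Variable G : cosheaf A B.

(* The coefficient at t of the cap product of s <| a^*, where s is a k-simplex,
   with phi, an l-cochain on K extended by zero: it is G(a > t) phi^tau_a if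
   t = s_{<= k-l}, with tau = s_{>= k-l}. If k < l there is no simplex t
   of dimension k - l, so that the absolute value does no harm. *)
Definition cap_gen_hom (k : int) (s : simplex) (a : simp full_sub n)
    (phi : bprod (fun s : simp K l => loc_hom_sheaf G n (val s))) (t : simplex) :
    G t :=
  if front o `|k - l|%N s == val t then
    oapp (fun tau : simp K l => coshm G (val a) t (loc_coeff (phi tau) a)) 0
         (find_simp K l (back o `|k - l|%N s))
  else 0.

(* The cap product of the sum of all a <| a^* with phi, at t; a_{<= n-l} = t
   forces a to lie in the star of t. *)
Definition cap_loc_hom_fun
    (phi : bprod (fun s : simp K l => loc_hom_sheaf G n (val s))) :
    bprod (fun t : simp K' (n%:Z - l) => G (val t)) := fun t =>
  \sum_(a0 <- star (val t)) oapp (fun a : simp full_sub n =>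
    cap_gen_hom n (val a) a phi (val t)) 0 (insub a0).

Fact cap_loc_hom_supp (phi : cochains fin (loc_hom_sheaf G n) K l) :
  cap_loc_hom_fun (coeff phi) \in subbimod_mem (supp_cond fin _).
Proof.
rewrite inE; apply/implyP => finT; apply/asboolP.
have /(finite_near K' (n%:Z - l)) := coeff_fin phi finT.
apply: sub_finite_set => t /=; apply: contra_neqP => phi0.
apply: big1 => a0 _; case: insub => [a|] //=; rewrite /cap_gen_hom.
case: eqP => // at_; case E: find_simp => [s|] //=.
have sa : sle (val s) (val a) by rewrite /sle (find_simpE E) back_sub.
have [->|s0] := eqVneq (coeff phi s) 0; first by rewrite loc_coeff0// bihom0.
case: phi0; exists s => //; exists (val a) => //.
by have := front_sub o `|n%:Z - l|%N (val a); rewrite at_.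
Qed.

Definition cap_loc_hom (phi : cochains fin (loc_hom_sheaf G n) K l) :
  chains fin G K' (n%:Z - l) := mk_dsum (cap_loc_hom_supp phi).

End CapSheaf.

Section CapCosheaf.
Variable F : sheaf A B.

(* The cap product of s <| a^*, where s is a k-simplex, with psi has as its
   coefficient at t = s_{<= k-l} the class of the cochain supported on a with
   value F(tau < a) psi_tau, where tau = s_{>= k-l}. *)
Definition cap_gen_cohom (k : int) (s : simplex) (a : simp full_sub n)
    (psi : bprod (fun s : simp K l => F (val s))) (t : simplex) : F (val a) :=
  if front o `|k - l|%N s == val t then
    oapp (fun tau : simp K l => shm F (val tau) (val a) (psi tau)) 0
         (find_simp K l (back o `|k - l|%N s))
  else 0.

(* The sum over all a of the cochains attached to a <| a^*. *)
Definition cap_cochain_fun (psi : bprod (fun s : simp K l => F (val s)))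
    (t : simplex) : bprod (fun a : simp full_sub n => F (val a)) := fun a =>
  cap_gen_cohom n (val a) a psi t.

Fact cap_cochain_supp psi t :
  cap_cochain_fun psi t \in subbimod_mem (supp_cond false _).
Proof. by []. Qed.

Fact cap_cochain_vanish psi t :
  mk_dsum (cap_cochain_supp psi t) \in
  subbimod_mem (vanish_on false F (off_star t) n).
Proof.
apply/asboolP => a; rewrite inE => at_.
rewrite /coeff /= /cap_cochain_fun /cap_gen_cohom; case: eqP => // ta.
by case/negP: at_; rewrite /sle -ta front_sub.
Qed.

Definition cap_cochain psi t : rel_cochains false F (off_star t) n :=
  exist _ (mk_dsum (cap_cochain_supp psi t)) (cap_cochain_vanish psi t).

Definition cap_loc_cohom_fun (psi : bprod (fun s : simp K l => F (val s))) :
    bprod (fun t : simp K' (n%:Z - l) => loc_cohom_cosheaf F n (val t)) :=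
  fun t => hclass _ _ (cap_cochain psi (val t)).

Fact cap_loc_cohom_supp (psi : cochains fin F K l) :
  cap_loc_cohom_fun (coeff psi) \in subbimod_mem (supp_cond fin _).
Proof.
rewrite inE; apply/implyP => finT; apply/asboolP.
have /(finite_near K' (n%:Z - l)) := coeff_fin psi finT.
apply: sub_finite_set => t /=; apply: contra_neqP => psi0.
rewrite /cap_loc_cohom_fun (_ : cap_cochain _ _ = 0).
  exact: hclass0.
apply: val_inj; apply: coeff_inj; apply: functional_extensionality_dep => a.
rewrite /coeff /= /cap_cochain_fun /cap_gen_cohom; case: eqP => // at_.
case E: find_simp => [s|] //=.
have [s0|s0] := eqVneq (coeff psi s) 0.
  by rewrite [X in shm _ _ _ X]s0 bihom0.
case: psi0; exists s => //; exists (val a).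
  by rewrite /sle (find_simpE E) back_sub.
by have := front_sub o `|n%:Z - l|%N (val a); rewrite at_.
Qed.

Definition cap_loc_cohom (psi : cochains fin F K l) :
  chains fin (loc_cohom_cosheaf F n) K' (n%:Z - l) :=
  mk_dsum (cap_loc_cohom_supp psi).

End CapCosheaf.
End Cap.
End LocalHomology.

(** ** The duality maps *)

(* With [fin] the cohomology on the left is compactly supported; without it the
   homology on the right is locally finite. *)

Section Duality.
Variables (o : orientation) (fin : bool) (L : subcomplex) (A B : pzRingType).

Let Lvc := vertex_complement L.

Section FromCosheaf.
Variables (G : cosheaf A B) (l : int).
Let h := loc_hom_sheaf o G n.

(* H^l(L; h_n|L) -> H_{n-l}(X, Lvc; G) *)
Definition cap_iso_1a : Prop :=
  induces_iso (cobound o fin h L (l - 1) l) (cobound o fin h L l (l + 1))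
    (rel_bound o fin G Lvc (n%:Z - l + 1) (n%:Z - l))
    (rel_bound o fin G Lvc (n%:Z - l) (n%:Z - l - 1))
    (fun phi => quot_pi _ (cap_loc_hom full_sub phi)).

(* H^l(X, L; h_n) -> H_{n-l}(Lvc; G) *)
Definition cap_iso_1b : Prop :=
  induces_iso (rel_cobound o fin h L (l - 1) l) (rel_cobound o fin h L l (l + 1))
    (bound o fin G Lvc (n%:Z - l + 1) (n%:Z - l))
    (bound o fin G Lvc (n%:Z - l) (n%:Z - l - 1))
    (fun phi => cap_loc_hom Lvc (val phi)).

End FromCosheaf.

Section FromSheaf.
Variables (F : sheaf A B) (l : int).
Let h := loc_cohom_cosheaf o F n.

(* H^l(X, L; F) -> H_{n-l}(Lvc; h^n|Lvc) *)
Definition cap_iso_2a : Prop :=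
  induces_iso (rel_cobound o fin F L (l - 1) l) (rel_cobound o fin F L l (l + 1))
    (bound o fin h Lvc (n%:Z - l + 1) (n%:Z - l))
    (bound o fin h Lvc (n%:Z - l) (n%:Z - l - 1))
    (fun psi => cap_loc_cohom o Lvc (val psi)).

(* H^l(L; F) -> H_{n-l}(X, Lvc; h^n) *)
Definition cap_iso_2b : Prop :=
  induces_iso (cobound o fin F L (l - 1) l) (cobound o fin F L l (l + 1))
    (rel_bound o fin h Lvc (n%:Z - l + 1) (n%:Z - l))
    (rel_bound o fin h Lvc (n%:Z - l) (n%:Z - l - 1))
    (fun psi => quot_pi _ (cap_loc_cohom o full_sub psi)).

End FromSheaf.
End Duality.
End Complexes.

(* Main.v *)
(* Let U be the vertex set of L (1.a, 2.b) or of L^vc (1.b, 2.a); it is an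
   interval of each simplex.  The cochains involved live on the simplices whose
   first vertex is in U, the chains on those whose last vertex is in U.
   In 1, both embed in the double complex with an entry in G(a) for each pair
   s <= a with the first vertex of s in U.  For fixed s, the local Cohen-Macaulay
   condition makes the row of boundaries in a a resolution of (h_G)_n(s).  For
   fixed a, the column of coboundaries in s is contracted by coning off the last
   vertex of a: it is acyclic if that vertex is not in U and resolves G(a) if it
   is.  Cutting a into a front and a back face is, by a Leibniz rule, a chain map
   from the total complex which is left inverse to the second embedding.  Its
   composite with the first embedding is the cap product, which is therefore an
   isomorphism on homology.  Case 2 is dual: pairs t <= a with the last vertex of
   t in U, columns contracted onto the first vertex of a, and (h^F)^n(t) a
   quotient.  For coefficients R, the local chain complexes are free, so if their
   homology is concentrated in degree n they split and their duals have
   cohomology only in degree n. *)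

From HB Require Import structures.
From mathcomp Require Import all_boot all_order all_algebra.
From mathcomp Require Import finmap ring zify.
From mathcomp Require Import boolp classical_sets functions cardinality.
Require Import Defs.

Set Implicit Arguments.
Unset Strict Implicit.
Unset Printing Implicit Defensive.
Import GRing.Theory.
Local Open Scope ring_scope.

(** The homology of the total complexes is never computed as such: a cycle is moved by finitely many
    corrections, one level of a row or column at a time, and the dimension bound on [X] makes the
    process stop. A correction is either zero wherever its row was zero or relates only simplices
    with a common coface, so local finiteness preserves finite supports. This is why one proof, with
    the flag [fin], covers compact and arbitrary supports together. Degrees and membership
    conditions are kept out of the types: every group embeds into families over all simplices with
    prescribed support, and incidence numbers vanish off codimension one. The cap product commutes
    with differentials only up to a sign depending on the degree, so isomorphism on homology is
    checked separately on cycles and boundaries instead of through a chain map. The interval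
    condition on [U] keeps the truncated differentials square-zero and makes the columns
    concentrated at vertices compatible with them. *)

(** * Finite sums compared by their nonzero terms *)

(** Sums over stars, face sets and singletons are exchanged by looking only at indices of nonzero
    terms, so no filtered index sets have to be carried along. *)
Lemma eq_big_supp (M : zmodType) (I : eqType) (r1 r2 : seq I) (F : I -> M) :
  uniq r1 -> uniq r2 ->
  (forall i, i \in r1 -> F i != 0 -> i \in r2) ->
  (forall i, i \in r2 -> F i != 0 -> i \in r1) ->
  \sum_(i <- r1) F i = \sum_(i <- r2) F i.
Proof.
have drop0 (r : seq I) : \sum_(i <- r) F i = \sum_(i <- r | F i != 0) F i.
  rewrite [RHS]big_mkcond; apply: eq_bigr => i _.
  by case: eqVneq.
move=> u1 u2 r12 r21; rewrite drop0 [RHS]drop0 -big_filter -[RHS]big_filter.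
apply: perm_big; apply: uniq_perm; rewrite ?filter_uniq// => i.
rewrite !mem_filter; have [//|F0] := eqVneq (F i) 0.
by apply/idP/idP => /= ?; [exact: r12|exact: r21].
Qed.

(** Two integer matrices applied in succession act through their product. Square-zero relations,
    homotopies and Leibniz rules thereby reduce to identities between integers, whatever the
    coefficient module. *)
Lemma sum_sum_mulrz (M : zmodType) (I J : Type) (r : seq I) (q : seq J)
    (f : J -> M) (a : I -> int) (b : J -> I -> int) :
  \sum_(i <- r) (\sum_(j <- q) f j *~ b j i) *~ a i =
  \sum_(j <- q) f j *~ (\sum_(i <- r) b j i * a i).
Proof.
under eq_bigr do rewrite mulrz_suml.
rewrite exchange_big; apply: eq_bigr => j _ /=.
by rewrite mulrz_sumr; apply: eq_bigr => i _; rewrite mulrzA.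
Qed.

(** * Alternating sums and incidence numbers *)

Section AlternatingSums.
Variables (V : eqType) (M : zmodType).
Implicit Types (f : seq V -> M) (s : seq V).

Definition del (i : nat) s := take i s ++ drop i.+1 s.

Lemma size_del i s : (i < size s)%N -> size (del i s) = (size s).-1.
Proof.
move=> is_; rewrite size_cat size_take is_ size_drop.
by case: (size s) is_ => // m; rewrite ltnS subSS => /subnKC.
Qed.

(** The simplicial differential on vertex lists. Lists admit induction on the first vertex, and no
    membership in [X] has to be proved along the way. *)
Definition alt f s : M := \sum_(i < size s) f (del i s) *~ (-1) ^+ i.

Lemma eq_alt f g s :
  (forall i, (i < size s)%N -> f (del i s) = g (del i s)) -> alt f s = alt g s.
Proof. by move=> fg; apply: eq_bigr => i _; rewrite fg. Qed.

Lemma alt_cons f x s : alt f (x :: s) = f s - alt (fun q => f (x :: q)) s.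
Proof.
rewrite /alt big_ord_recl /= expr0 mulr1z {1}/del /= drop0; congr (_ + _).
rewrite -sumrN; apply: eq_bigr => i _.
by rewrite /bump /= add1n exprS mulN1r mulrNz.
Qed.

Lemma altB f g s : alt (fun q => f q - g q) s = alt f s - alt g s.
Proof.
by rewrite /alt -sumrB; apply: eq_bigr => i _; rewrite mulrzBl.
Qed.

(** Induction through [alt_cons] replaces the usual pairing of deleted positions: the terms in which
    the head is deleted once cancel, and what remains is the identity for the tail. *)
Lemma alt_alt f s : alt (alt f) s = 0.
Proof.
elim: s f => [|x s IHs] f; first by rewrite /alt big_ord0.
rewrite alt_cons.
rewrite (eq_alt (f := fun q => alt f (x :: q))
                (g := fun q => f q - alt (fun q => f (x :: q)) q)).
  by rewrite altB IHs subr0 subrr.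
by move=> i _; rewrite alt_cons.
Qed.

(** A deleted position lies in one of the two pieces; in the second its index is shifted by
    [size s]. This is the source of the sign in the Leibniz rule. *)
Lemma alt_cat f s s' :
  alt f (s ++ s') =
  alt (fun q => f (q ++ s')) s + alt (fun q => f (s ++ q)) s' *~ (-1) ^+ size s.
Proof.
elim: s f => [|x s IHs] f.
  by rewrite {2}/alt big_ord0 add0r expr0 mulr1z.
rewrite /= !alt_cons IHs exprS mulN1r mulrNz opprD addrA.
by congr (_ - _).
Qed.

End AlternatingSums.

Lemma mem_del (V : eqType) (v0 : V) (q : seq V) i w : uniq q -> (i < size q)%N ->
  (w \in del i q) = (w != nth v0 q i) && (w \in q).
Proof.
move=> uq iq; rewrite -[q in RHS](cat_take_drop i) (drop_nth v0)//.
move: uq; rewrite -{1}(cat_take_drop i q) (drop_nth v0)// cat_uniq /=.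
move=> /and3P[_ /norP[h1 _] /andP[h2 _]].
rewrite /del !mem_cat in_cons nth_cat size_take iq ltnn subnn /=.
by have [->|] := eqVneq w; first exact/norP.
Qed.

(** * Faces as sublists, and incidence numbers *)

Section Incidence.
Variables (V : choiceType) (n : nat) (X : lfcomplex V n) (o : orientation X).
Implicit Types (s t u a : simplex X) (q : seq V).
Local Open Scope fset_scope.
Local Open Scope ring_scope.

Definition fs q : {fset V} := [fset v in q].

Lemma in_fs q v : (v \in fs q) = (v \in q).
Proof. by rewrite in_fset. Qed.

Lemma fs_del v0 i q : uniq q -> (i < size q)%N ->
  fs (del i q) = fs q `\ nth v0 q i.
Proof.
by move=> uq iq; apply/fsetP => v; rewrite in_fs (mem_del v0)// in_fsetD1 in_fs.
Qed.

Lemma vertices_uniq s : uniq (vertices o s).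
Proof. by rewrite sort_uniq. Qed.

Lemma mem_vertices s v : (v \in vertices o s) = (v \in val s).
Proof. by rewrite mem_sort. Qed.

Lemma size_vertices s : size (vertices o s) = #|` val s|.
Proof. by rewrite size_sort. Qed.

Lemma fs_vertices s : fs (vertices o s) = val s.
Proof. by apply/fsetP => v; rewrite in_fs mem_vertices. Qed.

Lemma card_fs q : uniq q -> #|` fs q| = size q.
Proof.
move=> uq; apply/perm_size/uniq_perm => // v; exact: in_fs.
Qed.

Lemma simplex_card_gt0 s : (0 < #|` val s|)%N.
Proof. by rewrite cardfs_gt0 (sc_neq0 (valP s)). Qed.

Lemma sle_card s t : sle s t -> (#|` val s| <= #|` val t|)%N.
Proof. exact: fsubset_leq_card. Qed.

Lemma vertices_face t s : sle t s ->
  vertices o t = filter (mem (val t)) (vertices o s).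
Proof.
move=> ts; have memt v : v \in vertices o t -> v \in val t.
  by rewrite mem_vertices.
apply: (@sorted_eq_in _ (ord o t)).
- by move=> x y z /memt xt /memt yt /memt zt; exact: ord_trans.
- by move=> x y /memt xt /memt yt; exact: ord_anti.
- by apply: (sort_sorted_in (P := mem (val t))); [exact: ord_total|apply/allP].
- have allt : all (mem (val t)) (filter (mem (val t)) (vertices o s)).
    exact: filter_all.
  rewrite (eq_in_sorted (e' := ord o s) (P := mem (val t)))//; last first.
    exact: ord_face.
  apply: (sorted_filter_in (P := mem (val s))).
  + exact: ord_trans.
  + by apply/allP => v; rewrite mem_vertices.
  + by apply: (sort_sorted_in (P := mem (val s))); [exact: ord_total|apply/allP].
- apply: uniq_perm; rewrite ?filter_uniq ?vertices_uniq// => v.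
  rewrite mem_filter !mem_vertices /=.
  by apply/idP/andP => [vt|[]//]; split=> //; exact: (fsubsetP ts).
Qed.

(** Faces inherit the order, so a sublist of the vertices of [s] is already sorted for the face it
    spans. With [subseq_face] this lets faces be handled as sublists. *)
Lemma vertices_subseq t s q : subseq q (vertices o s) -> val t = fs q ->
  sle t s /\ vertices o t = q.
Proof.
move=> qs tq; have ts : sle t s.
  apply/fsubsetP => v; rewrite tq in_fs => vq; rewrite -mem_vertices.
  exact: mem_subseq qs _ vq.
split=> //; rewrite (vertices_face ts).
have /(subseq_uniqP (vertices_uniq s)) -> := qs.
by apply: eq_filter => v; rewrite /= tq in_fs.
Qed.

Lemma subseq_face s q : subseq q (vertices o s) -> q != [::] ->
  {t : simplex X | val t = fs q & sle t s}.
Proof.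
move=> qs q0; have sub : fs q `<=` val s.
  apply/fsubsetP => v; rewrite in_fs -mem_vertices; exact: mem_subseq qs v.
have ne : fs q != fset0.
  case: q q0 {qs sub} => // x q _; apply/fset0Pn; exists x.
  by rewrite in_fs mem_head.
by exists (Sub (fs q) (sc_closed sub ne (valP s))).
Qed.

Lemma del_subseq (i : nat) q : subseq (del i q) q.
Proof.
rewrite -[X in subseq _ X](cat_take_drop i) /del -[i.+1]/(1 + i)%N -drop_drop.
by apply: cat_subseq => //; exact: drop_subseq.
Qed.

Lemma omitE i s : omit o i s = fs (del i (vertices o s)).
Proof. by []. Qed.

(** The incidence number. At most one position contributes, so it is [0], [1] or [-1]; it makes
    sense for every pair of simplices, without a dimension condition. *)
Definition inc t s : int :=
  \sum_(i < #|` val s| | omit o i s == val t) (-1) ^+ i.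

Definition faces s : {fset simplex X} := fset_set [set t | sle t s].

Lemma mem_faces s t : (t \in faces s) = sle t s.
Proof. by rewrite in_fset_set; [exact: asboolb|exact: finite_faces]. Qed.

Lemma mem_star s t : (t \in star s) = sle s t.
Proof. by rewrite in_fset_set; [exact: asboolb|exact: finite_star]. Qed.

(* A function on simplices, seen as a function on vertex lists. *)
Definition on_seq (M : zmodType) (f : simplex X -> M) q : M :=
  oapp f 0 (insub (fs q) : option (simplex X)).

Lemma on_seqE (M : zmodType) (f : simplex X -> M) q t :
  val t = fs q -> on_seq f q = f t.
Proof. by rewrite /on_seq => <-; rewrite valK. Qed.

(** The complexes are not augmented; edge cases of the list identities below rest on this value. *)
Lemma on_seq0 (M : zmodType) (f : simplex X -> M) : on_seq f [::] = 0.
Proof.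
rewrite /on_seq; case: insubP => [t _ t0|//].
have := sc_neq0 (valP t); rewrite t0 => /fset0Pn[v].
by rewrite in_fs.
Qed.

(** Each position is matched by at most one face, so weighting faces by incidence numbers gives the
    alternating sum over positions. This is the bridge between simplices and lists. *)
Lemma sum_inc (M : zmodType) (f : simplex X -> M) s :
  \sum_(t <- faces s) f t *~ inc t s = alt (on_seq f) (vertices o s).
Proof.
rewrite /alt size_vertices.
under eq_bigr do rewrite mulrz_sumr big_mkcond.
rewrite exchange_big; apply: eq_bigr => i _ /=; rewrite -big_mkcond /=.
rewrite /on_seq -omitE; case: insubP => /= [t _ ti|ni].
  rewrite (eq_bigl (pred1 t)); last first.
    by move=> t' /=; rewrite -ti [RHS]eq_sym -[RHS]val_eqE.
  rewrite -big_filter filter_pred1_uniq ?fset_uniq ?big_seq1//.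
  by rewrite mem_faces; exact: omit_sle (esym ti).
rewrite mul0rz big1// => t /eqP ti.
by case/negP: ni; rewrite ti; exact: (valP t).
Qed.

Lemma inc_codim1 t s : inc t s != 0 ->
  exists2 v, v \in val s & val t = val s `\ v.
Proof.
have [[i /eqP <-] _|no] := pselect (exists i : 'I_#|` val s|, omit o i s == val t).
  have [v0 _] : {v : V | v \in val s}.
    by apply: sigW; apply/fset0Pn; exact: sc_neq0 (valP s).
  have is_ : (i < size (vertices o s))%N by rewrite size_vertices.
  exists (nth v0 (vertices o s) i); first by rewrite -mem_vertices mem_nth.
  by rewrite omitE (fs_del v0) ?vertices_uniq// fs_vertices.
by rewrite /inc big1 ?eqxx// => i it; case: no; exists i.
Qed.

Lemma inc_del t s v : v \in val s -> val t = val s `\ v ->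
  inc t s = (-1) ^+ index v (vertices o s).
Proof.
rewrite -mem_vertices => vs tE.
have iv : (index v (vertices o s) < #|` val s|)%N.
  by rewrite -size_vertices index_mem.
rewrite /inc (big_pred1 (Ordinal iv))// => i.
have is_ : (i < size (vertices o s))%N by rewrite size_vertices.
rewrite omitE (fs_del v) ?vertices_uniq// fs_vertices tE.
apply/eqP/eqP => [e|->]; last by rewrite /= nth_index.
apply: val_inj => /=; have /fsetP/(_ (nth v (vertices o s) i)) := e.
rewrite !in_fsetD1 eqxx -mem_vertices mem_nth//= andbT.
by move=> /esym/negbFE/eqP <-; rewrite index_uniq ?vertices_uniq.
Qed.

Lemma inc_sle t s : inc t s != 0 -> sle t s.
Proof. by move=> /inc_codim1[v _ tE]; rewrite /sle tE fsubD1set. Qed.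

Lemma inc_card t s : inc t s != 0 -> #|` val s| = #|` val t|.+1.
Proof. by move=> /inc_codim1[v vs ->]; rewrite (cardfsD1 v) vs. Qed.

Lemma inc_dim t s : inc t s != 0 -> dim s = dim t + 1.
Proof. by move=> /inc_card ts; rewrite /dim ts -addn1 PoszD addrAC. Qed.

Lemma inc_sqr t s : inc t s != 0 -> inc t s * inc t s = 1.
Proof.
by move=> /inc_codim1[v vs tE]; rewrite (inc_del vs tE) -expr2 sqrr_sign.
Qed.

Lemma sum_inc_faces (M : zmodType) (f : simplex X -> M) s a : sle s a ->
  \sum_(t <- faces a) f t *~ inc t s = alt (on_seq f) (vertices o s).
Proof.
move=> sa; rewrite -sum_inc; apply: eq_big_supp => [||t _|t].
- exact: fset_uniq.
- exact: fset_uniq.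
- rewrite mem_faces => f0; apply: inc_sle; apply: contra_neq f0 => ->.
  by rewrite mulr0z.
- by rewrite !mem_faces => ts _; exact: sle_trans sa.
Qed.

(** Apply [alt_alt] to the indicator function of [t]. Faces of [a] outside [u] contribute nothing,
    so the sum may run over any [a] containing [u]. *)
Lemma inc_inc t u a : sle u a ->
  \sum_(s <- faces a) inc t s * inc s u = 0.
Proof.
move=> ua; under eq_bigr do rewrite -mulrzz.
rewrite sum_inc_faces// -[RHS](alt_alt (on_seq (fun t' => (t' == t)%:R : int)) (vertices o u)).
apply: eq_alt => i iu; have [->|q0] := eqVneq (del i (vertices o u)) [::].
  by rewrite on_seq0 /alt big_ord0.
have [s sE su] := subseq_face (del_subseq i _) q0.
have [_ <-] := vertices_subseq (del_subseq i _) sE.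
rewrite (on_seqE _ (_ : val s = _)); last by rewrite fs_vertices.
rewrite -sum_inc.
have [ts|nts] := boolP (sle t s).
  rewrite (eq_big_supp (r2 := [:: t])) ?fset_uniq ?big_seq1 ?eqxx ?mulr1n ?intz//.
  + by move=> t1 _; rewrite inE; have [//|_] := eqVneq t1 t; rewrite mulr0n mul0rz eqxx.
  + by move=> t1; rewrite inE => /eqP-> _; rewrite mem_faces.
rewrite big_seq big1 => [|t1]; last first.
  rewrite mem_faces; have [->|_ _] := eqVneq t1 t; first by rewrite (negbTE nts).
  by rewrite mulr0n mul0rz.
by apply/eqP; apply: contraNT nts => /inc_sle.
Qed.

End Incidence.

Lemma altMr (V : eqType) (f : seq V -> int) c s :
  alt (fun q => f q * c) s = alt f s * c.
Proof.
rewrite /alt mulr_suml; apply: eq_bigr => i _.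
by rewrite -!mulrzz mulrzAC.
Qed.

Lemma altMl (V : eqType) (f : seq V -> int) c s :
  alt (fun q => c * f q) s = c * alt f s.
Proof.
by rewrite mulrC -altMr; apply: eq_alt => i _; rewrite mulrC.
Qed.

(** A deletion among the first [k.+1] entries is one in the front [take k.+2 vs], a later one is in
    the back [drop k vs]. Each alternating sum on the right has one surplus term, the front losing
    its last entry or the back its first; these two cancel. *)
Lemma alt_take_drop (V : eqType) (h g : seq V -> int) k vs :
  (k.+1 < size vs)%N ->
  alt (fun q => h (take k.+1 q) * g (drop k q)) vs =
  alt h (take k.+2 vs) * g (drop k.+1 vs) +
  (-1) ^+ k * (h (take k.+1 vs) * alt g (drop k vs)).
Proof.
move=> kvs; have x0 : V by case: vs kvs.
set s := take k vs; set x := nth x0 vs k; set y := nth x0 vs k.+1.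
set s' := drop k.+2 vs.
have ss : size s = k by rewrite size_take ltnW // ltnW.
have dk : drop k vs = x :: y :: s'.
  by rewrite (drop_nth x0) 1?ltnW// (drop_nth x0).
have vsE : vs = (s ++ [:: x]) ++ y :: s'.
  by rewrite -catA /= -dk cat_take_drop.
have sx : size (s ++ [:: x]) = k.+1 by rewrite size_cat ss addn1.
have tk1 : take k.+1 vs = s ++ [:: x] by rewrite vsE take_cat sx ltnn subnn take0 cats0.
have tk2 : take k.+2 vs = (s ++ [:: x]) ++ [:: y].
  by rewrite vsE take_cat sx ltnNge leqnSn /= subSnn /= take0.
have dk1 : drop k.+1 vs = y :: s' by rewrite vsE drop_cat sx ltnn subnn drop0.
rewrite dk dk1 tk1 tk2 vsE !(alt_cat _ (s ++ [:: x])) sx.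
rewrite (eq_alt (g := fun q => h (q ++ [:: y]) * g (y :: s'))); last first.
  move=> i; rewrite sx => ik; have sd : size (del i (s ++ [:: x])) = k.
    by rewrite size_del sx.
  rewrite take_cat drop_cat sd ltnn subnn ltnNge leqnSn /= subSnn.
  by rewrite /= take0 ?drop0.
rewrite altMr.
rewrite (eq_alt (g := fun q => h (s ++ [:: x]) * g (x :: q)) (s := y :: s')); last first.
  move=> i _; rewrite take_cat sx ltnn subnn take0 cats0.
  by rewrite -catA drop_cat ss ltnn subnn drop0.
rewrite altMl.
have -> : alt (fun q => h ((s ++ [:: x]) ++ q)) [:: y] = h (s ++ [:: x]).
  by rewrite /alt big_ord1 /del /= cats0 expr0 mulr1z.
by rewrite (alt_cons g x) !mulrzz exprS; ring.
Qed.

(** * Splitting a simplex into a front and a back face *)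

Section FrontBack.
Variables (V : choiceType) (n : nat) (X : lfcomplex V n) (o : orientation X).
Implicit Types (s t u r a : simplex X) (q : seq V).
Local Open Scope fset_scope.
Local Open Scope ring_scope.
Notation inc := (inc o).

Lemma inc_alt t s :
  inc t s = alt (fun q => (fs q == val t)%:R : int) (vertices o s).
Proof.
rewrite /inc /alt size_vertices big_mkcond; apply: eq_bigr => i _.
by rewrite -omitE; case: eqP => _; rewrite ?intz // mul0rz.
Qed.

Lemma on_seq_inc t q a : subseq q (vertices o a) ->
  on_seq (inc t) q = alt (fun q => (fs q == val t)%:R : int) q.
Proof.
move=> qa; have [->|q0] := eqVneq q [::]; first by rewrite on_seq0 /alt big_ord0.
have [s sE _] := subseq_face qa q0; rewrite (on_seqE _ sE) inc_alt.
by have [_ ->] := vertices_subseq qa sE.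
Qed.

Lemma sum_faces_pick (f : simplex X -> int) q a : subseq q (vertices o a) ->
  \sum_(t <- faces a) (fs q == val t)%:R * f t = on_seq f q.
Proof.
move=> qa; have [q0|q0] := eqVneq q [::].
  rewrite q0 on_seq0 big1 // => t _; case: eqP => [t0|_]; last by rewrite mul0r.
  by have := simplex_card_gt0 t; rewrite -t0 card_fs.
have [s sE sa] := subseq_face qa q0; rewrite (on_seqE _ sE).
rewrite (eq_big_supp (r2 := [:: s])) ?fset_uniq//.
- by rewrite big_seq1 sE eqxx mul1r.
- move=> t _; rewrite -sE inE eq_sym val_eqE.
  by have [//|_] := eqVneq t s; rewrite mul0r eqxx.
- by move=> t; rewrite inE => /eqP-> _; rewrite mem_faces.
Qed.

(* t = a_{<= k} and s = a_{>= k} where k is the dimension of t *)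
Definition chi t s a : bool :=
  (front o #|` val t|.-1 a == val t) && (back o #|` val t|.-1 a == val s).

Lemma chi_sle t s a : chi t s a -> sle t a /\ sle s a.
Proof.
by move=> /andP[/eqP ta /eqP sa]; rewrite /sle -ta -sa front_sub back_sub.
Qed.

Lemma chiP t s a : chi t s a -> exists p x q,
  [/\ vertices o a = p ++ x :: q, vertices o t = p ++ [:: x]
    & vertices o s = x :: q].
Proof.
move=> /andP[/eqP]; rewrite /front /back -!/(fs _).
set k := _.-1; set vs := vertices o a => tE /eqP sE.
have tk : k.+1 = #|` val t| by rewrite prednK// simplex_card_gt0.
have kvs : (k < size vs)%N.
  have : (#|` val t| <= size vs)%N.
    by rewrite size_vertices sle_card// /sle -tE; exact: front_sub.
  by rewrite -tk.
have x0 : V by case: (vs) kvs.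
exists (take k vs), (nth x0 vs k), (drop k.+1 vs); split.
- by rewrite -drop_nth// cat_take_drop.
- have [_ ->] := vertices_subseq (take_subseq vs k.+1) (esym tE).
  by rewrite (take_nth x0)// -cats1.
- have [_ ->] := vertices_subseq (drop_subseq vs k) (esym sE).
  by rewrite -drop_nth.
Qed.

Lemma chi_vertices t s a p x q : vertices o a = p ++ x :: q ->
  vertices o t = p ++ [:: x] -> vertices o s = x :: q -> chi t s a.
Proof.
move=> ea et es; rewrite /chi -(size_vertices o) et size_cat addn1 /=.
rewrite /front /back -!/(fs _) ea take_cat drop_cat ltnNge leqnSn /= ltnn.
by rewrite subSnn subnn /= take0 -et -es !fs_vertices !eqxx.
Qed.

Lemma chi_dim t s a : chi t s a -> dim a = dim t + dim s.
Proof.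
move=> /chiP[p [x [q [ea et es]]]].
rewrite /dim -!(size_vertices o) ea et es !size_cat /= addn1 addnS.
rewrite -[(size p).+1]addn1 -[(size q).+1]addn1 -addn1 !PoszD !addrK.
by [].
Qed.

(* The Leibniz rule for the splittings of a into a front and a back face. *)
Lemma inc_chi u r a :
  \sum_(t <- faces a) (chi t r a)%:R * inc u t =
  \sum_(b <- faces a) (chi u r b)%:R * inc b a -
  (-1) ^+ #|` val u|.-1 * \sum_(s <- faces a) (chi u s a)%:R * inc r s.
Proof.
set k := #|` val u|.-1; set vs := vertices o a.
have uk : k.+1 = #|` val u| by rewrite prednK// simplex_card_gt0.
have uvs : uniq vs by exact: vertices_uniq.
pose h q : int := (fs q == val u)%:R; pose g q : int := (fs q == val r)%:R.
(* A list without repetitions of the wrong length cannot span [u]; this disposes of truncations of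
   lists that are too short. *)
have h0 q : uniq q -> size q != k.+1 -> h q = 0.
  move=> uq; rewrite uk /h => sq; have [e|//] := eqVneq (fs q) (val u).
  by move: sq; rewrite -e card_fs// eqxx.
have -> : \sum_(t <- faces a) (chi t r a)%:R * inc u t =
    alt h (take k.+2 vs) * g (drop k.+1 vs).
  rewrite -(on_seq_inc u (take_subseq _ _)) -(sum_faces_pick _ (take_subseq _ _)).
  rewrite mulr_suml; apply: eq_bigr => t _.
  have [->|/inc_card tu] := eqVneq (inc u t) 0; first by rewrite !mulr0 mul0r.
  by rewrite /chi /front /back tu -uk /= -mulnb natrM mulrAC.
have -> : \sum_(b <- faces a) (chi u r b)%:R * inc b a =
    alt (fun q => h (take k.+1 q) * g (drop k q)) vs.
  under eq_bigr do rewrite -mulrzz.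
  rewrite sum_inc; apply: eq_alt => i ia.
  have [d0|d0] := eqVneq (del i (vertices o a)) [::].
    by rewrite -/vs in d0; rewrite d0 on_seq0 h0// mul0r.
  have [b bE ba] := subseq_face (del_subseq i _) d0; rewrite (on_seqE _ bE).
  have [_ bv] := vertices_subseq (del_subseq i _) bE.
  by rewrite /chi /front /back bv -mulnb natrM.
have -> : \sum_(s <- faces a) (chi u s a)%:R * inc r s =
    h (take k.+1 vs) * alt g (drop k vs).
  rewrite -(on_seq_inc r (drop_subseq _ _)) -(sum_faces_pick _ (drop_subseq _ _)).
  rewrite mulr_sumr; apply: eq_bigr => s _.
  by rewrite /chi /front /back -/k -mulnb natrM mulrA.
(* If [a] has at most [k.+1] vertices, its facets are too short to have [u] as front face, and the
   back list has at most one vertex, whose only deletion is empty. So every term vanishes. *)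
have [kvs|kvs] := ltnP k.+1 (size vs).
  by rewrite alt_take_drop// addrK.
have h1 i : (i < size vs)%N -> h (take k.+1 (del i vs)) = 0.
  move=> ivs; rewrite h0 ?take_uniq ?(subseq_uniq (del_subseq i vs))//.
  rewrite take_oversize size_del //; last by rewrite (leq_trans (leq_pred _)).
  by rewrite neq_ltn; apply/orP; left; rewrite (leq_trans _ kvs)// prednK// (leq_ltn_trans _ ivs).
have -> : alt h (take k.+2 vs) = 0.
  rewrite take_oversize; last exact: leqW.
  apply: big1 => i _; rewrite [h _](_ : _ = 0) ?mul0rz//.
  rewrite -(h1 i)// take_oversize// size_del// (leq_trans (leq_pred _))//.
rewrite mul0r; have -> : alt (fun q => h (take k.+1 q) * g (drop k q)) vs = 0.
  by apply: big1 => i _; rewrite h1// mul0r mul0rz.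
suff -> : alt g (drop k vs) = 0 by rewrite !mulr0 subr0.
have : (size (drop k vs) <= 1)%N by rewrite size_drop leq_subLR addn1.
case: (drop k vs) => [|y [|//]] _; first by rewrite /alt big_ord0.
rewrite /alt big_ord1 /del /= /g; case: eqP => [r0|_]; last by rewrite mul0rz.
by have := simplex_card_gt0 r; rewrite -r0 card_fs.
Qed.

End FrontBack.

(** * Contracting a simplex onto one of its vertices *)

Section Cone.
Variables (V : choiceType) (n : nat) (X : lfcomplex V n) (o : orientation X).
Implicit Types (s t u r a k : simplex X) (v w : V).
Local Open Scope fset_scope.
Local Open Scope ring_scope.
Notation inc := (inc o).

Lemma face_del s v : val s `\ v != fset0 ->
  {t : simplex X | val t = val s `\ v}.
Proof.
move=> ne.
by exists (Sub (val s `\ v) (sc_closed (fsubD1set _ _) ne (valP s))).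
Qed.

Lemma face_add s a v : sle s a -> v \in val a ->
  {t : simplex X | val t = v |` val s & sle t a}.
Proof.
move=> sa va; have sub : v |` val s `<=` val a by rewrite fsubUset fsub1set va.
have ne : v |` val s != fset0 by apply/fset0Pn; exists v; rewrite fset1U1.
by exists (Sub (v |` val s) (sc_closed sub ne (valP a))).
Qed.

Lemma inc_del_neq0 t s v : v \in val s -> val t = val s `\ v -> inc t s != 0.
Proof. by move=> vs tE; rewrite (inc_del o vs tE) signr_eq0. Qed.

(** The augmentation kills boundaries: an edge has two endpoints of opposite incidence, and the
    facets of any other simplex are not vertices. *)
Lemma sum_inc_vertex r a : sle r a ->
  \sum_(v <- faces a) (#|` val v| == 1%N)%:R * inc v r = 0.
Proof.
move=> ra; under eq_bigr do rewrite -mulrzz.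
rewrite sum_inc_faces//.
rewrite (eq_alt (g := fun q => (size q == 1%N)%:R)); last first.
  move=> i ir; have [->|d0] := eqVneq (del i (vertices o r)) [::].
    by rewrite on_seq0.
  have [t tE _] := subseq_face (del_subseq i _) d0; rewrite (on_seqE _ tE).
  by have [_ tv] := vertices_subseq (del_subseq i _) tE; rewrite -tv size_vertices.
have [r2|r2] := eqVneq (size (vertices o r)) 2%N.
  case: (vertices o r) r2 => [|x [|y []]] // _.
  by rewrite /alt big_ord_recl big_ord1.
apply: big1 => i _; rewrite size_del//.
have /negbTE -> : (size (vertices o r)).-1 != 1%N.
  by move: r2; case: (size _) => [|[|[|m]]].
by rewrite mul0rz.
Qed.

(* The matrix of the contraction of the chains of a simplex onto its vertex w. *)
Definition cone w k r : int :=
  ((w \in val r) && (w \notin val k))%:R * inc k r.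

Lemma cone_neq0 w k r : cone w k r != 0 ->
  [/\ w \in val r, w \notin val k, val r = w |` val k & val k = val r `\ w].
Proof.
rewrite /cone; case: (boolP (w \in val r)) => /= wr; last by rewrite mul0r eqxx.
case: (boolP (w \in val k)) => /= wk; first by rewrite mul0r eqxx.
rewrite mul1r => /inc_codim1[v vr kE].
have /eqP vw : v == w.
  by apply: contraNT wk => vw; rewrite kE !inE eq_sym vw.
by rewrite vw in kE; split=> //; rewrite kE fsetD1K.
Qed.

(** The cone adds [w] with the incidence number itself as sign, so the position of [w] is never
    tracked and one lemma serves first and last vertices. Diagonal terms are squares of signs; when
    [w] is in [r] but not in [s], the terms are controlled by square-zero or by the augmentation. *)
Lemma cone_homotopy w a s r : w \in val a -> sle s a -> sle r a ->
  \sum_(k <- faces a) cone w k r * inc k s +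
  \sum_(k <- faces a) cone w s k * inc r k =
  (s == r)%:R - ((val r == [fset w]) && (#|` val s| == 1%N))%:R.
Proof.
move=> wa sa ra.
have pick1 (f : simplex X -> int) k0 : sle k0 a ->
    (forall k, f k != 0 -> k = k0) -> \sum_(k <- faces a) f k = f k0.
  move=> ka fk; rewrite (eq_big_supp (r2 := [:: k0])) ?fset_uniq ?big_seq1//.
    by move=> k _ /fk ->; rewrite inE.
  by move=> k; rewrite inE mem_faces => /eqP->.
have S1a : w \notin val r -> \sum_(k <- faces a) cone w k r * inc k s = 0.
  by move=> wr; apply: big1 => k _; rewrite /cone (negbTE wr) !mul0r.
have S1b : val r = [fset w] -> \sum_(k <- faces a) cone w k r * inc k s = 0.
  move=> rw; apply: big1 => k _; apply/eqP; rewrite mulf_eq0; apply/orP; left.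
  apply/negPn/negP => /cone_neq0[_ _ _ kE].
  by have := simplex_card_gt0 k; rewrite kE rw fsetDv cardfs0.
have S2a : w \in val s -> \sum_(k <- faces a) cone w s k * inc r k = 0.
  by move=> ws; apply: big1 => k _; rewrite /cone ws andbF !mul0r.
have rwE : w \in val r -> val r != [fset w] -> {k0 | val k0 = val r `\ w & sle k0 a /\ 
    \sum_(k <- faces a) cone w k r * inc k s = inc k0 r * inc k0 s}.
  move=> wr rw; have ne : val r `\ w != fset0.
    apply: contra rw => /eqP rw; rewrite -(fsetD1K wr) rw.
    by rewrite fsetU0.
  have [k0 kE] := face_del ne; have k0a : sle k0 a.
    by rewrite /sle kE; apply: fsubset_trans ra; exact: fsubD1set.
  exists k0 => //; split=> //; rewrite (pick1 _ k0)//.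
    by rewrite /cone kE wr !inE eqxx mul1r.
  move=> k; rewrite mulf_eq0 negb_or => /andP[/cone_neq0[_ _ _ kE'] _].
  by apply/val_inj; rewrite kE.
have [ws|ws] := boolP (w \in val s).
  rewrite (S2a ws) addr0; have [wr|wr] := boolP (w \in val r); last first.
    rewrite S1a//; have [sr|_] := eqVneq s r; first by rewrite -sr ws in wr.
    have [rw|_] := eqVneq (val r) [fset w]; last by rewrite subr0.
    by rewrite rw fset11 in wr.
  have [rw|rw] := eqVneq (val r) [fset w].
    rewrite S1b//= -val_eqE /= rw.
    suff -> : (val s == [fset w]) = (#|` val s| == 1%N) by rewrite subrr.
    by rewrite eq_sym eqEfcard fsub1set ws cardfs1 eqn_leq simplex_card_gt0 andbT.
  have [k0 kE [ka ->]] := rwE wr rw; rewrite subr0.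
  have [->|sr] := eqVneq s r; first by rewrite inc_sqr// (inc_del_neq0 wr).
  apply/eqP; rewrite mulf_eq0; apply/orP; right; apply: contraNT sr.
  move=> /inc_codim1[v vs kE']; have vw : v = w.
    apply/eqP; apply: contraTT ws => vw; apply/negP => ws.
    have : w \in val k0 by rewrite kE' !inE eq_sym vw.
    by rewrite kE !inE eqxx.
  by apply/eqP/val_inj; rewrite -(fsetD1K vs) -kE' kE vw fsetD1K.
have [sw swE swa] := face_add sa wa.
have wsw : w \in val sw by rewrite swE fset1U1.
have sE : val s = val sw `\ w.
  by rewrite swE; apply/fsetP => v; rewrite !inE; case: eqVneq => // ->; rewrite (negbTE ws).
have inc_s := inc_del_neq0 wsw sE.
have -> : \sum_(k <- faces a) cone w s k * inc r k = inc s sw * inc r sw.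
  rewrite (pick1 _ sw)//; first by rewrite /cone wsw ws mul1r.
  move=> k; rewrite mulf_eq0 negb_or => /andP[/cone_neq0[_ _ kE _] _].
  by apply/val_inj; rewrite kE.
have [wr|wr] := boolP (w \in val r); last first.
  rewrite S1a// add0r; have [<-|sr] := eqVneq s r; last first.
    rewrite [inc r sw](_ : _ = 0) ?mulr0.
      have [rw|_] := eqVneq (val r) [fset w]; last by rewrite subr0.
      by rewrite rw fset11 in wr.
    apply/eqP; apply: contraNT sr => /inc_codim1[v vs rE].
    have /eqP vw : v == w by apply: contraNT wr => vw; rewrite rE !inE eq_sym vw.
    by apply/eqP/val_inj; rewrite rE vw.
  have [sw1|_] := eqVneq (val s) [fset w]; first by rewrite sw1 fset11 in ws.
  by rewrite inc_sqr// subr0.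
have sr : s != r by apply: contraNneq ws => ->.
rewrite (negbTE sr); have [rw|rw] := eqVneq (val r) [fset w].
  rewrite S1b// !add0r /=; have [s1|s1] := eqVneq #|` val s| 1%N.
    (* Here [s] and [r] are the two endpoints of the edge [sw]. *)
    have : inc s sw + inc r sw = 0.
      rewrite -[RHS](sum_inc_vertex swa) (eq_big_supp (r2 := [:: s; r])) ?fset_uniq//=.
      - by rewrite big_cons big_seq1 s1 rw cardfs1 eqxx !mul1r.
      - by rewrite inE andbT.
      - move=> v va; rewrite mulf_eq0 negb_or => /andP[v1 /inc_codim1[u us vE]].
        rewrite !inE; have [uw|uw] := eqVneq u w.
          by rewrite -[v == s]val_eqE /= vE uw -sE eqxx.
        apply/orP; right; rewrite -val_eqE rw eq_sym eqEfcard fsub1set cardfs1.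
        rewrite vE !inE eq_sym uw wsw /= -vE.
        by move: v1; have [->//|_] := eqVneq #|` val v| 1%N; rewrite eqxx.
      - by move=> v; rewrite !inE => /orP[]/eqP->; rewrite mem_faces.
    move=> /eqP; rewrite addrC addr_eq0 => /eqP ->.
    by rewrite mulrN inc_sqr.
  rewrite oppr0; apply/eqP; rewrite mulf_eq0; apply/orP; right.
  apply: contraNT s1 => /inc_card; rewrite rw cardfs1 swE cardfsU1 ws.
  by rewrite add1n => -[->].
have [k0 kE [ka ->]] := rwE wr rw; rewrite subr0.
have inc_r := inc_del_neq0 wr kE.
have wk : w \notin val k0 by rewrite kE !inE eqxx.
(* A facet of [sw] having [k0] as a facet arises by dropping [w] or by adding [w] to [k0], so only
   [s] and [r] occur in the square-zero relation. Multiplying it by two signs gives the claim. *)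
have := inc_inc o k0 swa; rewrite (eq_big_supp (r2 := [:: s; r])) ?fset_uniq//=.
- rewrite big_cons big_seq1 => I1.
  have := congr1 (fun z => z * (inc s sw * inc k0 r)) I1.
  rewrite mul0r => I2; rewrite mulr0n -[RHS]I2.
  have -> : (inc k0 s * inc s sw + inc k0 r * inc r sw) * (inc s sw * inc k0 r) =
    (inc s sw * inc s sw) * (inc k0 r * inc k0 s) +
    (inc k0 r * inc k0 r) * (inc s sw * inc r sw) by ring.
  by rewrite !inc_sqr// !mul1r.
- by rewrite inE andbT.
- move=> x _; rewrite mulf_eq0 negb_or => /andP[/inc_codim1[v vx kv] /inc_codim1[u us xE]].
  rewrite !inE; have [uw|uw] := eqVneq u w.
    by rewrite -[x == s]val_eqE /= xE uw -sE eqxx.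
  have wx : w \in val x by rewrite xE !inE eq_sym uw.
  have vw : v = w.
    by apply/eqP; apply: contraNT wk => vw; rewrite kv !inE eq_sym vw.
  by apply/orP; right; rewrite -val_eqE /= -(fsetD1K vx) -kv kE vw fsetD1K.
- by move=> v; rewrite !inE => /orP[]/eqP->; rewrite mem_faces.
Qed.

End Cone.

(** * First and last vertices, and intervals of vertices *)

Section FirstLast.
Variables (V : choiceType) (n : nat) (X : lfcomplex V n) (o : orientation X).
Implicit Types (s t u r a k : simplex X) (v w x y z : V) (U : pred V).
Local Open Scope fset_scope.
Local Open Scope ring_scope.

Definition first_in U s := oapp U false (ohead (vertices o s)).
Definition last_in U s := oapp U false (ohead (rev (vertices o s))).

Lemma vertices_sorted s : sorted (ord o s) (vertices o s).
Proof.
apply: (sort_sorted_in (P := mem (val s))); last exact/allP.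
exact: ord_total.
Qed.

Lemma firstE s : exists x q, [/\ vertices o s = x :: q, x \in val s,
  {in val s, forall y, ord o s x y} & forall U, first_in U s = U x].
Proof.
have := vertices_sorted s; have := size_vertices o s.
have mems := mem_vertices o s.
rewrite /first_in; case: (vertices o s) mems => [|x q] mems.
  by move=> s0; have := simplex_card_gt0 s; rewrite -s0.
have xs : x \in val s by rewrite -mems mem_head.
move=> _ /= qx; exists x, q; split=> // y; rewrite -mems in_cons.
case/predU1P => [->|yq]; first exact: ord_refl.
have qs : all (mem (val s)) (x :: q) by apply/allP => v; rewrite mems.
have /allP := order_path_min_in (@ord_trans _ _ _ o s) qs qx.
exact.
Qed.

Lemma lastE s : exists x q, [/\ vertices o s = rcons q x, x \in val s,
  {in val s, forall y, ord o s y x} & forall U, last_in U s = U x].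
Proof.
have := vertices_sorted s; have := size_vertices o s.
have mems := mem_vertices o s.
rewrite /last_in; case: (lastP (vertices o s)) mems => [|q x] mems.
  by move=> s0; have := simplex_card_gt0 s; rewrite -s0.
have xs : x \in val s by rewrite -mems mem_rcons mem_head.
move=> _ qx; exists x, q; rewrite rev_rcons; split=> // y; rewrite -mems.
rewrite mem_rcons in_cons.
case/predU1P => [->|yq]; first exact: ord_refl.
move: qx; rewrite -rev_sorted rev_rcons /= => qx.
have qs : all (mem (val s)) (x :: rev q).
  by apply/allP => v; rewrite -mem_rev /= rev_cons revK mems.
have tr : {in mem (val s) & &, transitive (fun y x => ord o s x y)}.
  by move=> a b c ha hb hc ab bc; exact: (ord_trans ha hc hb bc ab).
have /allP := order_path_min_in tr qs qx.
by apply; rewrite mem_rev.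
Qed.

Lemma first_last_chi U t s a : chi o t s a -> first_in U s = last_in U t.
Proof.
by move=> /chiP[p [x [q [_ et es]]]]; rewrite /first_in /last_in es et rev_cat.
Qed.

Variable U : pred V.

Definition order_convex := forall a x y z, x \in val a -> y \in val a ->
  z \in val a -> ord o a x y -> ord o a y z -> U x -> U z -> U y.

Hypothesis Uconv : order_convex.
Local Notation S := (first_in U).
Local Notation T := (last_in U).

(** The first vertex of [t] lies between those of [u] and [s]. Hence an intermediate face cannot
    leave the truncation to [S], and the truncated differential still squares to zero. *)
Lemma first_convex s t u : sle s t -> sle t u -> S s -> S u -> S t.
Proof.
have [x [_ [_ xs _ ->]]] := firstE s.
have [y [_ [_ yt ty ->]]] := firstE t.
have [z [_ [_ zu uz ->]]] := firstE u.
move=> st tu; have xt := fsubsetP st _ xs.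
have [xu yu] := (fsubsetP tu _ xt, fsubsetP tu _ yt).
move=> Ux Uz; apply: (Uconv zu yu xu) => //; first exact: uz.
by rewrite -(ord_face o tu)//; exact: ty.
Qed.

Lemma last_convex s t u : sle s t -> sle t u -> T s -> T u -> T t.
Proof.
have [x [_ [_ xs _ ->]]] := lastE s.
have [y [_ [_ yt ty ->]]] := lastE t.
have [z [_ [_ zu uz ->]]] := lastE u.
move=> st tu; have xt := fsubsetP st _ xs.
have [xu yu] := (fsubsetP tu _ xt, fsubsetP tu _ yt).
move=> Ux Uz; apply: (Uconv xu yu zu) => //; last exact: uz.
by rewrite -(ord_face o tu)//; exact: ty.
Qed.

Lemma first_in1 s x : val s = [fset x] -> S s = U x.
Proof.
move=> vx; have [y [_ [_ + _ ->]]] := firstE s.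
by rewrite vx inE => /eqP ->.
Qed.

Lemma last_in1 s x : val s = [fset x] -> T s = U x.
Proof.
move=> vx; have [y [_ [_ + _ ->]]] := lastE s.
by rewrite vx inE => /eqP ->.
Qed.

Lemma card1P s : #|` val s| == 1%N -> exists x, val s = [fset x].
Proof. by move=> /cardfs1P. Qed.

(* Every vertex of s lies between the first vertex of s and the last one of a. *)
Lemma between_in s a y : sle s a -> S s -> T a -> y \in val s -> U y.
Proof.
have [x [_ [_ xs sx ->]]] := firstE s.
have [z [_ [_ za az ->]]] := lastE a.
move=> sa Ux Uz ys.
have [xa ya] := (fsubsetP sa _ xs, fsubsetP sa _ ys).
apply: (Uconv xa ya za) => //; last exact: az.
by rewrite -(ord_face o sa)//; exact: sx.
Qed.

Lemma between_in' s a y : sle s a -> T s -> S a -> y \in val s -> U y.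
Proof.
have [x [_ [_ xs sx ->]]] := lastE s.
have [z [_ [_ za az ->]]] := firstE a.
move=> sa Ux Uz ys.
have [xa ya] := (fsubsetP sa _ xs, fsubsetP sa _ ys).
apply: (Uconv za ya xa) => //; first exact: az.
by rewrite -(ord_face o sa)//; exact: sx.
Qed.

(** The last vertex of [a] lies between [y] and the last vertex of [b]. A face that still meets [U]
    therefore survives the truncation to [T]. *)
Lemma last_in_face a b y : sle a b -> T b -> y \in val a -> U y -> T a.
Proof.
have [x [_ [_ xa ax ->]]] := lastE a.
have [z [_ [_ zb bz ->]]] := lastE b.
move=> ab Uz ya Uy.
have [xb yb] := (fsubsetP ab _ xa, fsubsetP ab _ ya).
apply: (Uconv yb xb zb) => //; last exact: bz.
by rewrite -(ord_face o ab)//; exact: ax.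
Qed.

Lemma first_in_face a b y : sle a b -> S b -> y \in val a -> U y -> S a.
Proof.
have [x [_ [_ xa ax ->]]] := firstE a.
have [z [_ [_ zb bz ->]]] := firstE b.
move=> ab Uz ya Uy.
have [xb yb] := (fsubsetP ab _ xa, fsubsetP ab _ ya).
apply: (Uconv zb xb yb) => //; first exact: bz.
by rewrite -(ord_face o ab)//; exact: ax.
Qed.

(** Adding the largest vertex of [a] does not affect the minimum of a nonempty face, so coning onto
    the last vertex respects conditions on first vertices. *)
Lemma first_in_cone k r a w : sle r a -> w \in val a ->
  {in val a, forall y, ord o a y w} -> val r = w |` val k -> S r = S k.
Proof.
move=> ra wa aw rE; have [x [_ [_ xk kx ->]]] := firstE k.
have kr : sle k r by rewrite /sle rE fsubsetUr.
have [y [_ [_ yr ry ->]]] := firstE r.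
have xr := fsubsetP kr _ xk.
have [xa ya] := (fsubsetP ra _ xr, fsubsetP ra _ yr).
congr (U _); apply: (ord_anti (o := o) (s := r)) => //.
rewrite ry//=; move: yr; rewrite rE in_fset1U => /predU1P[yw|yk].
  by rewrite (ord_face o ra) ?yw ?aw// rE fset1U1.
by rewrite -(ord_face o kr)// kx.
Qed.

Lemma last_in_cone k r a w : sle r a -> w \in val a ->
  {in val a, forall y, ord o a w y} -> val r = w |` val k -> T r = T k.
Proof.
move=> ra wa aw rE; have [x [_ [_ xk kx ->]]] := lastE k.
have kr : sle k r by rewrite /sle rE fsubsetUr.
have [y [_ [_ yr ry ->]]] := lastE r.
have xr := fsubsetP kr _ xk.
have [xa ya] := (fsubsetP ra _ xr, fsubsetP ra _ yr).
congr (U _); apply: (ord_anti (o := o) (s := r)) => //.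
rewrite ry//= andbT; move: yr; rewrite rE in_fset1U => /predU1P[yw|yk].
  by rewrite (ord_face o ra) ?yw ?aw// rE fset1U1.
by rewrite -(ord_face o kr)// kx.
Qed.

End FirstLast.

(** Signs move from the ring to the integers, which act on every bimodule and commute with every
    morphism; later sign computations take place in [int]. *)
Lemma signr_scalez (A : pzRingType) (M : lmodType A) i (x : M) :
  (-1) ^+ i *: x = x *~ (-1) ^+ i.
Proof.
rewrite -signr_odd -[in RHS]signr_odd; case: (odd i) => /=.
  by rewrite !expr1 scaleN1r mulrN1z.
by rewrite !expr0 scale1r mulr1z.
Qed.

Lemma bihom_sum (A B : pzRingType) (M N : bimodType A B) (f : bihom M N)
    (I : Type) (r : seq I) (F : I -> M) :
  f (\sum_(i <- r) F i) = \sum_(i <- r) f (F i).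
Proof. exact: raddf_sum. Qed.

Lemma bihomMz (A B : pzRingType) (M N : bimodType A B) (f : bihom M N) x z :
  f (x *~ z) = f x *~ z.
Proof. exact: raddfMz. Qed.

(** * Families indexed by simplices *)

Section BigProd.
Variables (A B : pzRingType) (I : Type) (M : I -> bimodType A B).
Implicit Types f g : bprod M.

Lemma bprodP f g : (forall i, f i = g i) -> f = g.
Proof. exact: functional_extensionality_dep. Qed.

Lemma bprod_sum (J : Type) (r : seq J) (f : J -> bprod M) i :
  (\sum_(j <- r) f j) i = \sum_(j <- r) f j i.
Proof. by elim: r => [|j r IHr]; rewrite ?big_nil// !big_cons bprodDE IHr. Qed.

Lemma bprod_mulz f z i : (f *~ z) i = f i *~ z.
Proof.
have mulnE j : (f *+ j) i = f i *+ j.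
  by elim: j => // j IHj; rewrite !mulrS bprodDE IHj.
case: z => j; first exact: mulnE.
by rewrite -[LHS]/(- ((f *+ j.+1) i)) mulnE.
Qed.

End BigProd.

Section Families.
Variables (V : choiceType) (n : nat) (X : lfcomplex V n) (o : orientation X).
Variables A B : pzRingType.
Implicit Types (s t u r a : simplex X) (F : sheaf X A B) (G : cosheaf X A B).

Lemma shm_comp F s t u x : sle s t -> sle t u ->
  shm F t u (shm F s t x) = shm F s u x.
Proof.
by move=> st tu; rewrite !shmE; [exact: sle_trans tu|move=> su; exact: sh_map_comp].
Qed.

Lemma shm_id F s x : shm F s s x = x.
Proof. by rewrite (shmE _ (sle_refl s)) sh_map_id. Qed.

Lemma coshm_comp G s t u x : sle s t -> sle t u ->
  coshm G t s (coshm G u t x) = coshm G u s x.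
Proof.
by move=> st tu; rewrite !coshmE; [exact: sle_trans tu|move=> su; exact: cosh_map_comp].
Qed.

Lemma coshm_id G s x : coshm G s s x = x.
Proof. by rewrite (coshmE _ (sle_refl s)) cosh_map_id. Qed.

(* Boundary and coboundary of families indexed by all simplices at once. *)
Definition Bd G (c : bprod G) : bprod G := fun t =>
  \sum_(s <- star t) coshm G s t (c s) *~ inc o t s.

Definition Cob F (phi : bprod F) : bprod F := fun s =>
  \sum_(t <- faces s) shm F t s (phi t) *~ inc o t s.

Lemma eq_Bd G (c c' : bprod G) t :
  (forall s, inc o t s != 0 -> c s = c' s) -> Bd c t = Bd c' t.
Proof.
move=> cc; apply: eq_bigr => s _.
by have [->|/cc ->//] := eqVneq (inc o t s) 0; rewrite !mulr0z.
Qed.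

Lemma eq_Cob F (c c' : bprod F) s :
  (forall t, inc o t s != 0 -> c t = c' t) -> Cob c s = Cob c' s.
Proof.
move=> cc; apply: eq_bigr => t _.
by have [->|/cc ->//] := eqVneq (inc o t s) 0; rewrite !mulr0z.
Qed.

Lemma Bd0 G t : Bd (0 : bprod G) t = 0.
Proof. by apply: big1 => s _; rewrite bihom0 mul0rz. Qed.

Lemma Cob0 F s : Cob (0 : bprod F) s = 0.
Proof. by apply: big1 => t _; rewrite bihom0 mul0rz. Qed.

Lemma BdB G (c c' : bprod G) t : Bd (c - c') t = Bd c t - Bd c' t.
Proof. by rewrite -sumrB; apply: eq_bigr => s _; rewrite -mulrzBl -bihomB. Qed.

Lemma CobB F (c c' : bprod F) s : Cob (c - c') s = Cob c s - Cob c' s.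
Proof. by rewrite -sumrB; apply: eq_bigr => t _; rewrite -mulrzBl -bihomB. Qed.

Lemma Bd_mulz G (c : bprod G) t z : Bd (fun s => c s *~ z) t = Bd c t *~ z.
Proof.
rewrite mulrz_suml; apply: eq_bigr => s _.
by rewrite raddfMz mulrzAC.
Qed.

Lemma Cob_mulz F (c : bprod F) t z : Cob (fun s => c s *~ z) t = Cob c t *~ z.
Proof.
rewrite mulrz_suml; apply: eq_bigr => s _.
by rewrite raddfMz mulrzAC.
Qed.

Lemma bihom_Cob F (N : bimodType A B) s (f : bihom (F s) N) (c : bprod F) :
  f (Cob c s) = \sum_(t <- faces s) f (shm F t s (c t)) *~ inc o t s.
Proof. by rewrite bihom_sum; apply: eq_bigr => t _; rewrite bihomMz. Qed.

Lemma mulz_neq0l (M : zmodType) (x : M) z : x *~ z != 0 -> x != 0.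
Proof. by apply: contra_neq => ->; rewrite mul0rz. Qed.

Lemma mulz_neq0r (M : zmodType) (x : M) z : x *~ z != 0 -> z != 0.
Proof. by apply: contra_neq => ->; rewrite mulr0z. Qed.

Lemma sum_star_widen (M : zmodType) (f : simplex X -> M) s t : sle t s ->
  (forall u, f u != 0 -> sle s u) ->
  \sum_(u <- star s) f u = \sum_(u <- star t) f u.
Proof.
move=> ts f0; apply: eq_big_supp; rewrite ?fset_uniq// => u.
  by rewrite !mem_star => su _; exact: sle_trans su.
by rewrite !mem_star => _ /f0.
Qed.

Lemma sum_faces_widen (M : zmodType) (f : simplex X -> M) s t : sle s t ->
  (forall u, f u != 0 -> sle u s) ->
  \sum_(u <- faces s) f u = \sum_(u <- faces t) f u.
Proof.
move=> st f0; apply: eq_big_supp; rewrite ?fset_uniq// => u.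
  by rewrite !mem_faces => su _; exact: sle_trans st.
by rewrite !mem_faces => _ /f0.
Qed.

Lemma sum_star_faces (M : zmodType) (f : simplex X -> M) s t :
  (forall u, f u != 0 -> sle s u && sle u t) ->
  \sum_(u <- star s) f u = \sum_(u <- faces t) f u.
Proof.
move=> f0; apply: eq_big_supp; rewrite ?fset_uniq// => u _ /f0/andP[su ut].
  by rewrite mem_faces.
by rewrite mem_star.
Qed.

Lemma Bd_Bd G (c : bprod G) t : Bd (Bd c) t = 0.
Proof.
transitivity (\sum_(s <- star t) (\sum_(u <- star t)
    coshm G u t (c u) *~ inc o s u) *~ inc o t s).
  rewrite [LHS]big_seq [RHS]big_seq; apply: eq_bigr => s; rewrite mem_star => ts.
  congr (_ *~ _); rewrite raddf_sum -(sum_star_widen ts); last first.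
    by move=> u /mulz_neq0r/inc_sle.
  rewrite big_seq [RHS]big_seq; apply: eq_bigr => u; rewrite mem_star => su.
  by rewrite raddfMz /= coshm_comp.
rewrite sum_sum_mulrz; apply: big1 => u _.
rewrite (sum_star_faces (t := u)) => [|s]; last first.
  by rewrite mulf_eq0 negb_or => /andP[/inc_sle-> /inc_sle->].
under eq_bigr do rewrite mulrC.
by rewrite inc_inc ?mulr0z// sle_refl.
Qed.

Lemma Cob_Cob F (c : bprod F) t : Cob (Cob c) t = 0.
Proof.
transitivity (\sum_(s <- faces t) (\sum_(u <- faces t)
    shm F u t (c u) *~ inc o u s) *~ inc o s t).
  rewrite [LHS]big_seq [RHS]big_seq; apply: eq_bigr => s; rewrite mem_faces => st.
  congr (_ *~ _); rewrite raddf_sum -(sum_faces_widen st); last first.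
    by move=> u /mulz_neq0r/inc_sle.
  rewrite big_seq [RHS]big_seq; apply: eq_bigr => u; rewrite mem_faces => us.
  by rewrite raddfMz /= shm_comp.
rewrite sum_sum_mulrz; apply: big1 => u _.
by rewrite inc_inc ?mulr0z// sle_refl.
Qed.

(* Finiteness of supports is preserved by operations that only relate simplices
   with a common coface. *)
Lemma finite_near (D D' : set (simplex X)) : finite_set D ->
  (forall t, D' t -> exists2 s, D s & exists2 u, sle s u & sle t u) ->
  finite_set D'.
Proof.
move=> finD near; apply: (@sub_finite_set _ _ (\bigcup_(s in D)
  \bigcup_(u in [set u | sle s u]) [set t | sle t u])%classic).
  by move=> t /near[s Ds [u su tu]]; exists s => //; exists u.
apply: bigcup_finite => // s _; apply: bigcup_finite => [|u _].
  exact: finite_star.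
exact: finite_faces.
Qed.

Section Extension.
Variables (K : subcomplex X) (k : int) (F : simplex X -> bimodType A B).

(** Matching on [idP] supplies the membership proof for the index, so that no transport between
    fibres of [F] is needed. *)
Definition ext_fun (c : bprod (fun s : simp K k => F (val s))) : bprod F :=
  fun s => if @idP ((s \in sub_mem K) && (dim s == k)) is ReflectT sK
           then c (exist _ s sK) else 0.

Lemma ext_val c (s : simp K k) : ext_fun c (val s) = c s.
Proof.
case: s => s sK; rewrite /ext_fun /=; case: {-}_ / idP => [sK'|//].
by rewrite (bool_irrelevance sK sK').
Qed.

Lemma ext_out c s : ~~ ((s \in sub_mem K) && (dim s == k)) -> ext_fun c s = 0.
Proof. by rewrite /ext_fun; case: {-}_ / idP => // sK; rewrite sK. Qed.

Lemma simp_case s : (exists t : simp K k, val t = s) \/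
  ~~ ((s \in sub_mem K) && (dim s == k)).
Proof.
by have [sK|sK] := boolP ((s \in sub_mem K) && (dim s == k)); [left|right]; first exists (exist _ s sK).
Qed.

Lemma ext_linear : linear ext_fun.
Proof.
move=> x c c'; apply: bprodP => s.
rewrite bprodDE bprodZE; have [[t <-]|nt] := simp_case s; first by rewrite !ext_val.
by rewrite !ext_out// scaler0 addr0.
Qed.

Lemma ext_rscale b : {morph ext_fun : x / rscale x b}.
Proof.
move=> x; apply: bprodP => s.
rewrite bprodRE; have [[t <-]|nt] := simp_case s; first by rewrite !ext_val.
by rewrite !ext_out// rscale0l.
Qed.

Definition ext fin :
    bihom (dsum fin (fun s : simp K k => F (val s))) (bprod F) :=
  bihom_comp (Bihom ext_linear ext_rscale) (sub_incl _).

End Extension.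

Section Mask.
Variables (K : subcomplex X) (F : simplex X -> bimodType A B).

Definition off_fun (c : bprod F) : bprod F :=
  fun s => if s \in sub_mem K then 0 else c s.

Definition off : bihom (bprod F) (bprod F).
Proof.
exists off_fun => [x c c'|b c]; apply: bprodP => s.
  by rewrite bprodDE bprodZE /off_fun; case: ifP => // _; rewrite scaler0 addr0.
by rewrite bprodRE /off_fun; case: ifP => // _; rewrite rscale0l.
Defined.

End Mask.

Definition rel_cochains_ext fin F K k :
    bihom (rel_cochains fin F K k) (bprod F) :=
  bihom_comp (ext (full_sub X) k F fin)
             (sub_incl (vanish_on fin F K k)).

Fact off_chains_in fin G K k (c : chains fin G (full_sub X) k) :
  c \in subbimod_mem (chains_in fin G K k) ->
  bihom_comp (off K G) (ext (full_sub X) k G fin) c = 0.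
Proof.
move=> /asboolP c0; apply: bprodP => s /=.
rewrite /off_fun; case: ifPn => // sK.
have [[t ts]|nt] := simp_case (full_sub X) k s; last by rewrite ext_out.
by rewrite -ts ext_val; apply: c0; rewrite ts.
Qed.

Definition rel_chains_ext fin G K k : bihom (rel_chains fin G K k) (bprod G) :=
  quot_lift (@off_chains_in fin G K k).

(* M is, via e, the module of (finite, if fin holds) families supported on P. *)
Record is_model (F : simplex X -> bimodType A B) (fin : bool)
    (P : pred (simplex X)) (M : bimodType A B) (e : bihom M (bprod F)) : Prop := {
  model_inj : injective e;
  model_out : forall c s, ~~ P s -> e c s = 0;
  model_fin : forall c, fin -> finite_set [set s | e c s != 0];
  model_surj : forall x : bprod F, (forall s, ~~ P s -> x s = 0) ->
    (fin -> finite_set [set s | x s != 0]) -> exists c, e c = x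
}.

Lemma ext_model fin K k (F : simplex X -> bimodType A B) (P : pred (simplex X)) :
  (forall s, P s = (s \in sub_mem K) && (dim s == k)) ->
  is_model fin P (ext K k F fin).
Proof.
move=> PE; split.
- move=> c c' cc; apply: coeff_inj; apply: bprodP => s.
  have /(congr1 (fun f : bprod F => f (val s))) := cc.
  by rewrite /= !ext_val.
- by move=> c s; rewrite PE; exact: ext_out.
- move=> c /(coeff_fin c) finc; apply: sub_finite_set (finite_image val finc).
  move=> s /= cs; have [[t ts]|nt] := simp_case K k s; last by rewrite ext_out ?eqxx in cs.
  by exists t => //=; move: cs; rewrite -ts ext_val.
- move=> x xP finx.
  have fx : (fun s : simp K k => x (val s)) \in subbimod_mem (supp_cond fin (fun s : simp K k => F (val s))).
    rewrite inE; apply/implyP => finT; apply/asboolP.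
    apply: (@sub_finite_set _ _ (val @^-1` [set s | x s != 0])%classic) => //.
    by apply: finite_preimage (finx finT) => t u _ _; exact: val_inj.
  exists (mk_dsum fx); apply: bprodP => s.
  have [[t <-]|nt] := simp_case K k s; first exact: ext_val.
  by rewrite xP ?PE//; exact: ext_out.
Qed.

End Families.

(** * Chain and cochain groups as families with prescribed support *)

Section Models.
Variables (V : choiceType) (n : nat) (X : lfcomplex V n) (o : orientation X).
Variables (A B : pzRingType) (fin : bool).
Implicit Types (s t u r a : simplex X) (F : sheaf X A B) (G : cosheaf X A B).
Implicit Types (K : subcomplex X) (k : int).

Lemma rel_chains_ext_pi G K k c :
  rel_chains_ext fin G K k (quot_pi _ c) = off_fun K (ext _ k G fin c).
Proof. exact: quot_liftE. Qed.

Lemma rel_cochains_model F K k (P : pred (simplex X)) :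
  (forall s, P s = (s \notin sub_mem K) && (dim s == k)) ->
  is_model fin P (rel_cochains_ext fin F K k).
Proof.
move=> PE; have M := @ext_model _ _ _ A B fin (full_sub X) k F _ (fun=> erefl).
split.
- by move=> c c' /(model_inj M)/val_inj.
- move=> c s; rewrite PE negb_and negbK => /orP[sK|sk]; last first.
    by apply: (model_out M); rewrite negb_and sk orbT.
  have [[t ts]|nt] := simp_case (full_sub X) k s; last exact: (model_out M).
  have /asboolP c0 := valP c; rewrite -ts /= ext_val; apply: c0.
  by rewrite ts.
- by move=> c /(model_fin M (val c)).
- move=> x xP xfin; have [|c cx] := model_surj M _ xfin.
    by move=> s /= sk; apply: xP; rewrite PE negb_and sk orbT.
  have cK : c \in subbimod_mem (vanish_on fin F K k).
    apply/asboolP => s sK; rewrite -(ext_val (coeff c)).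
    rewrite -[LHS]/(ext (full_sub X) k F fin c (val s)) cx xP// PE sK.
    by [].
  by exists (exist _ c cK).
Qed.

(** A relative chain has a unique representative vanishing on [K], so this quotient too is a group
    of supported families. *)
Lemma rel_chains_model G K k (P : pred (simplex X)) :
  (forall s, P s = (s \notin sub_mem K) && (dim s == k)) ->
  is_model fin P (rel_chains_ext fin G K k).
Proof.
move=> PE; have M := @ext_model _ _ _ A B fin (full_sub X) k G _ (fun=> erefl).
split.
- move=> c c'; rewrite -[c]quot_piK -[c']quot_piK !rel_chains_ext_pi => cc.
  apply/quot_piP/asboolP => s sK.
  apply/eqP; rewrite -[coeff _ s]/(coeff (repr c) s - coeff (repr c') s) subr_eq0.
  have /(congr1 (fun f : bprod G => f (val s))) := cc.
  by rewrite /off_fun (negbTE sK) /= !ext_val => cs; apply/eqP.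
- move=> c s; rewrite PE negb_and negbK -[c]quot_piK rel_chains_ext_pi /off_fun.
  case: ifP => //= sK sk; apply: (model_out M).
  by rewrite negb_and sk orbT.
- move=> c finT; rewrite -[c]quot_piK rel_chains_ext_pi.
  apply: sub_finite_set (model_fin M (repr c) finT) => s /=.
  by rewrite /off_fun; case: ifP => //; rewrite eqxx.
- move=> x xP xfin; have [|c cx] := model_surj M _ xfin.
    by move=> s /= sk; apply: xP; rewrite PE negb_and sk orbT.
  exists (quot_pi _ c); rewrite rel_chains_ext_pi cx.
  apply: bprodP => s; rewrite /off_fun.
  by case: ifP => // sK; rewrite xP// PE sK.
Qed.

Lemma rel_chains_ext_incl K K' (KK' : {subset sub_mem K <= sub_mem K'}) G k c s :
  rel_chains_ext fin G K' k (rel_chains_incl fin KK' G k c) s =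
  if s \notin sub_mem K' then rel_chains_ext fin G K k c s else 0.
Proof.
rewrite -[c]quot_piK rel_chains_inclE !rel_chains_ext_pi /off_fun if_neg.
by case: ifPn => // sK'; case: ifP => // /KK'; rewrite (negbTE sK').
Qed.

Lemma ext_cobound F K k k' c s :
  ext K k' F fin (cobound o fin F K k k' c) s =
  if (s \in sub_mem K) && (dim s == k') then Cob o (ext K k F fin c) s else 0.
Proof.
have [[w <-]|nt] := simp_case K k' s; last by rewrite (negbTE nt) [LHS]ext_out.
have wK : (val w \in sub_mem K) && (dim (val w) == k') := valP w.
rewrite wK [LHS]ext_val [RHS]sum_inc /alt size_vertices.
apply: eq_bigr => i _; rewrite /find_simp /on_seq -omitE.
case: insubP => [t _ _|_] /=; last by rewrite mul0rz.
case: insubP => [u _ ut|nt] /=; last by rewrite ext_out// bihom0 mul0rz.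
by rewrite -ut ext_val signr_scalez.
Qed.

Lemma ext_bound G K k k' c s :
  ext K k' G fin (bound o fin G K k k' c) s =
  if (s \in sub_mem K) && (dim s == k') then Bd o (ext K k G fin c) s else 0.
Proof.
have [[w <-]|nt] := simp_case K k' s; last by rewrite (negbTE nt) [LHS]ext_out.
have wK : (val w \in sub_mem K) && (dim (val w) == k') := valP w.
rewrite wK [LHS]ext_val; apply: eq_bigr => t _.
case: insubP => [u _ ut|nt] /=; last by rewrite ext_out// bihom0 mul0rz.
rewrite -ut ext_val mulrz_sumr.
by apply: eq_bigr => i _; rewrite signr_scalez.
Qed.

Lemma rel_cochains_ext_cobound F K k k' c s :
  rel_cochains_ext fin F K k' (rel_cobound o fin F K k k' c) s =
  if (s \notin sub_mem K) && (dim s == k')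
  then Cob o (rel_cochains_ext fin F K k c) s else 0.
Proof.
have M := @rel_cochains_model F K k' _ (fun=> erefl).
case: ifPn => [/andP[_ sk]|]; last exact: (model_out M).
by rewrite [LHS]ext_cobound /= sk.
Qed.

Lemma rel_chains_ext_bound G K k k' c s :
  rel_chains_ext fin G K k' (rel_bound o fin G K k k' c) s =
  if (s \notin sub_mem K) && (dim s == k')
  then Bd o (rel_chains_ext fin G K k c) s else 0.
Proof.
have M := @rel_chains_model G K k' _ (fun=> erefl).
case: ifPn => [/andP[sK sk]|]; last exact: (model_out M).
rewrite -[c]quot_piK rel_boundE !rel_chains_ext_pi /off_fun (negbTE sK) ext_bound /= sk.
(* Masking [c] on [K] changes nothing here: a coface of a simplex outside [K] is outside [K]. *)
apply: eq_Bd => t /inc_sle st; case: ifP => // tK.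
by case/negP: sK; exact: sub_closed tK.
Qed.

End Models.

(** * Isomorphisms on homology from chain-level conditions *)

Section InducesIso.
Variables (A B : pzRingType) (L M P L' M' P' : bimodType A B).
Variables (f : bihom L M) (g : bihom M P) (f' : bihom L' M') (g' : bihom M' P').

(** The conditions concern cycles and boundaries because the cap product is a chain map only up to
    signs. Injectivity and surjectivity are solvable equations on representatives, the form in which
    the zigzags deliver them. *)
Lemma induces_isoP (h : M -> M') : linear h ->
  (forall b, {morph h : x / rscale x b}) ->
  (forall z, g z = 0 -> g' (h z) = 0) ->
  (forall y, exists y', h (f y) = f' y') ->
  (forall z y', g z = 0 -> h z = f' y' -> exists y, z = f y) ->
  (forall z', g' z' = 0 -> exists z y', g z = 0 /\ z' - h z = f' y') ->
  induces_iso f g f' g' h.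
Proof.
move=> hlin hr hc hb hinj hsurj; pose hh := Bihom hlin hr.
pose Phi := @homology_map _ _ _ _ _ _ _ _ f g f' g' hh hc hb.
have PhiE z : g z = 0 -> Phi (hclass f g z) = hclass f' g' (h z).
  by move=> gz; rewrite /Phi homology_mapE.
exists Phi; split; last by move=> z gz; split; [exact: (hc _ gz)|exact: PhiE].
have Phi_inj c : Phi c = 0 -> c = 0.
  rewrite -(hreprK c) PhiE ?hrepr_cycle// -(hclass0 f' g') => hz.
  have [y'] := (hclassP f' (hc _ (hrepr_cycle c)) (bihom0 _)).1 hz.
  rewrite subr0 => /(hinj _ _ (hrepr_cycle c))[y cy].
  rewrite -(hclass0 f g); apply/(hclassP f (hrepr_cycle c) (bihom0 _)).
  by exists y; rewrite subr0.
have Phi_surj c' : exists c, Phi c = c'.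
  have [z [y' [gz zy]]] := hsurj _ (hrepr_cycle c').
  exists (hclass f g z); rewrite PhiE// -[RHS]hreprK.
  apply/(hclassP f' (hc _ gz) (hrepr_cycle c')).
  by exists (- y'); rewrite raddfN /= -zy opprB.
pose Psi c' := projT1 (cid (Phi_surj c')).
have PsiK c' : Phi (Psi c') = c' by rewrite /Psi; case: cid.
exists Psi => // c; apply/eqP; rewrite -subr_eq0; apply/eqP/Phi_inj.
by rewrite bihomB PsiK subrr.
Qed.

End InducesIso.

Lemma quot_lift_hclass (A B : pzRingType) (L M P Q : bimodType A B)
    (f : bihom L M) (g : bihom M P) (e : bihom M Q)
    (H : forall x, x \in subbimod_mem (boundaries f g) ->
         bihom_comp e (sub_incl (kernel g)) x = 0) z :
  g z = 0 -> quot_lift H (hclass f g z) = e z.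
Proof.
by move=> gz; rewrite /hclass quot_liftE /= insubdK// inE gz.
Qed.

Lemma quot_pi_hclass (A B : pzRingType) (L M P Q : bimodType A B)
    (f : bihom L M) (g : bihom M P) (e : bihom Q M)
    (H : forall x, e x \in subbimod_mem (kernel g)) z :
  bihom_comp (quot_pi (boundaries f g)) (sub_corestr H) z = hclass f g (e z).
Proof.
rewrite /hclass /=; congr (quot_pi _ _); apply: val_inj => /=.
by rewrite insubdK//; exact: H.
Qed.

(** * Local homology and cohomology *)

Section LocalModels.
Variables (V : choiceType) (n : nat) (X : lfcomplex V n) (o : orientation X).
Variables (A B : pzRingType).
Implicit Types (s t u r a : simplex X) (k : int).

Definition in_star s k : pred (simplex X) := fun a => sle s a && (dim a == k).

Lemma out_star_dim s k a : dim a != k -> ~~ in_star s k a.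
Proof. by rewrite /in_star negb_and orbC => ->. Qed.

Lemma out_star_sle s k a : ~~ sle s a -> ~~ in_star s k a.
Proof. by rewrite /in_star negb_and => ->. Qed.

Lemma off_starE s a : (a \notin sub_mem (off_star s)) = sle s a.
Proof. by rewrite inE negbK. Qed.

Lemma dim_le_top a : dim a != n%:Z + 1.
Proof.
apply/eqP => an; have aX : (a \in sub_mem (full_sub X)) && (dim a == n%:Z + 1).
  by rewrite an eqxx.
exact: (simp_top (exist _ a aX)).
Qed.

Lemma finite_star_supp (F : simplex X -> bimodType A B) s (x : bprod F) :
  (forall a, ~~ sle s a -> x a = 0) -> finite_set [set a | x a != 0].
Proof.
move=> x0; apply: sub_finite_set (finite_star s) => a /=.
by apply: contra_neqT => /x0.
Qed.

Section Homology.
Variable G : cosheaf X A B.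

Lemma rel_chains_star_model s k :
  is_model true (in_star s k) (rel_chains_ext true G (off_star s) k).
Proof. by apply: rel_chains_model => a; rewrite off_starE. Qed.

Lemma rel_chains_star_bound s k k' c a :
  rel_chains_ext true G (off_star s) k' (rel_bound o true G (off_star s) k k' c) a =
  if in_star s k' a then Bd o (rel_chains_ext true G (off_star s) k c) a else 0.
Proof. by rewrite rel_chains_ext_bound off_starE. Qed.

(** Exactness of the local chain complex at [s] in degree [k]. Imposing the equations only on the
    star amounts to working modulo the chains of its complement. *)
Definition bd_exact s k := forall z : bprod G,
  (forall a, ~~ in_star s k a -> z a = 0) ->
  (forall a, sle s a -> Bd o z a = 0) ->
  exists w : bprod G, (forall a, ~~ in_star s (k + 1) a -> w a = 0) /\
    forall a, sle s a -> Bd o w a = z a.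

Lemma star_Bd0 (z : bprod G) s k a : (forall a, ~~ in_star s k a -> z a = 0) ->
  dim a != k - 1 -> Bd o z a = 0.
Proof.
move=> z0 ak; rewrite (@eq_Bd _ _ _ _ _ _ _ _ 0) ?Bd0// => b ab; apply: z0.
apply: out_star_dim; rewrite (inc_dim ab).
by apply: contra ak => /eqP <-; rewrite addrK.
Qed.

Lemma CM_bd_exact K : CM_at_cosheaf o G K ->
  forall s k, s \in sub_mem K -> k != n -> bd_exact s k.
Proof.
move=> CM s k sK kn z z0 zB; have M := rel_chains_star_model s k.
have [_|c cz] := model_surj M z0.
  by apply: (@finite_star_supp _ s) => a sa; exact: z0 (out_star_sle _ sa).
have gc : rel_bound o true G (off_star s) k (k - 1) c = 0.
  apply: (model_inj (rel_chains_star_model s (k - 1))); rewrite bihom0.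
  apply: bprodP => a.
  rewrite rel_chains_star_bound cz; case: ifP => // /andP[sa _].
  exact: zB.
have := CM s k sK kn (hclass (rel_bound o true G (off_star s) (k + 1) k) _ c).
rewrite -(hclass0 (rel_bound o true G (off_star s) (k + 1) k)
                  (rel_bound o true G (off_star s) k (k - 1))) => h0.
have [y] := (hclassP _ gc (bihom0 _)).1 h0; rewrite subr0 => cy.
have M' := rel_chains_star_model s (k + 1).
exists (rel_chains_ext true G (off_star s) (k + 1) y); split.
  by move=> a; exact: (model_out M').
move=> a sa; have [ak|ak] := eqVneq (dim a) k.
  by rewrite -cz cy rel_chains_star_bound /in_star sa ak eqxx.
rewrite (z0 _ (out_star_dim s ak)); apply: (star_Bd0 (model_out M' y)).
by rewrite addrK.
Qed.

Let f s := rel_bound o true G (off_star s) (n%:Z + 1) n.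
Let g s := rel_bound o true G (off_star s) n (n%:Z - 1).

(** No simplex has dimension [n + 1], so degree [n] has no boundaries and top local homology is a
    group of cycles. This makes it the kernel of a row. *)
Fact loc_ext_boundary s (x : submod (kernel (g s))) :
  x \in subbimod_mem (boundaries (f s) (g s)) ->
  bihom_comp (rel_chains_ext true G (off_star s) n) (sub_incl _) x = 0.
Proof.
move=> /asboolP[y xy].
have y0 : y = 0 by exact: rel_chains_top.
rewrite y0 in xy.
rewrite bihom0 in xy.
rewrite -[LHS]/(rel_chains_ext true G (off_star s) n (val x)).
rewrite xy.
exact: bihom0.
Qed.

(* The coefficients of a class of h_n(s) = H_n(X, X - st(s); G). *)
Definition loc_ext s : bihom (loc_hom o G n s) (bprod G) :=
  quot_lift (@loc_ext_boundary s).

Lemma loc_extE s (c : loc_hom o G n s) :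
  loc_ext s c = rel_chains_ext true G (off_star s) n (hrepr c).
Proof. by []. Qed.

Lemma loc_ext_hclass s x : g s x = 0 ->
  loc_ext s (hclass (f s) (g s) x) = rel_chains_ext true G (off_star s) n x.
Proof.
exact: quot_lift_hclass.
Qed.

Lemma loc_ext_out s c a : ~~ in_star s n a -> loc_ext s c a = 0.
Proof. exact: (model_out (rel_chains_star_model s n)). Qed.

Lemma loc_ext_inj s : injective (loc_ext s).
Proof.
move=> c c'; rewrite !loc_extE => /(model_inj (rel_chains_star_model s n)) cc.
by rewrite -[c]hreprK -[c']hreprK cc.
Qed.

Lemma loc_ext_cycle s c a : sle s a -> Bd o (loc_ext s c) a = 0.
Proof.
move=> sa; have [an|an] := eqVneq (dim a) (n%:Z - 1); last first.
  exact: (star_Bd0 (@loc_ext_out s c)).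
have := congr1 (fun x => rel_chains_ext true G (off_star s) _ x a) (hrepr_cycle c).
by rewrite bihom0 rel_chains_star_bound /in_star sa an eqxx.
Qed.

Lemma loc_ext_surj s (x : bprod G) : (forall a, ~~ in_star s n a -> x a = 0) ->
  (forall a, sle s a -> Bd o x a = 0) -> exists c, loc_ext s c = x.
Proof.
move=> x0 xB; have [_|c cx] := model_surj (rel_chains_star_model s n) x0.
  by apply: (@finite_star_supp _ s) => a sa; exact: x0 (out_star_sle _ sa).
have gc : g s c = 0.
  apply: (model_inj (rel_chains_star_model s (n%:Z - 1))); rewrite bihom0.
  apply: bprodP => a.
  by rewrite rel_chains_star_bound cx; case: ifP => // /andP[sa _]; exact: xB.
by exists (hclass (f s) (g s) c); rewrite loc_ext_hclass.
Qed.

(** In terms of coefficients, the structure map of the sheaf just forgets the simplices outside the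
    smaller star. *)
Lemma loc_ext_map s t (c : loc_hom_sheaf o G n s) a : sle s t ->
  loc_ext t (shm (loc_hom_sheaf o G n) s t c) a =
  if sle t a then loc_ext s c a else 0.
Proof.
move=> st; have c0 := hrepr_cycle c.
have mE : loc_hom_map o G n st c = hclass (f t) (g t)
    (rel_chains_incl true (off_starS st) G n (hrepr c)).
  by rewrite -(loc_hom_mapE st c0); congr (loc_hom_map _ _ _ _ _); rewrite hreprK.
rewrite shmE -[sh_map _ _ _]/(loc_hom_map o G n st c) mE loc_ext_hclass.
  by rewrite rel_chains_ext_incl off_starE loc_extE.
by rewrite /g -rel_chains_incl_bound c0 bihom0.
Qed.

Lemma loc_coeffE s (c : loc_hom o G n s) (a : simp (full_sub X) n) :
  sle s (val a) -> loc_coeff c a = loc_ext s c (val a).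
Proof.
move=> sa; rewrite loc_extE -[in RHS](quot_piK (hrepr c)) rel_chains_ext_pi.
rewrite /off_fun.
have /negbTE -> : val a \notin sub_mem (off_star s) by rewrite off_starE.
by rewrite [RHS]ext_val.
Qed.

End Homology.

Section Cohomology.
Variable F : sheaf X A B.

Lemma rel_cochains_star_model s k :
  is_model false (in_star s k) (rel_cochains_ext false F (off_star s) k).
Proof. by apply: rel_cochains_model => a; rewrite off_starE. Qed.

Lemma rel_cochains_star_cobound s k k' c a :
  rel_cochains_ext false F (off_star s) k'
    (rel_cobound o false F (off_star s) k k' c) a =
  if in_star s k' a then Cob o (rel_cochains_ext false F (off_star s) k c) a else 0.
Proof. by rewrite rel_cochains_ext_cobound off_starE. Qed.

Definition cob_exact s k := forall z : bprod F,
  (forall a, ~~ in_star s k a -> z a = 0) ->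
  (forall a, sle s a -> Cob o z a = 0) ->
  exists w : bprod F, (forall a, ~~ in_star s (k - 1) a -> w a = 0) /\
    forall a, sle s a -> Cob o w a = z a.

Lemma star_Cob0 (z : bprod F) s k a : (forall a, ~~ in_star s k a -> z a = 0) ->
  dim a != k + 1 -> Cob o z a = 0.
Proof.
move=> z0 ak; rewrite (@eq_Cob _ _ _ _ _ _ _ _ 0) ?Cob0// => b ab; apply: z0.
apply: out_star_dim.
by apply: contra ak => /eqP <-; rewrite (inc_dim ab).
Qed.

Lemma CM_cob_exact K : CM_at_sheaf o F K ->
  forall s k, s \in sub_mem K -> k != n -> cob_exact s k.
Proof.
move=> CM s k sK kn z z0 zB; have M := rel_cochains_star_model s k.
have [//|c cz] := model_surj M z0.
have gc : rel_cobound o false F (off_star s) k (k + 1) c = 0.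
  apply: (model_inj (rel_cochains_star_model s (k + 1))); rewrite bihom0.
  apply: bprodP => a.
  rewrite rel_cochains_star_cobound cz; case: ifP => // /andP[sa _].
  exact: zB.
have := CM s k sK kn (hclass (rel_cobound o false F (off_star s) (k - 1) k) _ c).
rewrite -(hclass0 (rel_cobound o false F (off_star s) (k - 1) k)
                  (rel_cobound o false F (off_star s) k (k + 1))) => h0.
have [y] := (hclassP _ gc (bihom0 _)).1 h0; rewrite subr0 => cy.
have M' := rel_cochains_star_model s (k - 1).
exists (rel_cochains_ext false F (off_star s) (k - 1) y); split.
  by move=> a; exact: (model_out M').
move=> a sa; have [ak|ak] := eqVneq (dim a) k.
  by rewrite -cz cy rel_cochains_star_cobound /in_star sa ak eqxx.
rewrite (z0 _ (out_star_dim s ak)); apply: (star_Cob0 (model_out M' y)).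
by rewrite subrK.
Qed.

Let f s := rel_cobound o false F (off_star s) (n%:Z - 1) n.
Let g s := rel_cobound o false F (off_star s) n (n%:Z + 1).

Definition star_restr_fun s (z : bprod F) :
    bprod (fun a : simp (full_sub X) n => F (val a)) :=
  fun a : simp (full_sub X) n => if sle s (val a) then z (val a) else 0.

Definition star_restr s : bihom (bprod F)
  (bprod (fun a : simp (full_sub X) n => F (val a))).
Proof.
exists (star_restr_fun s) => [x c c'|b c];
  apply: bprodP => a.
  by rewrite bprodDE bprodZE /star_restr_fun; case: ifP => // _; rewrite scaler0 addr0.
by rewrite bprodRE /star_restr_fun; case: ifP => // _; rewrite rscale0l.
Defined.

Fact star_restr_supp s z : star_restr s z \in subbimod_mem (supp_cond false _).
Proof. by []. Qed.

Fact star_restr_vanish s z : sub_corestr (star_restr_supp s) z \in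
  subbimod_mem (vanish_on false F (off_star s) n).
Proof.
apply/asboolP => a; rewrite inE => /negbTE sa.
by rewrite /coeff /= /star_restr_fun sa.
Qed.

Definition star_cochain s : bihom (bprod F) (rel_cochains false F (off_star s) n) :=
  sub_corestr (star_restr_vanish s).

Lemma rel_cochains_top s (y : rel_cochains false F (off_star s) (n%:Z + 1)) : y = 0.
Proof.
apply: (model_inj (rel_cochains_star_model s (n%:Z + 1))); rewrite bihom0.
apply: bprodP => a.
apply: (model_out (rel_cochains_star_model s (n%:Z + 1))).
exact: out_star_dim (dim_le_top a).
Qed.

(** For lack of simplices of dimension [n + 1], every [n]-cochain is a cocycle; top local cohomology
    is thus a quotient of all families, the cokernel of a row. *)
Fact star_cochain_cycle s z : star_cochain s z \in subbimod_mem (kernel (g s)).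
Proof. exact/eqP/(rel_cochains_top (g s (star_cochain s z))). Qed.

(* The class in h^n(s) = H^n(X, X - st(s); F) of the n-cochain that agrees with
   z on the star of s. *)
Definition loc_class s : bihom (bprod F) (loc_cohom o F n s) :=
  bihom_comp (quot_pi (boundaries (f s) (g s))) (sub_corestr (star_cochain_cycle s)).

Lemma loc_classE s z : loc_class s z = hclass (f s) (g s) (star_cochain s z).
Proof.
exact: quot_pi_hclass.
Qed.

Lemma star_cochain_ext s z a : rel_cochains_ext false F (off_star s) n
  (star_cochain s z) a = if in_star s n a then z a else 0.
Proof.
case: ifPn => [/andP[sa an]|]; last exact: (model_out (rel_cochains_star_model s n)).
have [[t ta]|] := simp_case (full_sub X) n a; last by rewrite an.
rewrite -ta [LHS]ext_val -[LHS]/(star_restr_fun s z t) /star_restr_fun.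
by have -> : sle s (val t) by rewrite ta.
Qed.

Lemma star_cochainK s (x : rel_cochains false F (off_star s) n) :
  star_cochain s (rel_cochains_ext false F (off_star s) n x) = x.
Proof.
apply: (model_inj (rel_cochains_star_model s n)).
apply: bprodP => a; rewrite star_cochain_ext.
by case: ifPn => // /(model_out (rel_cochains_star_model s n) x).
Qed.

Lemma loc_class_surj s (c : loc_cohom o F n s) : exists z : bprod F,
  (forall a, ~~ in_star s n a -> z a = 0) /\ loc_class s z = c.
Proof.
exists (rel_cochains_ext false F (off_star s) n (hrepr c)); split.
  by move=> a; exact: (model_out (rel_cochains_star_model s n)).
by rewrite loc_classE star_cochainK; exact: hreprK.
Qed.

Lemma eq_loc_class s (z z' : bprod F) :
  (forall a, in_star s n a -> z a = z' a) -> loc_class s z = loc_class s z'.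
Proof.
move=> zz; rewrite !loc_classE; congr (hclass _ _ _).
apply: (model_inj (rel_cochains_star_model s n)).
apply: bprodP => a; rewrite !star_cochain_ext.
by case: ifP => // /zz.
Qed.

Lemma loc_class_eq0 s (z : bprod F) : loc_class s z = 0 ->
  exists w : bprod F, (forall a, ~~ in_star s (n%:Z - 1) a -> w a = 0) /\
    forall a, in_star s n a -> Cob o w a = z a.
Proof.
rewrite loc_classE -(hclass0 (f s) (g s)) => h0.
have [y] := (hclassP (f s) (rel_cochains_top _) (bihom0 (g s))).1 h0.
rewrite subr0 => zy; exists (rel_cochains_ext false F (off_star s) (n%:Z - 1) y).
split=> [a|a sa]; first exact: (model_out (rel_cochains_star_model s _)).
have := congr1 (fun x => rel_cochains_ext false F (off_star s) n x a) zy.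
by rewrite star_cochain_ext rel_cochains_star_cobound sa.
Qed.

Lemma loc_class_Cob s (w : bprod F) : (forall a, ~~ sle s a -> w a = 0) ->
  loc_class s (Cob o w) = 0.
Proof.
(* Only the part of [w] in dimension [n - 1] affects the coboundary in dimension [n], so [w] need
   not be homogeneous. *)
move=> w0; pose w' : bprod F := fun a => if dim a == n%:Z - 1 then w a else 0.
have [a /=|//|y yw] := model_surj (rel_cochains_star_model s (n%:Z - 1)) (x := w').
  rewrite negb_and /w' => /orP[/w0->|/negbTE->//].
  by case: ifP.
rewrite loc_classE -(hclass0 (f s) (g s)).
apply/(hclassP (f s) (rel_cochains_top _) (bihom0 (g s))).
exists y; rewrite subr0; apply: (model_inj (rel_cochains_star_model s n)).
apply: bprodP => a.
rewrite star_cochain_ext rel_cochains_star_cobound yw.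
case: ifP => // /andP[_ /eqP an]; apply: eq_Cob => t /inc_dim ta.
by rewrite /w' -(addrK 1 (dim t)) -ta an eqxx.
Qed.

Lemma loc_class_map s t (z : bprod F) : sle s t ->
  (forall a, ~~ sle t a -> z a = 0) ->
  coshm (loc_cohom_cosheaf o F n) t s (loc_class t z) = loc_class s z.
Proof.
move=> st z0; have mE : loc_cohom_map o F n st (loc_class t z) = hclass (f s) (g s)
    (rel_cochains_incl false (off_starS st) F n (star_cochain t z)).
  by rewrite loc_classE; exact: (loc_cohom_mapE st (rel_cochains_top _)).
rewrite coshmE -[LHS]/(loc_cohom_map o F n st (loc_class t z)) mE.
rewrite loc_classE; congr (hclass _ _ _).
apply: (model_inj (rel_cochains_star_model s n)).
apply: bprodP => a; rewrite star_cochain_ext.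
transitivity (rel_cochains_ext false F (off_star t) n (star_cochain t z) a) => //.
rewrite star_cochain_ext /in_star; case: (boolP (sle t a)) => [ta|/z0->]; last by case: ifP.
by rewrite (sle_trans st ta).
Qed.

End Cohomology.
End LocalModels.

(** * The double complexes *)

Section DoubleFamilies.
Variables (V : choiceType) (n : nat) (X : lfcomplex V n) (A B : pzRingType).
Variables (F : simplex X -> bimodType A B) (fin : bool) (Q : pred (simplex X)).
Implicit Types (s t a b : simplex X) (e m : int).

(* The elements of the double complexes: entries indexed by a simplex s and a
   coface a of s. *)
Definition fam2 : bimodType A B :=
  bprod (fun _ : simplex X => (bprod F : bimodType A B)).
Implicit Types (x w : fam2) (y : bprod F).

Lemma fam2E x x' : (forall s a, x s a = x' s a) -> x = x'.
Proof.
move=> xx; apply: bprodP => s.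
by apply: bprodP => a.
Qed.

(** The total degree [m] is the codimension of [s] in [a], since chain and cochain degrees count
    with opposite signs. *)
Definition cell m s a := [&& Q s, sle s a & dim a == dim s + m].
Definition supp1 m y := forall t, ~~ (Q t && (dim t == m)) -> y t = 0.
Definition supp2 m x := forall s a, ~~ cell m s a -> x s a = 0.
Definition finF y := fin -> finite_set [set s | y s != 0].
(** Only nonzero rows are counted: a row supported on cells lives on a finite star. *)
Definition fin2 x := fin -> finite_set [set s | x s != 0].

Lemma supp2_cell m x s a : supp2 m x -> x s a != 0 -> cell m s a.
Proof. by move=> sx; apply: contra_neqT => /sx. Qed.

Lemma fam2_neq0 x s : x s != 0 -> exists a, x s a != 0.
Proof.
move=> xs; apply/not_existsP => x0; case/eqP: xs.
by apply: bprodP => a; apply/eqP/negPn/negP/x0.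
Qed.

Lemma fin2_near x x' : fin2 x ->
  (forall s a, x' s a != 0 ->
     exists r b, [/\ x r b != 0, sle s b & sle r b]) -> fin2 x'.
Proof.
move=> fx near /fx; move=> finx; apply: (finite_near finx) => s /fam2_neq0[a xa].
have [r [b [rb sb rleb]]] := near s a xa.
exists r; last by exists b.
by apply: contra_neq rb => ->.
Qed.

Definition scale2 e x : fam2 := fun s a => x s a *~ e.

Lemma scale2_supp m e x : supp2 m x -> supp2 m (scale2 e x).
Proof. by move=> sx s a /sx; rewrite /scale2 => ->; rewrite mul0rz. Qed.

Lemma scale2_fin e x : fin2 x -> fin2 (scale2 e x).
Proof.
move=> fx /fx; apply: sub_finite_set => s /=; apply: contra_neq => xs.
by apply: bprodP => a; rewrite /scale2 xs mul0rz.
Qed.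

Lemma fin2_0 : fin2 0.
Proof. by move=> _; apply: sub_finite_set (finite_set0 _) => s /=; rewrite eqxx. Qed.

Lemma supp2B m x x' : supp2 m x -> supp2 m x' -> supp2 m (x - x').
Proof.
move=> sx sx' s a c; rewrite -[LHS]/(x s a - x' s a).
by rewrite (sx _ _ c) (sx' _ _ c) subr0.
Qed.

Lemma supp2D m x x' : supp2 m x -> supp2 m x' -> supp2 m (x + x').
Proof.
move=> sx sx' s a c; rewrite -[LHS]/(x s a + x' s a).
by rewrite (sx _ _ c) (sx' _ _ c) addr0.
Qed.

Lemma fin2_op x x' x2 : fin2 x -> fin2 x' ->
  (forall s, x s = 0 -> x' s = 0 -> x2 s = 0) -> fin2 x2.
Proof.
move=> fx fx' x20 finT; have := conj (fx finT) (fx' finT); rewrite -finite_setU.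
apply: sub_finite_set => s /= x2s.
have [xs|] := eqVneq (x s) 0; last by left.
by right; apply: contra_neq x2s => /(x20 _ xs).
Qed.

Lemma fin2B x x' : fin2 x -> fin2 x' -> fin2 (x - x').
Proof.
move=> fx fx'; apply: (fin2_op fx fx') => s xs xs'.
by rewrite -[LHS]/(x s - x' s) xs xs' subr0.
Qed.

Lemma fin2D x x' : fin2 x -> fin2 x' -> fin2 (x + x').
Proof.
move=> fx fx'; apply: (fin2_op fx fx') => s xs xs'.
by rewrite -[LHS]/(x s + x' s) xs xs' addr0.
Qed.

Lemma finFB y y' : finF y -> finF y' -> finF (y - y').
Proof.
move=> fy fy' finT; have := conj (fy finT) (fy' finT); rewrite -finite_setU.
apply: sub_finite_set => t /=; rewrite -[(y - y') t]/(y t - y' t) => yt.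
have [y0|] := eqVneq (y t) 0; [right|by left].
by apply: contra_neq yt => ->; rewrite y0 subr0.
Qed.

Lemma supp1B m y y' : supp1 m y -> supp1 m y' -> supp1 m (y - y').
Proof.
move=> sy sy' s c; rewrite -[LHS]/(y s - y' s).
by rewrite (sy _ c) (sy' _ c) subr0.
Qed.

Lemma supp1_mulz m y e : supp1 m y -> supp1 m (fun s => y s *~ e).
Proof. by move=> sy s c; rewrite (sy _ c) mul0rz. Qed.

Lemma finF_mulz y e : finF y -> finF (fun s => y s *~ e).
Proof.
by move=> fy /fy; apply: sub_finite_set => s /=; apply: contra_neq => ->; rewrite mul0rz.
Qed.

End DoubleFamilies.

Definition cob_on (V : choiceType) (n : nat) (X : lfcomplex V n)
    (o : orientation X) (A B : pzRingType) (F : sheaf X A B)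
    (Q : pred (simplex X)) (phi : bprod F) : bprod F :=
  fun s => if Q s then Cob o phi s else 0.

Definition bd_on (V : choiceType) (n : nat) (X : lfcomplex V n)
    (o : orientation X) (A B : pzRingType) (G : cosheaf X A B)
    (Q : pred (simplex X)) (c : bprod G) : bprod G :=
  fun t => if Q t then Bd o c t else 0.

Lemma mulz_sign_eq0 (M : zmodType) (z : M) e : e * e = 1 -> z *~ e = 0 -> z = 0.
Proof. by move=> ee z0; rewrite -[z]mulr1z -ee mulrzA z0 mul0rz. Qed.

Definition int_sign (m : int) : int := (-1) ^+ `|m|%N.

Lemma int_sign_sqr m : int_sign m * int_sign m = 1.
Proof. by rewrite /int_sign -expr2 sqrr_sign. Qed.

Lemma int_signB1 m : int_sign (m - 1) = - int_sign m.
Proof.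
rewrite /int_sign; case: m => [[|k]|k].
- by rewrite sub0r.
- have -> : k.+1%:Z - 1 = k by rewrite intS addrC addKr.
  by rewrite /= exprS mulN1r opprK.
- have -> : Negz k - 1 = Negz k.+1 by rewrite !NegzE -opprD addrC -intS.
  by rewrite /= exprS mulN1r.
Qed.

Lemma int_signD1 m : int_sign (m + 1) = - int_sign m.
Proof. by rewrite -[in RHS](addrK 1 m) int_signB1 opprK. Qed.

(** * Cosheaf coefficients *)

Section CosheafResolution.
Variables (V : choiceType) (n : nat) (X : lfcomplex V n) (o : orientation X).
Variables (A B : pzRingType) (G : cosheaf X A B).
Variables (U : pred V) (fin : bool).
Hypothesis Uconv : order_convex o U.
Implicit Types (s t u r a b k : simplex X) (e m : int).
Local Notation S := (first_in o U).
Local Notation T := (last_in o U).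
Local Notation inc := (inc o).
Local Notation Bd := (@Bd _ _ X o A B G).

Local Notation fam2 := (fam2 G).
Local Notation suppT := (@supp1 _ _ _ _ _ G T).
Local Notation suppS := (@supp1 _ _ _ _ _ _ S).
Local Notation finF := (finF fin).
Local Notation bdT := (@bd_on _ _ _ o _ _ G T).
Local Notation cobS := (@cob_on _ _ _ o _ _ _ S).
Local Notation h := (loc_hom_sheaf o G n).
Local Notation cell := (cell S).
Local Notation supp2 := (@supp2 _ _ _ _ _ G S).
Local Notation fin2 := (@fin2 _ _ _ _ _ G fin).
Implicit Types (x w : fam2) (y : bprod G).

(** The column differential, for fixed [a]. All its terms lie in the single module [G a], so it
    involves integer coefficients only. *)
Definition cob_left x : fam2 := fun s a => if S s && sle s a
  then \sum_(r <- faces a) x r a *~ inc r s else 0.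
Definition bd_right x : fam2 := fun s a => if S s && sle s a then Bd (x s) a else 0.
(** The sign depends on the total degree, which an ungraded family does not know, so it is a
    parameter. In degree [m] it is taken to be [int_sign m] up to an overall convention, and it
    flips at each application. *)
Definition tot_bd e x : fam2 := fun s a => bd_right x s a + cob_left x s a *~ e.

Lemma cob_left_neq0 x s a : cob_left x s a != 0 ->
  exists r, [/\ S s, sle s a, inc r s != 0 & x r a != 0].
Proof.
rewrite /cob_left; case: ifP => [/andP[Ss sa]|]; last by rewrite eqxx.
move=> x0; apply/not_existsP => no; case/eqP: x0; apply: big1 => r _.
apply/eqP/negPn/negP => xr; apply: (no r); split=> //.
  exact: mulz_neq0r xr.
exact: mulz_neq0l xr.
Qed.

Lemma bd_right_neq0 x s a : bd_right x s a != 0 ->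
  exists b, [/\ S s, sle s a, inc a b != 0 & x s b != 0].
Proof.
rewrite /bd_right; case: ifP => [/andP[Ss sa]|]; last by rewrite eqxx.
move=> x0; apply/not_existsP => no; case/eqP: x0; apply: big1 => b _.
apply/eqP/negPn/negP => xb; apply: (no b); split=> //.
  exact: mulz_neq0r xb.
by apply: contra_neq xb => ->; rewrite bihom0 mul0rz.
Qed.

Lemma cob_left_supp m x : supp2 m x -> supp2 (m - 1) (cob_left x).
Proof.
move=> sx s a; apply: contraNeq => /cob_left_neq0[r [Ss sa rs /(supp2_cell sx)]].
rewrite /cell => /and3P[_ _ /eqP ->]; rewrite Ss sa (inc_dim rs) /=.
by rewrite addrACA subrr addr0.
Qed.

Lemma bd_right_supp m x : supp2 m x -> supp2 (m - 1) (bd_right x).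
Proof.
move=> sx s a; apply: contraNeq => /bd_right_neq0[b [Ss sa ab /(supp2_cell sx)]].
rewrite /cell Ss sa => /and3P[_ _]; rewrite (inc_dim ab) /= => /eqP ba.
by rewrite addrA -ba addrK.
Qed.

Lemma tot_bd_supp e m x : supp2 m x -> supp2 (m - 1) (tot_bd e x).
Proof.
by move=> sx s a c; rewrite /tot_bd (cob_left_supp sx c) (bd_right_supp sx c) mul0rz addr0.
Qed.

Lemma tot_bd_supp' e m x : supp2 (m + 1) x -> supp2 m (tot_bd e x).
Proof. by move=> /(tot_bd_supp e); rewrite addrK. Qed.

Lemma cob_left_fin x : fin2 x -> fin2 (cob_left x).
Proof.
move=> fx; apply: (fin2_near fx) => s a /cob_left_neq0[r [_ sa rs xr]].
by exists r, a; split=> //; exact: sle_trans (inc_sle rs) sa.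
Qed.

Lemma bd_right_fin x : fin2 x -> fin2 (bd_right x).
Proof.
move=> fx; apply: (fin2_near fx) => s a /bd_right_neq0[b [_ sa ab xb]].
by exists s, b; split=> //; exact: sle_trans sa (inc_sle ab).
Qed.

Lemma tot_bd_fin e x : fin2 x -> fin2 (tot_bd e x).
Proof. by move=> fx; exact: fin2D (bd_right_fin fx) (scale2_fin e (cob_left_fin fx)). Qed.

Lemma cob_leftB x x' s a : cob_left (x - x') s a = cob_left x s a - cob_left x' s a.
Proof.
rewrite /cob_left; case: ifP => _; last by rewrite subr0.
by rewrite -sumrB; apply: eq_bigr => r _; rewrite -mulrzBl.
Qed.

Lemma bd_rightB x x' s a : bd_right (x - x') s a = bd_right x s a - bd_right x' s a.
Proof.
rewrite /bd_right; case: ifP => _; last by rewrite subr0.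
by rewrite -BdB.
Qed.

Lemma tot_bdB e x x' : tot_bd e (x - x') = tot_bd e x - tot_bd e x'.
Proof.
apply: fam2E => s a; rewrite /tot_bd cob_leftB bd_rightB mulrzBl.
by rewrite opprD addrACA.
Qed.

Lemma tot_bd0 e : tot_bd e 0 = 0.
Proof. by have := tot_bdB e 0 0; rewrite !subrr. Qed.

Lemma tot_bdN e x : tot_bd e (- x) = - tot_bd e x.
Proof. by rewrite -[- x]sub0r tot_bdB tot_bd0 sub0r. Qed.

Lemma tot_bdD e x x' : tot_bd e (x + x') = tot_bd e x + tot_bd e x'.
Proof. by rewrite -{1}[x']opprK tot_bdB tot_bdN opprK. Qed.

Lemma cob_left_scale2 e x s a : cob_left (scale2 e x) s a = cob_left x s a *~ e.
Proof.
rewrite /cob_left; case: ifP => _; last by rewrite mul0rz.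
by rewrite mulrz_suml; apply: eq_bigr => r _; rewrite mulrzAC.
Qed.

Lemma bd_right_scale2 e x s a : bd_right (scale2 e x) s a = bd_right x s a *~ e.
Proof. by rewrite /bd_right; case: ifP => _; rewrite ?mul0rz// -Bd_mulz. Qed.

Lemma tot_bd_scale2 e e' x : tot_bd e (scale2 e' x) = scale2 e' (tot_bd e x).
Proof.
by apply: fam2E => s a; rewrite /tot_bd /scale2 cob_left_scale2 bd_right_scale2 mulrzDl mulrzAC.
Qed.

Lemma cob_left_cob_left m x s a : supp2 m x -> cob_left (cob_left x) s a = 0.
Proof.
move=> sx; rewrite {1}/cob_left; case: ifP => // /andP[Ss sa].
transitivity (\sum_(r <- faces a)
    (\sum_(q <- faces a) x q a *~ inc q r) *~ inc r s).
  rewrite [LHS]big_seq [RHS]big_seq; apply: eq_bigr => r; rewrite mem_faces => ra.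
  have [->|rs] := eqVneq (inc r s) 0; first by rewrite !mulr0z.
  congr (_ *~ _); rewrite /cob_left ra andbT; case: ifPn => // nS.
  rewrite big1// => q _; apply/eqP; apply: contraNT nS => xq.
  have /and3P[Sq _ _] := supp2_cell sx (mulz_neq0l xq).
  exact: (first_convex Uconv (inc_sle (mulz_neq0r xq)) (inc_sle rs)).
by rewrite sum_sum_mulrz big1// => q _; rewrite inc_inc ?mulr0z.
Qed.

Lemma bd_right_bd_right x s a : bd_right (bd_right x) s a = 0.
Proof.
rewrite {1}/bd_right; case: ifP => // /andP[Ss sa].
rewrite -[RHS](Bd_Bd o (x s) a); apply: eq_Bd => b /inc_sle ab.
by rewrite /bd_right Ss (sle_trans sa ab).
Qed.

Lemma cob_left_bd_right m x s a : supp2 m x -> cob_left (bd_right x) s a = bd_right (cob_left x) s a.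
Proof.
move=> sx; rewrite {1}/cob_left {2}/bd_right; case: ifP => // /andP[Ss sa].
transitivity (\sum_(r <- faces a) \sum_(b <- star a)
    coshm G b a (x r b) *~ inc a b *~ inc r s).
  rewrite [LHS]big_seq [RHS]big_seq; apply: eq_bigr => r; rewrite mem_faces => ra.
  rewrite -mulrz_suml /bd_right ra andbT; case: ifPn => // nS.
  rewrite big1 ?mul0rz// => b _; apply/eqP; apply: contraNT nS => xb.
  have xrb : x r b != 0.
    by apply: contra_neq xb => ->; rewrite bihom0 mul0rz.
  by have /and3P[] := supp2_cell sx xrb.
rewrite exchange_big /= [LHS]big_seq [RHS]big_seq; apply: eq_bigr => b.
rewrite mem_star => ab; rewrite /cob_left Ss (sle_trans sa ab) /= bihom_sum mulrz_suml.
rewrite (sum_faces_widen ab) => [|r].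
  by apply: eq_bigr => r _; rewrite raddfMz mulrzAC.
by move=> /mulz_neq0r/inc_sle rs; exact: sle_trans rs sa.
Qed.

(** Row and column differentials commute instead of anticommuting; the change of sign between the
    two applications makes up for it. *)
Lemma tot_bd_tot_bd m e x : e * e = 1 -> supp2 m x -> tot_bd (- e) (tot_bd e x) = 0.
Proof.
move=> ee sx; apply: fam2E => s a.
have Dxx : tot_bd e x = bd_right x + scale2 e (cob_left x) by [].
have add1 f g s1 a1 : cob_left (f + g) s1 a1 = cob_left f s1 a1 + cob_left g s1 a1.
  rewrite /cob_left; case: ifP => _; last by rewrite addr0.
  by rewrite -big_split; apply: eq_bigr => r _ /=; rewrite -mulrzDl.
have add2 f g s1 a1 : bd_right (f + g) s1 a1 = bd_right f s1 a1 + bd_right g s1 a1.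
  rewrite /bd_right; case: ifP => _; last by rewrite addr0.
  rewrite /Bd -big_split; apply: eq_bigr => r _ /=.
  by rewrite -mulrzDl -bihomD.
rewrite {1}/tot_bd Dxx add1 add2 cob_left_scale2 bd_right_scale2 bd_right_bd_right (cob_left_cob_left s a sx) (cob_left_bd_right s a sx).
by rewrite mul0rz add0r addr0 mulrNz subrr.
Qed.

(** Cutting: the entry at a back face [s] of [a] is carried by [coshm] to the complementary front
    face. Composed with [entries] it is the cap product. *)
Definition cut_sum x : bprod G := fun t =>
  \sum_(a <- star t) \sum_(s <- faces a)
    coshm G a t (x s a) *~ (chi o t s a)%:R.

Lemma cut_sum_neq0 x t : cut_sum x t != 0 ->
  exists s a, chi o t s a /\ x s a != 0.
Proof.
move=> x0; apply/not_existsP => no; case/eqP: x0.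
apply: big1 => a _; apply: big1 => s _.
case c: (chi o t s a); last by rewrite mulr0z.
have [->|xsa] := eqVneq (x s a) 0; first by rewrite bihom0 mul0rz.
by case: (no s); exists a.
Qed.

Lemma cut_sum_supp m x : supp2 m x -> suppT m (cut_sum x).
Proof.
move=> sx t; apply: contraNeq => /cut_sum_neq0[s [a [c /(supp2_cell sx)]]].
rewrite /cell (first_last_chi U c) (chi_dim c).
by move=> /and3P[-> _ /=]; rewrite addrC => /eqP/addrI ->.
Qed.

Lemma cut_sum_fin x : fin2 x -> finF (cut_sum x).
Proof.
move=> fx /fx finx; apply: (finite_near finx) => t /cut_sum_neq0[s [a [c xsa]]].
exists s; first by apply: contra_neq xsa => ->.
by exists a; have [] := chi_sle c.
Qed.

Lemma cut_sumB x x' t : cut_sum (x - x') t = cut_sum x t - cut_sum x' t.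
Proof.
rewrite /cut_sum -sumrB; apply: eq_bigr => a _.
by rewrite -sumrB; apply: eq_bigr => s _; rewrite -mulrzBl -bihomB.
Qed.

Lemma cut_sum_bd_right m x u : supp2 m x -> T u ->
  cut_sum (bd_right x) u = \sum_(a <- star u) \sum_(r <- faces a)
    coshm G a u (x r a) *~ (\sum_(b <- faces a) (chi o u r b)%:R * inc b a).
Proof.
move=> sx Tu; transitivity (\sum_(b <- star u) \sum_(a <- star u) \sum_(r <- faces a)
    coshm G a u (x r a) *~ ((chi o u r b)%:R * inc b a)).
  rewrite [LHS]big_seq [RHS]big_seq; apply: eq_bigr => b; rewrite mem_star => ub.
  transitivity (\sum_(r <- faces b) \sum_(a <- star u)
      coshm G a u (x r a) *~ ((chi o u r b)%:R * inc b a)).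
    rewrite [LHS]big_seq [RHS]big_seq; apply: eq_bigr => r; rewrite mem_faces => rb.
    case c: (chi o u r b); last by rewrite mulr0z big1// => a _; rewrite mul0r mulr0z.
    rewrite /bd_right (first_last_chi U c) Tu rb /= mulr1z bihom_sum.
    rewrite (sum_star_widen ub) => [|a xa].
      rewrite big_seq [RHS]big_seq; apply: eq_bigr => a _.
      have [->|/inc_sle ba] := eqVneq (inc b a) 0; first by rewrite !mulr0z bihom0.
      by rewrite bihomMz coshm_comp// mul1r.
    apply: (@inc_sle _ _ _ o); apply: contra_neq xa => ->.
    by rewrite mulr0z bihom0.
  rewrite exchange_big /= [LHS]big_seq [RHS]big_seq; apply: eq_bigr => a _.
  have [ba|ba] := boolP (sle b a).
    rewrite (sum_faces_widen ba)// => r /mulz_neq0r.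
    by case c: (chi o u r b); [have [] := chi_sle c|rewrite mul0r eqxx].
  have i0 : inc b a = 0 by apply/eqP; apply: contraNT ba => /inc_sle.
  by rewrite !big1// => r _; rewrite i0 mulr0 mulr0z.
rewrite exchange_big; apply: eq_bigr => a _ /=.
rewrite exchange_big; apply: eq_bigr => r _ /=.
rewrite -mulrz_sumr; congr (_ *~ _); apply: sum_star_faces => b.
rewrite mulf_eq0 negb_or => /andP[+ /inc_sle ->]; rewrite andbT.
by case c: (chi o u r b) => // _; have [] := chi_sle c.
Qed.

Lemma cut_sum_cob_left x u : T u ->
  cut_sum (cob_left x) u = \sum_(a <- star u) \sum_(r <- faces a)
    coshm G a u (x r a) *~ (\sum_(s <- faces a) (chi o u s a)%:R * inc r s).
Proof.
move=> Tu; apply: eq_bigr => a _.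
transitivity (\sum_(s <- faces a) (\sum_(r <- faces a)
    coshm G a u (x r a) *~ inc r s) *~ (chi o u s a)%:R).
  rewrite [LHS]big_seq [RHS]big_seq; apply: eq_bigr => s; rewrite mem_faces => sa.
  case c: (chi o u s a); last by rewrite !mulr0z.
  rewrite /cob_left sa (first_last_chi U c) Tu /= bihom_sum.
  by congr (_ *~ _); apply: eq_bigr => r _; rewrite bihomMz.
rewrite sum_sum_mulrz; apply: eq_bigr => r _.
by congr (_ *~ _); apply: eq_bigr => s _; rewrite mulrC.
Qed.

Lemma Bd_cut_sum x u : Bd (cut_sum x) u = \sum_(a <- star u) \sum_(r <- faces a)
    coshm G a u (x r a) *~ (\sum_(t <- faces a) (chi o t r a)%:R * inc u t).
Proof.
transitivity (\sum_(t <- star u) \sum_(a <- star u) \sum_(r <- faces a)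
    coshm G a u (x r a) *~ ((chi o t r a)%:R * inc u t)).
  rewrite [LHS]big_seq [RHS]big_seq; apply: eq_bigr => t; rewrite mem_star => ut.
  rewrite bihom_sum mulrz_suml (sum_star_widen ut); last first.
    move=> a; apply: contra_neqT => ta; apply/eqP; rewrite bihom_sum mulrz_suml.
    apply/eqP/big1 => r _; case c: (chi o t r a).
      by have [ta' _] := chi_sle c; rewrite ta' in ta.
    by rewrite mulr0z bihom0 mul0rz.
  apply: eq_bigr => a _; rewrite bihom_sum mulrz_suml; apply: eq_bigr => r _.
  rewrite bihomMz -mulrzA; case c: (chi o t r a); last by rewrite !mul0r !mulr0z.
  by have [ta _] := chi_sle c; rewrite coshm_comp.
rewrite exchange_big; apply: eq_bigr => a _ /=.
rewrite exchange_big; apply: eq_bigr => r _ /=.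
rewrite -mulrz_sumr; congr (_ *~ _); apply: sum_star_faces => t.
rewrite mulf_eq0 negb_or => /andP[+ /inc_sle ->] /=.
by case c: (chi o t r a) => // _; have [] := chi_sle c.
Qed.

(** This is the Leibniz rule [inc_chi], entry by entry. Its sign is that of [dim u], which equals
    [m - 1] wherever the last term is nonzero; this dictates [int_sign m] in the total
    differential. *)
Lemma cut_sum_tot_bd m x u : supp2 m x -> T u -> cut_sum (tot_bd (int_sign m) x) u = Bd (cut_sum x) u.
Proof.
move=> sx Tu; transitivity (cut_sum (bd_right x) u + cut_sum (cob_left x) u *~ int_sign m).
  rewrite /cut_sum mulrz_suml -big_split; apply: eq_bigr => a _ /=.
  rewrite mulrz_suml -big_split; apply: eq_bigr => s _ /=.
  by rewrite /tot_bd bihomD mulrzDl bihomMz mulrzAC.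
rewrite (cut_sum_bd_right sx Tu) (cut_sum_cob_left _ Tu) Bd_cut_sum mulrz_suml -big_split.
apply: eq_bigr => a _ /=; rewrite mulrz_suml -big_split; apply: eq_bigr => r _ /=.
have [->|/(supp2_cell sx)/and3P[_ _ /eqP ar]] := eqVneq (x r a) 0.
  by rewrite bihom0 !mul0rz addr0.
rewrite -mulrzA -mulrzDr inc_chi; congr (_ *~ (_ + _)).
rewrite -mulNr [LHS]mulrC.
have [->|] := eqVneq (\sum_(s <- faces a) (chi o u s a)%:R * inc r s) 0.
  by rewrite !mulr0.
move=> s0; congr (_ * _).
have [s cs] : exists s, chi o u s a /\ inc r s != 0.
  apply/not_existsP => no; case/eqP: s0; apply: big1 => s _.
  case c: (chi o u s a); last by rewrite mul0r.
  rewrite mul1r; apply/eqP/negPn/negP => rs; exact: (no s).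
have um : dim u = m - 1.
  have := chi_dim cs.1; rewrite ar (inc_dim cs.2) => e.
  transitivity (dim u + (dim r + 1) - dim r - 1); first by ring.
  by rewrite -e; ring.
have du : dim u = #|` val u|.-1 :> int.
  by rewrite /dim -{1}(prednK (simplex_card_gt0 u)) intS addrC addKr.
by rewrite -[int_sign m]opprK -int_signB1 -um du.
Qed.

(** The embedding of chains: [y a] becomes a constant function on the vertices of [a] in [U], a
    zero-cocycle of the column. *)
Definition vertex_col y : fam2 := fun s a =>
  if [&& #|` val s| == 1%N, S s & sle s a] then y a else 0.

Lemma vertex_col_neq0 y s a : vertex_col y s a != 0 ->
  [/\ #|` val s| == 1%N, S s, sle s a & y a != 0].
Proof. by rewrite /vertex_col; case: ifP => [/and3P[]//|]; rewrite eqxx. Qed.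

Lemma dim_vertex s : #|` val s| == 1%N -> dim s = 0.
Proof. by rewrite /dim => /eqP ->. Qed.

Lemma vertex_col_supp m y : suppT m y -> supp2 m (vertex_col y).
Proof.
move=> sy s a; apply: contraNeq => /vertex_col_neq0[s1 Ss sa].
apply: contraNT; rewrite /cell Ss sa (dim_vertex s1) add0r => am.
by rewrite sy// negb_and am orbT.
Qed.

Lemma vertex_col_fin y : finF y -> fin2 (vertex_col y).
Proof.
move=> fy /fy finy; apply: (finite_near finy) => s /fam2_neq0[a /vertex_col_neq0[_ _ sa ya]].
by exists a => //; exists a => //; exact: sle_refl.
Qed.

(** If [s] begins and [a] ends in [U], all vertices of [s] are in [U], so a constant function on
    them has no coboundary by [sum_inc_vertex]; only the row part is left. *)
Lemma vertex_col_tot_bd e m y : suppT m y -> tot_bd e (vertex_col y) = vertex_col (bdT y).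
Proof.
move=> sy; apply: fam2E => s a; rewrite /tot_bd.
have yT b : y b != 0 -> T b.
  by apply: contra_neqT => Tb; rewrite sy// negb_and Tb.
have -> : cob_left (vertex_col y) s a = 0.
  rewrite /cob_left; case: ifP => // /andP[Ss sa].
  have [ya|/yT Ta] := eqVneq (y a) 0.
    by apply: big1 => r _; rewrite /vertex_col ya; case: ifP; rewrite mul0rz.
  transitivity (y a *~ \sum_(r <- faces a) (#|` val r| == 1%N)%:R * inc r s); last first.
    by rewrite sum_inc_vertex ?mulr0z.
  rewrite mulrz_sumr big_seq [RHS]big_seq; apply: eq_bigr => r; rewrite mem_faces => ra.
  rewrite /vertex_col ra andbT; have [r1|_] := eqVneq #|` val r| 1%N; last by rewrite mul0r mul0rz.
  rewrite mul1r; have [->|/inc_sle rs] := eqVneq (inc r s) 0; first by rewrite !mulr0z.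
  suff -> : S r by [].
  have [v rv] : exists v, val r = [fset v]%fset by apply: card1P; rewrite r1.
  rewrite (first_in1 o U rv); apply: (between_in Uconv sa Ss Ta).
  by apply: (fsubsetP rs); rewrite rv fset11.
rewrite mul0rz addr0 /bd_right [RHS]/vertex_col.
have [/andP[Ss sa]|nS] := boolP (S s && sle s a); last by rewrite andbF.
rewrite andbT; have [s1|s1] := eqVneq #|` val s| 1%N; last first.
  rewrite -[RHS](Bd0 o G a); apply: eq_Bd => b ab.
  by rewrite /vertex_col (negbTE s1).
transitivity (Bd y a).
  apply: eq_Bd => b /inc_sle ab; rewrite /vertex_col s1 Ss (sle_trans sa ab).
  by [].
(* If [a] has a vertex in [U] but does not end in [U], no coface of [a] ends in [U] either, so
   truncating to [T] discards nothing here. *)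
rewrite /bd_on; case: ifPn => // Ta; apply: big1 => b _.
have [->|ab] := eqVneq (inc a b) 0; first by rewrite mulr0z.
have [->|yb] := eqVneq (y b) 0; first by rewrite bihom0 mul0rz.
case/negP: Ta; have [v sv] : exists v, val s = [fset v]%fset by apply: card1P; rewrite s1.
rewrite (first_in1 o U sv) in Ss.
apply: (last_in_face Uconv (inc_sle ab) (yT _ yb) _ Ss).
by apply: (fsubsetP sa); rewrite sv fset11.
Qed.

(** A back face with one vertex leaves all of [a] as front face, so only [t] paired with its last
    vertex contributes. *)
Lemma cut_sum_vertex_col m y : suppT m y -> cut_sum (vertex_col y) = y.
Proof.
move=> sy; apply: bprodP => t.
have [p [q [tE pt _ Tp]]] := lastE o t.
have pq : subseq [:: p] (vertices o t) by rewrite sub1seq mem_vertices.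
have [v vE vt] := subseq_face pq isT; have [_ vv] := vertices_subseq pq vE.
have only s a : chi o t s a -> #|` val s| == 1%N -> a = t /\ s = v.
  move=> /chiP[p' [x [q' [ea et es]]]].
  rewrite -(size_vertices o) es eqSS size_eq0 => /eqP q0.
  split; apply/val_inj; first by rewrite -(fs_vertices o a) ea q0 -et fs_vertices.
  rewrite -(fs_vertices o s) es q0 vE; move: et; rewrite tE cats1.
  by move=> /rcons_inj[_ ->].
have cv : chi o t v t by apply: (chi_vertices (x := p) (q := [::]) _ _ vv); rewrite tE cats1.
rewrite /cut_sum (eq_big_supp (r2 := [:: t])) ?fset_uniq ?big_seq1//; first last.
- by move=> a; rewrite inE => /eqP -> _; rewrite mem_star sle_refl.
- move=> a _; apply: contraNT; rewrite inE => at_; apply/eqP/big1 => s _.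
  case c: (chi o t s a); last by rewrite mulr0z.
  have [s1|s1] := boolP (#|` val s| == 1%N).
    by have [ea _] := only _ _ c s1; rewrite ea eqxx in at_.
  by rewrite /vertex_col (negbTE s1) bihom0 mul0rz.
rewrite (eq_big_supp (r2 := [:: v])) ?fset_uniq ?big_seq1//; first last.
- by move=> s; rewrite inE => /eqP -> _; rewrite mem_faces.
- move=> s _; apply: contraNT; rewrite inE => sv; apply/eqP.
  case c: (chi o t s t); last by rewrite mulr0z.
  have [s1|s1] := boolP (#|` val s| == 1%N).
    by have [_ es] := only _ _ c s1; rewrite es eqxx in sv.
  by rewrite /vertex_col (negbTE s1) bihom0 mul0rz.
rewrite cv mulr1z coshm_id /vertex_col vt andbT (first_last_chi U cv).
rewrite -(size_vertices o v) vv /=; case: ifPn => // Tt.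
by rewrite sy// negb_and Tt.
Qed.

Lemma last_vertex_subproof a : exists v : V, [/\ v \in val a,
  {in val a, forall v', ord o a v' v} & T a = U v].
Proof. by have [v [_ [_ va vl vT]]] := lastE o a; exists v. Qed.

Definition last_vertex a : V := projT1 (cid (last_vertex_subproof a)).

Lemma last_vertexP a : [/\ last_vertex a \in val a,
  {in val a, forall v, ord o a v (last_vertex a)} & T a = U (last_vertex a)].
Proof. exact: projT2 (cid (last_vertex_subproof a)). Qed.

Definition cone_last x : fam2 := fun s a => if S s && sle s a
  then \sum_(r <- faces a) x r a *~ cone o (last_vertex a) s r else 0.

(** Evaluation of each column at the last vertex of [a]. On supported families it vanishes when that
    vertex is outside [U], which is the acyclic case. *)
Definition last_entry x : bprod G := fun a =>
  \sum_(r <- faces a) x r a *~ (val r == [fset last_vertex a]%fset)%:R.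

Lemma cone_last_neq0 x s a : cone_last x s a != 0 -> exists r, [/\ S s, sle s a,
  sle r a, x r a != 0 & #|` val r| = #|` val s|.+1].
Proof.
rewrite /cone_last; case: ifP => [/andP[Ss sa]|]; last by rewrite eqxx.
move=> x0; apply/not_existsP => no; case/eqP: x0; rewrite big_seq big1// => r.
rewrite mem_faces => ra; apply/eqP/negPn/negP => xr.
have [_ ws rE _] := cone_neq0 (mulz_neq0r xr).
apply: (no r); split=> //; first exact: mulz_neq0l xr.
by rewrite rE cardfsU1 ws.
Qed.

Lemma cone_last_supp m x : supp2 m x -> supp2 (m + 1) (cone_last x).
Proof.
move=> sx s a; apply: contraNeq => /cone_last_neq0[r [Ss sa ra xr rs]].
have /and3P[_ _ /eqP am] := supp2_cell sx xr.
rewrite /cell Ss sa am /= /dim rs intS; apply/eqP.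
by ring.
Qed.

Lemma cone_last_fin x : fin2 x -> fin2 (cone_last x).
Proof.
move=> fx; apply: (fin2_near fx) => s a /cone_last_neq0[r [_ sa ra xr _]].
by exists r, a.
Qed.

Lemma last_entry_supp m x : supp2 m x -> suppT m (last_entry x).
Proof.
move=> sx a; apply: contraNeq => x0.
have [r [rE xr]] : exists r, val r = [fset last_vertex a]%fset /\ x r a != 0.
  apply/not_existsP => no; case/eqP: x0; apply: big1 => r _.
  have [rE|] := eqVneq (val r) [fset last_vertex a]%fset; last by rewrite mulr0z.
  have [->|xr] := eqVneq (x r a) 0; first by rewrite mul0rz.
  by case: (no r).
have [_ _ ->] := last_vertexP a; have := supp2_cell sx xr.
rewrite /cell (first_in1 o U rE) => /and3P[-> _ /eqP ->] /=.
by rewrite dim_vertex ?rE ?cardfs1// add0r.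
Qed.

Lemma last_entry_fin x : fin2 x -> finF (last_entry x).
Proof.
move=> fx /fx finx; apply: (finite_near finx) => a x0.
have [r [ra xr]] : exists r, sle r a /\ x r a != 0.
  apply/not_existsP => no; case/eqP: x0; rewrite /last_entry big_seq big1// => r.
  rewrite mem_faces => ra; have [->|xr] := eqVneq (x r a) 0; first by rewrite mul0rz.
  by case: (no r).
exists r; first by apply: contra_neq xr => ->.
by exists a => //; exact: sle_refl.
Qed.

(** Each column is contracted by [cone_homotopy] with the last vertex of [a]; [first_in_cone] keeps
    the cones inside the truncation to [S], and the projection term becomes
    [vertex_col (last_entry x)]. *)
Lemma cone_last_homotopy m x : supp2 m x ->
  x = cob_left (cone_last x) + cone_last (cob_left x) + vertex_col (last_entry x).
Proof.
move=> sx; apply: fam2E => s a; rewrite !bprodDE.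
have [/andP[Ss sa]|nS] := boolP (S s && sle s a); last first.
  rewrite /cob_left /cone_last /vertex_col (negbTE nS) andbF !addr0 sx//.
  by apply: contra nS => /and3P[-> ->].
have [wa wl _] := last_vertexP a.
have -> : cob_left (cone_last x) s a = \sum_(r <- faces a)
    x r a *~ (\sum_(k <- faces a) cone o (last_vertex a) k r * inc k s).
  rewrite -sum_sum_mulrz /cob_left Ss sa /= big_seq [RHS]big_seq; apply: eq_bigr => k.
  rewrite mem_faces => ka; congr (_ *~ _); rewrite /cone_last ka andbT; case: ifPn => // nS.
  rewrite big_seq big1// => r; rewrite mem_faces => ra; apply/eqP.
  apply: contraNT nS => xr; have [_ _ rE _] := cone_neq0 (mulz_neq0r xr).
  rewrite -(first_in_cone U ra wa wl rE).
  by have /and3P[] := supp2_cell sx (mulz_neq0l xr).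
have -> : cone_last (cob_left x) s a = \sum_(r <- faces a)
    x r a *~ (\sum_(k <- faces a) cone o (last_vertex a) s k * inc r k).
  transitivity (\sum_(k <- faces a) (\sum_(r <- faces a) x r a *~ inc r k) *~
      cone o (last_vertex a) s k).
    rewrite /cone_last Ss sa /= big_seq [RHS]big_seq; apply: eq_bigr => k.
    rewrite mem_faces => ka; have [->|ck] := eqVneq (cone o (last_vertex a) s k) 0.
      by rewrite !mulr0z.
    have [_ _ kE _] := cone_neq0 ck.
    by rewrite /cob_left (first_in_cone U ka wa wl kE) Ss ka.
  rewrite sum_sum_mulrz; apply: eq_bigr => r _; congr (_ *~ _).
  by apply: eq_bigr => k _; rewrite mulrC.
rewrite -big_split /=.
transitivity (\sum_(r <- faces a) x r a *~ ((s == r)%:R -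
    ((val r == [fset last_vertex a]%fset) && (#|` val s| == 1%N))%:R) + vertex_col (last_entry x) s a).
  rewrite (_ : vertex_col (last_entry x) s a = \sum_(r <- faces a) x r a *~
      ((val r == [fset last_vertex a]%fset) && (#|` val s| == 1%N))%:R).
    rewrite -big_split /=; under eq_bigr do rewrite -mulrzDr subrK.
    rewrite (eq_big_supp (r2 := [:: s])) ?fset_uniq ?big_seq1 ?eqxx ?mulr1z//.
      by move=> r _; rewrite inE; have [//|_] := eqVneq s r; rewrite mulr0z eqxx.
    by move=> r; rewrite inE => /eqP -> _; rewrite mem_faces.
  rewrite /vertex_col Ss sa !andbT; case: eqP => _.
    by apply: eq_bigr => r _; rewrite andbT.
  by rewrite big1// => r _; rewrite andbF mulr0z.
congr (_ + _); rewrite big_seq [RHS]big_seq; apply: eq_bigr => r.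
by rewrite mem_faces => ra; rewrite -(cone_homotopy o wa sa ra) mulrzDr.
Qed.

(** Columns are exact off the vertices, so entries are removed from the largest [s] downwards. Once
    only vertices carry entries, the homotopy identifies the cycle with [vertex_col] of its last
    entry. *)
Lemma cycle_vertex_col e m x : e * e = 1 -> supp2 m x -> fin2 x -> tot_bd e x = 0 ->
  exists y w, [/\ suppT m y, supp2 (m + 1) w, finF y, fin2 w &
    x = vertex_col y + tot_bd (- e) w].
Proof.
move=> ee; suff [N] : exists N, forall s a, (N.+1 < #|` val s|)%N -> x s a = 0.
  elim: N x => [|N IHN] x xN sx fx Dx.
    (* Where the row of [x] vanishes, the cycle equation isolates its column part. *)
    have d1N r a : (1 < #|` val r|)%N -> cob_left x r a = 0.
      move=> r2; have /(congr1 (fun f : fam2 => f r a)) := Dx.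
      rewrite /tot_bd (_ : bd_right x r a = 0) ?add0r; first exact: mulz_sign_eq0.
      by apply/eqP/negPn/negP => /bd_right_neq0[b [_ _ _]]; rewrite xN ?eqxx.
    exists (last_entry x), 0; split.
    - exact: last_entry_supp.
    - by [].
    - exact: last_entry_fin.
    - exact: fin2_0.
    rewrite tot_bd0 addr0 {1}(cone_last_homotopy sx).
    have -> : cone_last x = 0.
      apply: fam2E => s a; apply/eqP/negPn/negP => /cone_last_neq0[r [_ _ _ + rs]].
      by rewrite xN ?eqxx// rs ltnS simplex_card_gt0.
    have -> : cone_last (cob_left x) = 0.
      apply: fam2E => s a; apply/eqP/negPn/negP => /cone_last_neq0[r [_ _ _ + rs]].
      by rewrite d1N ?eqxx// rs ltnS simplex_card_gt0.
    rewrite addr0 (_ : cob_left 0 = 0) ?add0r//; apply: fam2E => s a.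
    by apply/eqP/negPn/negP => /cob_left_neq0[r [_ _ _]]; rewrite eqxx.
  have d1N r a : (N.+2 < #|` val r|)%N -> cob_left x r a = 0.
    move=> rN; have /(congr1 (fun f : fam2 => f r a)) := Dx.
    rewrite /tot_bd (_ : bd_right x r a = 0) ?add0r; first exact: mulz_sign_eq0.
    by apply/eqP/negPn/negP => /bd_right_neq0[b [_ _ _]]; rewrite xN ?eqxx.
  (* As [e * e = 1], the column part of [tot_bd (- e) w1] is minus [cob_left (cone_last x)] and
     cancels that term of the homotopy. *)
  pose w1 := scale2 e (cone_last x).
  have sw1 : supp2 (m + 1) w1 by apply: scale2_supp; exact: cone_last_supp.
  have fw1 : fin2 w1 by apply: scale2_fin; exact: cone_last_fin.
  have [s a sN|||| y [w [sy sw fy fw xw]]] := IHN (x + tot_bd (- e) w1).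
  - have -> : (x + tot_bd (- e) w1) s a =
        cone_last (cob_left x) s a + vertex_col (last_entry x) s a + bd_right (cone_last x) s a *~ e.
      rewrite {1}(cone_last_homotopy sx) /w1 tot_bd_scale2 !bprodDE /scale2 /tot_bd.
      rewrite mulrzDl -mulrzA mulNr ee mulrN1z.
      move: (cob_left _ s a) (cone_last _ s a) (vertex_col _ s a) (_ *~ e) => p q r t.
      by rewrite -[p + q + r]addrA [p + (q + r)]addrC -addrA [p + _]addrCA subrr addr0.
    have -> : cone_last (cob_left x) s a = 0.
      apply/eqP/negPn/negP => /cone_last_neq0[r [_ _ _ + rs]].
      by rewrite d1N ?eqxx// rs ltnS.
    have -> : vertex_col (last_entry x) s a = 0.
      by rewrite /vertex_col; case: eqP sN => // ->.
    rewrite (_ : bd_right _ s a = 0) ?mul0rz ?addr0//.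
    apply/eqP/negPn/negP => /bd_right_neq0[b [_ _ _ /cone_last_neq0[r [_ _ _ + rs]]]].
    by rewrite xN ?eqxx// rs ltnS.
  - by apply: supp2D => //; apply: tot_bd_supp'.
  - by apply: fin2D => //; apply: tot_bd_fin.
  - rewrite tot_bdD Dx add0r -{1}[e]opprK; apply: tot_bd_tot_bd sw1 => //.
    by rewrite mulrNN.
  exists y, (w - w1); split=> //; first exact: supp2B.
    exact: fin2B.
  by rewrite tot_bdB addrA -xw addrK.
exists n => s a; rewrite ltnNge => /negP[].
exact: sc_dim_le (valP s).
Qed.

Hypothesis exact_S : forall s (k : int), S s -> k != n%:Z -> bd_exact o G s k.

(** Rows are exact off dimension [n], so entries are removed from the smallest [a] upwards. The
    cycle condition is asked only off dimension [n] because the lemma is also applied to a family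
    whose total boundary is some [entries phi], concentrated there. *)
Lemma push_top e m x : e * e = 1 -> supp2 m x -> fin2 x ->
  (forall s a, dim a != n -> tot_bd e x s a = 0) ->
  exists w, [/\ supp2 (m + 1) w, fin2 w &
    forall s a, dim a != n -> (x - tot_bd (- e) w) s a = 0].
Proof.
move=> ee; have : exists j, forall s a, (#|` val a| + j < n.+1)%N -> x s a = 0.
  exists n.+1 => s a; lia.
case=> j; elim: j x => [|j IHj] x xj sx fx Dx.
  exists 0; split=> //.
    exact: fin2_0.
  move=> s a an; rewrite tot_bd0 subr0; apply: xj.
  have := sc_dim_le (valP a); move: an; rewrite /dim; lia.
(* The correction of row [s]. Vanishing with [x s] preserves finiteness; vanishing on the current
   and lower levels prevents the column part of its boundary from refilling them. *)
have ex_w s : exists ws : bprod G,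
   [/\ forall a, ~~ (S s && in_star s (dim s + m + 1) a) -> ws a = 0,
       x s = 0 -> ws = 0,
       forall a, (#|` val a| + j < n.+1)%N -> ws a = 0 &
       forall a, sle s a -> (#|` val a| + j < n.+1)%N -> Bd ws a = x s a].
  have [Ss|nS] := boolP (S s); last first.
    exists 0; split=> // a sa aj; rewrite Bd0 sx// /cell (negbTE nS).
    by [].
  have [xs|xs] := eqVneq (x s) 0.
    by exists 0; split=> // a sa aj; rewrite Bd0 xs.
  (* The current level is [dim a = n - j - 1]; a row has entries there only if [dim s + m] is this
     number, and other rows get no correction. *)
  have [kj|kj] := eqVneq (dim s + m + j%:Z + 1) n%:Z; last first.
    exists 0; split=> // a sa aj; rewrite Bd0; apply/esym/eqP.
    apply: contraNT kj => xsa; have /and3P[_ _ /eqP am] := supp2_cell sx xsa.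
    have : ~~ (#|` val a| + j.+1 < n.+1)%N.
      by apply: contra xsa => aj'; apply/eqP/xj.
    move: am aj; rewrite /dim; lia.
  have kn : dim s + m != n by move: kj; lia.
  have xstar a : ~~ in_star s (dim s + m) a -> x s a = 0.
    by move=> na; apply: sx; rewrite /cell Ss.
  (* Below the lowest occupied level the column part is zero, so the cycle equation makes the row a
     cycle. *)
  have xcyc a : sle s a -> Bd (x s) a = 0.
    move=> sa; have [ak|ak] := eqVneq (dim a) (dim s + m - 1); last first.
      exact: star_Bd0 xstar ak.
    have an : dim a != n by rewrite ak; move: kj; lia.
    have := Dx s a an; rewrite /tot_bd /bd_right Ss sa /= (_ : cob_left x s a = 0).
      by rewrite mul0rz addr0.
    apply/eqP/negPn/negP => /cob_left_neq0[r [_ _ _]]; rewrite xj ?eqxx//.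
    by move: ak kj; rewrite /dim; lia.
  have [ws [w0 wB]] := exact_S Ss kn xstar xcyc.
  exists ws; split=> //.
  - by move=> /eqP; rewrite (negbTE xs).
  - move=> a aj; apply: w0; apply: out_star_dim.
    by move: aj kj; rewrite /dim; lia.
  - by move=> a sa _; exact: wB.
pose w : fam2 := fun s => projT1 (cid (ex_w s)).
have wP s := projT2 (cid (ex_w s)).
have sw : supp2 (m + 1) w.
  move=> s a c; have [w0 _ _ _] := wP s; apply: w0; move: c.
  by rewrite /cell /in_star addrA.
have fw : fin2 w.
  move=> /fx; apply: sub_finite_set => s /=; apply: contra_neq => xs.
  by have [_ + _ _] := wP s; exact.
have [s a aj||||w' [sw' fw' xw']] := IHj (x - tot_bd (- e) w).
- rewrite -[LHS]/(x s a - (bd_right w s a + cob_left w s a *~ (- e))).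
  rewrite (_ : cob_left w s a = 0) ?mul0rz ?addr0; last first.
    apply/eqP/negPn/negP => /cob_left_neq0[r [_ _ _]].
    have [_ _ wj _] := wP r; rewrite -[w r]/(projT1 (cid (ex_w r))).
    by rewrite wj ?eqxx.
  rewrite /bd_right; case: ifPn => [/andP[Ss sa]|nS].
    by have [_ _ _ wB] := wP s; rewrite wB// subrr.
  rewrite subr0 sx//; apply: contra nS.
  by rewrite /cell => /and3P[-> -> _].
- by apply: supp2B => //; apply: tot_bd_supp'.
- by apply: fin2B => //; apply: tot_bd_fin.
- move=> s a an; rewrite tot_bdB (_ : tot_bd e (tot_bd (- e) w) = 0) ?subr0; first exact: Dx.
  by rewrite -{1}[e]opprK; apply: (tot_bd_tot_bd) sw; rewrite mulrNN.
exists (w + w'); split; first exact: supp2D.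
  exact: fin2D.
by move=> s a an; rewrite tot_bdD opprD addrA xw'.
Qed.

Definition entries (phi : bprod h) : fam2 := fun s => loc_ext o G s (phi s).

Lemma entries_supp l (phi : bprod h) : suppS l phi -> supp2 (n%:Z - l) (entries phi).
Proof.
move=> sphi s a; rewrite /entries.
have [/andP[Ss /eqP sl]|nS] := boolP (S s && (dim s == l)); last first.
  by rewrite sphi// bihom0.
move=> c; apply: loc_ext_out; move: c; rewrite /cell Ss /in_star sl.
by rewrite addrC subrK.
Qed.

Lemma entries_fin (phi : bprod h) : finF phi -> fin2 (entries phi).
Proof.
move=> fphi /fphi; apply: sub_finite_set => s /=.
by apply: contra_neq => ps; rewrite /entries ps bihom0.
Qed.

Lemma entries_out (phi : bprod h) s a : dim a != n -> entries phi s a = 0.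
Proof. by move=> an; exact: loc_ext_out (out_star_dim s an). Qed.

Lemma bd_right_entries (phi : bprod h) s a : bd_right (entries phi) s a = 0.
Proof.
by rewrite /bd_right; case: ifP => // /andP[_ sa]; exact: loc_ext_cycle.
Qed.

Lemma cob_left_entries (phi : bprod h) s a :
  cob_left (entries phi) s a = if S s then loc_ext o G s (Cob o phi s) a else 0.
Proof.
have [Ss|nS] : S s \/ ~~ S s by case: (S s); [left|right].
  have -> : (if S s then loc_ext o G s (Cob o phi s) a else 0) =
      loc_ext o G s (Cob o phi s) a by rewrite Ss.
  have [sa|sa] : sle s a \/ ~~ sle s a by case: (sle s a); [left|right].
    have -> : cob_left (entries phi) s a = \sum_(r <- faces a) entries phi r a *~ inc r s.
      by rewrite /cob_left Ss sa.
    have -> : loc_ext o G s (Cob o phi s) = \sum_(r <- faces s)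
        loc_ext o G s (shm h r s (phi r)) *~ inc r s.
      exact: (bihom_Cob o (loc_ext o G s : bihom (h s) (bprod G)) phi).
    rewrite bprod_sum -(sum_faces_widen sa) => [|r /mulz_neq0r/inc_sle//].
    rewrite big_seq [RHS]big_seq; apply: eq_bigr => r; rewrite mem_faces => rs.
    by rewrite bprod_mulz loc_ext_map// sa.
  have -> : cob_left (entries phi) s a = 0 by rewrite /cob_left (negbTE sa) andbF.
  by apply/esym; exact: loc_ext_out (out_star_sle n sa).
by rewrite (negbTE nS) /cob_left (negbTE nS).
Qed.

Lemma tot_bd_entries e (phi : bprod h) s a : tot_bd e (entries phi) s a =
  (if S s then loc_ext o G s (Cob o phi s) a else 0) *~ e.
Proof. by rewrite /tot_bd bd_right_entries cob_left_entries add0r. Qed.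

(** A row in dimension [n] comes from local homology as soon as it is a cycle. Off dimension [n] the
    column part of [tot_bd] vanishes, so the last hypothesis says exactly that. *)
Lemma entries_surj e m x : e * e = 1 -> supp2 m x -> fin2 x ->
  (forall s a, dim a != n -> x s a = 0) ->
  (forall s a, dim a != n -> tot_bd e x s a = 0) ->
  exists phi : bprod h, [/\ suppS (n%:Z - m) phi, finF phi & entries phi = x].
Proof.
move=> ee sx fx xn Dx.
have ex_phi s : exists c : h s, loc_ext o G s c = x s.
  apply: loc_ext_surj => [a|a sa].
    rewrite negb_and => /orP[sa|]; last exact: xn.
    by apply: sx; rewrite /cell (negbTE sa) andbF.
  have [Ss|nS] := boolP (S s); last first.
    rewrite -[RHS](Bd0 o G a); apply: eq_Bd => b _.
    by apply: sx; rewrite /cell (negbTE nS).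
  have [an|an] := eqVneq (dim a) n.
    apply: big1 => b _; have [->|ab] := eqVneq (inc a b) 0; first by rewrite mulr0z.
    by have := dim_le_top b; rewrite (inc_dim ab) an eqxx.
  have := Dx s a an; rewrite /tot_bd /bd_right Ss sa /= (_ : cob_left x s a = 0).
    by rewrite mul0rz addr0.
  by apply/eqP/negPn/negP => /cob_left_neq0[r [_ _ _]]; rewrite xn ?eqxx.
pose phi : bprod h := fun s => projT1 (cid (ex_phi s)).
have phiE s : loc_ext o G s (phi s) = x s := projT2 (cid (ex_phi s)).
have phi0 s : x s = 0 -> phi s = 0.
  by move=> xs; apply: (@loc_ext_inj _ _ _ o _ _ G s); rewrite phiE xs bihom0.
exists phi; split.
- move=> s sm; apply: phi0; apply: bprodP => a.
  have [an|an] := eqVneq (dim a) n; last exact: xn.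
  apply: sx; apply: contra sm; rewrite /cell => /and3P[-> _ /eqP am].
  by rewrite -an am addrK eqxx.
- by move=> /fx; apply: sub_finite_set => s /=; apply: contra_neq => /phi0.
- by apply: bprodP => s; exact: phiE.
Qed.

Lemma bd_cut_sum_entries l (phi : bprod h) t : suppS l phi -> T t ->
  Bd (cut_sum (entries phi)) t = cut_sum (entries (cobS phi)) t *~ int_sign (n%:Z - l).
Proof.
move=> sphi Tt; rewrite -(cut_sum_tot_bd (entries_supp sphi) Tt) /cut_sum mulrz_suml.
apply: eq_bigr => a _; rewrite mulrz_suml; apply: eq_bigr => s _.
rewrite tot_bd_entries bihomMz mulrzAC; congr (coshm _ _ _ _ *~ _ *~ _).
by rewrite /entries /cob_on; case: (S s) => //; rewrite bihom0.
Qed.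

(** Columns replace the cocycle by some [vertex_col y'], [cut_sum] shows that [y'] is a boundary,
    and rows turn the resulting bounding family into [entries] of a cochain. *)
Lemma cut_sum_entries_inj l (phi : bprod h) y : suppS l phi -> finF phi ->
  (forall s, S s -> Cob o phi s = 0) -> suppT (n%:Z - l + 1) y -> finF y ->
  (forall t, T t -> cut_sum (entries phi) t = Bd y t) ->
  exists psi : bprod h, [/\ suppS (l - 1) psi, finF psi &
    forall s, S s -> Cob o psi s = phi s].
Proof.
move=> sphi fphi cphi sy fy cy; set m := n%:Z - l in sy; set e := int_sign m.
have ee : e * e = 1 by exact: int_sign_sqr.
have eme : (- e) * (- e) = 1 by rewrite mulrNN.
have six := entries_supp sphi.
have Dphi : tot_bd e (entries phi) = 0.
  apply: fam2E => s a; rewrite tot_bd_entries; case: ifP => [/cphi->|_]; last by rewrite mul0rz.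
  by rewrite bihom0 mul0rz.
have sj := vertex_col_supp sy.
have eS : - e = int_sign (m + 1) by rewrite int_signD1.
have [||| y' [w [sy' sw fy' fw xw]]] := @cycle_vertex_col e m (entries phi - tot_bd (- e) (vertex_col y)) ee.
- by apply: supp2B => //; exact: tot_bd_supp'.
- by apply: fin2B; [exact: entries_fin|apply/tot_bd_fin/vertex_col_fin].
- rewrite tot_bdB Dphi sub0r -{1}[e]opprK (tot_bd_tot_bd eme sj).
  by rewrite oppr0.
pose w2 := vertex_col y + w; have sw2 : supp2 (m + 1) w2 by exact: supp2D.
have fw2 : fin2 w2 by apply: fin2D => //; exact: vertex_col_fin.
have jy' : vertex_col y' = entries phi - tot_bd (- e) w2.
  by rewrite /w2 tot_bdD opprD addrA xw addrK.
pose y2 := y - cut_sum w2; have sy2 : suppT (m + 1) y2.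
  exact: supp1B (cut_sum_supp sw2).
have fy2 : finF y2 by apply: finFB => //; exact: cut_sum_fin.
(* Being a left inverse of [vertex_col], [cut_sum] reads [y'] off the equation [jy']. *)
have y'E : y' = bdT y2.
  apply: bprodP => t; rewrite /bd_on.
  have [Tt|nT] := boolP (T t); last by rewrite sy'// (negbTE nT).
  rewrite -(cut_sum_vertex_col sy') jy' cut_sumB cy// eS (cut_sum_tot_bd sw2 Tt).
  by rewrite -BdB.
pose W := w2 + vertex_col y2; have sW : supp2 (m + 1) W.
  by apply: supp2D => //; exact: vertex_col_supp.
have fW : fin2 W by apply: fin2D => //; exact: vertex_col_fin.
have DW : tot_bd (- e) W = entries phi.
  by rewrite tot_bdD (vertex_col_tot_bd (- e) sy2) -y'E jy' addrC subrK.
have [s a an|u [su fu Wu]] := push_top eme sW fW; first by rewrite DW entries_out.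
rewrite opprK in Wu; pose W' := W - tot_bd e u.
have DW' : tot_bd (- e) W' = entries phi by rewrite tot_bdB DW (tot_bd_tot_bd ee su) subr0.
have [||||psi [spsi fpsi psiE]] := @entries_surj (- e) (m + 1) W' eme.
- by apply: supp2B => //; exact: tot_bd_supp'.
- by apply: fin2B => //; exact: tot_bd_fin.
- exact: Wu.
- by move=> s a an; rewrite DW' entries_out.
(* The factor cancels the sign [- e] that [tot_bd_entries] carries in degree [m + 1]. *)
exists (fun s => psi s *~ (- e)); split.
- have lE : n%:Z - (m + 1) = l - 1 by rewrite /m; ring.
  by rewrite lE in spsi; exact: supp1_mulz.
- exact: finF_mulz.
- move=> s Ss; rewrite Cob_mulz; apply: (@loc_ext_inj _ _ _ o _ _ G s).
  apply: bprodP => a.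
  rewrite -[RHS]/(entries phi s a) -DW' -psiE tot_bd_entries Ss bihomMz.
  exact: bprod_mulz.
Qed.

(** Rows push the cycle [vertex_col y] into dimension [n], where it is [entries phi]; applying
    [cut_sum] to the correction [w] gives the chain bounding the difference. *)
Lemma cut_sum_entries_surj l y : suppT (n%:Z - l) y -> finF y ->
  (forall t, T t -> Bd y t = 0) ->
  exists (phi : bprod h) y', [/\ suppS l phi, finF phi,
    (forall s, S s -> Cob o phi s = 0), suppT (n%:Z - l + 1) y' /\ finF y' &
    forall t, T t -> y t - cut_sum (entries phi) t = Bd y' t].
Proof.
set m := n%:Z - l => sy fy cy; set e := int_sign m.
have ee : e * e = 1 by exact: int_sign_sqr.
have eS : - e = int_sign (m + 1) by rewrite int_signD1.
have Dj : tot_bd e (vertex_col y) = 0.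
  rewrite (vertex_col_tot_bd e sy); apply: fam2E => s a; rewrite /vertex_col /bd_on.
  by case: ifP => // _; case: ifP => // /cy.
have [s a _|w [sw fw xw]] := push_top ee (vertex_col_supp sy) (vertex_col_fin fy).
  by rewrite Dj.
pose x' := vertex_col y - tot_bd (- e) w.
have Dx' : tot_bd e x' = 0.
  by rewrite tot_bdB Dj -{1}[e]opprK (tot_bd_tot_bd _ sw) ?subr0// mulrNN.
have [||||phi [sphi fphi phiE]] := @entries_surj e m x' ee.
- by apply: supp2B; [exact: vertex_col_supp|exact: tot_bd_supp'].
- by apply: fin2B; [exact: vertex_col_fin|exact: tot_bd_fin].
- exact: xw.
- by move=> s a an; rewrite Dx'.
exists phi, (cut_sum w); split.
- by move: sphi; rewrite /m opprB addrC subrK.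
- exact: fphi.
- move=> s Ss; apply: (@loc_ext_inj _ _ _ o _ _ G s); rewrite bihom0.
  apply: bprodP => a.
  apply: (mulz_sign_eq0 ee); have := tot_bd_entries e phi s a; rewrite Ss => <-.
  by rewrite phiE Dx'.
- by split; [exact: cut_sum_supp|exact: cut_sum_fin].
- move=> t Tt; rewrite phiE /x' cut_sumB (cut_sum_vertex_col sy) eS (cut_sum_tot_bd sw Tt).
  by rewrite opprB addrC subrK.
Qed.

End CosheafResolution.

Lemma rscale_sum (A B : pzRingType) (M : bimodType A B) I (q : seq I) (f : I -> M) c :
  rscale (\sum_(i <- q) f i) c = \sum_(i <- q) rscale (f i) c.
Proof.
by rewrite (big_morph (fun x => rscale x c) (@rscaleDl _ _ _ c) (rscale0l _ c)).
Qed.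

(** * Cycle conditions independent of the degree *)

Section ModelDifferentials.
Variables (V : choiceType) (n : nat) (X : lfcomplex V n) (o : orientation X).
Variables (A B : pzRingType) (F : sheaf X A B) (G : cosheaf X A B).
Variables (fin : bool) (Q : pred (simplex X)) (M P : bimodType A B).
Implicit Types (s t : simplex X) (k : int).

Lemma Cob_dim0 k (z : bprod F) s :
  (forall s, ~~ (Q s && (dim s == k)) -> z s = 0) -> dim s != k + 1 -> Cob o z s = 0.
Proof.
move=> z0 sk; rewrite (@eq_Cob _ _ _ _ _ _ _ _ 0) ?Cob0// => r /inc_dim rs.
by apply: z0; apply: contra sk => /andP[_ /eqP <-]; rewrite rs.
Qed.

Lemma Bd_dim0 k (z : bprod G) s :
  (forall s, ~~ (Q s && (dim s == k)) -> z s = 0) -> dim s != k - 1 -> Bd o z s = 0.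
Proof.
move=> z0 sk; rewrite (@eq_Bd _ _ _ _ _ _ _ _ 0) ?Bd0// => r /inc_dim rs.
by apply: z0; apply: contra sk => /andP[_ /eqP <-]; rewrite rs addrK.
Qed.

Variables (k k' : int) (g : bihom M P).

Section Coboundary.
Variables (eM : bihom M (bprod F)) (eP : bihom P (bprod F)).
Hypothesis mM : is_model fin (fun s => Q s && (dim s == k)) eM.
Hypothesis mP : is_model fin (fun s => Q s && (dim s == k')) eP.
Hypothesis gE : forall c s, Q s && (dim s == k') -> eP (g c) s = Cob o (eM c) s.
Hypothesis kE : k' = k + 1.

(** Outside dimension [k'] both sides vanish for degree reasons, so cocycle conditions can be tested
    at all simplices of [Q]. *)
Lemma model_cob c s : Q s -> eP (g c) s = Cob o (eM c) s.
Proof.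
move=> Qs; have [sk|sk] := eqVneq (dim s) k'; first by rewrite gE// Qs sk eqxx.
rewrite (model_out mP); last by rewrite negb_and sk orbT.
by rewrite (Cob_dim0 (model_out mM c))// -kE.
Qed.

Lemma model_cycle_cob c : g c = 0 <-> forall s, Q s -> Cob o (eM c) s = 0.
Proof.
split=> [gc s Qs|gc]; first by rewrite -model_cob// gc bihom0.
apply: (model_inj mP); rewrite bihom0; apply: bprodP => s.
have [Qs|nQ] := boolP (Q s); first by rewrite model_cob// gc.
by rewrite (model_out mP)// (negbTE nQ).
Qed.

End Coboundary.

Section Boundary.
Variables (eM : bihom M (bprod G)) (eP : bihom P (bprod G)).
Hypothesis mM : is_model fin (fun s => Q s && (dim s == k)) eM.
Hypothesis mP : is_model fin (fun s => Q s && (dim s == k')) eP.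
Hypothesis gE : forall c s, Q s && (dim s == k') -> eP (g c) s = Bd o (eM c) s.
Hypothesis kE : k' = k - 1.

Lemma model_bd c s : Q s -> eP (g c) s = Bd o (eM c) s.
Proof.
move=> Qs; have [sk|sk] := eqVneq (dim s) k'; first by rewrite gE// Qs sk eqxx.
rewrite (model_out mP); last by rewrite negb_and sk orbT.
by rewrite (Bd_dim0 (model_out mM c))// -kE.
Qed.

Lemma model_cycle_bd c : g c = 0 <-> forall s, Q s -> Bd o (eM c) s = 0.
Proof.
split=> [gc s Qs|gc]; first by rewrite -model_bd// gc bihom0.
apply: (model_inj mP); rewrite bihom0; apply: bprodP => s.
have [Qs|nQ] := boolP (Q s); first by rewrite model_bd// gc.
by rewrite (model_out mP)// (negbTE nQ).
Qed.

End Boundary.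
End ModelDifferentials.

(** * The cap product on chain groups, for a cosheaf *)

Section CosheafTransport.
Variables (V : choiceType) (n : nat) (X : lfcomplex V n) (o : orientation X).
Variables (A B : pzRingType) (G : cosheaf X A B).
Implicit Types (s t u r a b : simplex X) (l : int).
Local Notation h := (loc_hom_sheaf o G n).

(** For fixed [t] and [a] only the back face found by [find_simp] can satisfy [chi], and the
    absolute value in the definition is the dimension of [t]. *)
Lemma cap_loc_hom_funE (K K' : subcomplex X) l
    (phi : bprod (fun s : simp K l => h (val s))) (t : simp K' (n%:Z - l)) :
  cap_loc_hom_fun phi t = cut_sum o (entries (ext_fun phi)) (val t).
Proof.
have /andP[_ /eqP td] : (val t \in sub_mem K') && (dim (val t) == n%:Z - l).
  exact: (valP t).
have tk : `|n%:Z - l|%N = #|` val (val t)|.-1.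
  by move: td (simplex_card_gt0 (val t)); rewrite /dim; lia.
rewrite /cap_loc_hom_fun /cut_sum big_seq [RHS]big_seq; apply: eq_bigr => a0.
rewrite mem_star => ta; case: insubP => [a _ aE|na] /=; last first.
  rewrite big1// => s _; rewrite /entries loc_ext_out ?bihom0 ?mul0rz//.
  exact: out_star_dim.
rewrite -aE /cap_gen_hom tk /chi.
have [ft|nf] := boolP (front o #|` val (val t)|.-1 (val a) == val (val t)); last first.
  by rewrite big1.
case E: (find_simp K l _) => [tau|] /=.
  have tauE := find_simpE E.
  have tau_a : sle (val tau) (val a) by rewrite /sle tauE back_sub.
  rewrite (eq_big_supp (r2 := [:: val tau])) ?fset_uniq ?big_seq1//.
  - rewrite -tauE eqxx mulr1z /entries ext_val.
    by rewrite loc_coeffE.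
  - move=> s _ /mulz_neq0r; rewrite -tauE inE val_eqE [s == _]eq_sym.
    by case: (val tau == s).
  - by move=> s; rewrite inE => /eqP-> _; rewrite mem_faces.
(* The back face is not an [l]-simplex of [K], so the cochain extended by zero vanishes there. *)
rewrite big1// => s _; case: eqP => [bs|_]; last by rewrite mulr0z.
rewrite /entries ext_out ?bihom0 ?mul0rz// ?bihom0//.
apply/negP => sK; have := find_simpK (exist _ s sK : simp K l).
by rewrite /= -bs E.
Qed.

Lemma cut_sum_entries_linear (c : A) (phi psi : bprod h) t :
  cut_sum o (entries (c *: phi + psi)) t = c *: cut_sum o (entries phi) t + cut_sum o (entries psi) t.
Proof.
rewrite /cut_sum scaler_sumr -big_split; apply: eq_bigr => a _ /=.
rewrite scaler_sumr -big_split; apply: eq_bigr => s _ /=.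
case: (chi o t s a); last by rewrite !mulr0z scaler0 addr0.
by rewrite !mulr1z /entries bprodDE bprodZE bihom_linear bprodDE bprodZE bihom_linear.
Qed.

Lemma cut_sum_entries_rscale (c : B) (phi : bprod h) t :
  cut_sum o (entries (rscale phi c)) t = rscale (cut_sum o (entries phi) t) c.
Proof.
rewrite /cut_sum rscale_sum; apply: eq_bigr => a _ /=.
rewrite rscale_sum; apply: eq_bigr => s _ /=.
case: (chi o t s a); last by rewrite !mulr0z rscale0l.
by rewrite !mulr1z /entries bprodRE bihom_rscale bprodRE bihom_rscale.
Qed.

Variables (U : pred V) (fin : bool) (l : int).
Hypothesis Uconv : order_convex o U.
Local Notation S := (first_in o U).
Local Notation T := (last_in o U).
Hypothesis exact_S : forall s (k : int), S s -> k != n%:Z -> bd_exact o G s k.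

Variables (L M P L' M' P' : bimodType A B).
Variables (f : bihom L M) (g : bihom M P) (f' : bihom L' M') (g' : bihom M' P').
Variables (eL : bihom L (bprod h)) (eM : bihom M (bprod h)) (eP : bihom P (bprod h)).
Variables (eL' : bihom L' (bprod G)) (eM' : bihom M' (bprod G)) (eP' : bihom P' (bprod G)).
Hypothesis mL : is_model fin (fun s => S s && (dim s == l - 1)) eL.
Hypothesis mM : is_model fin (fun s => S s && (dim s == l)) eM.
Hypothesis mP : is_model fin (fun s => S s && (dim s == l + 1)) eP.
Hypothesis mL' : is_model fin (fun t => T t && (dim t == n%:Z - l + 1)) eL'.
Hypothesis mM' : is_model fin (fun t => T t && (dim t == n%:Z - l)) eM'.
Hypothesis mP' : is_model fin (fun t => T t && (dim t == n%:Z - l - 1)) eP'.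
Hypothesis fE : forall c s, S s && (dim s == l) -> eM (f c) s = Cob o (eL c) s.
Hypothesis gE : forall c s, S s && (dim s == l + 1) -> eP (g c) s = Cob o (eM c) s.
Hypothesis fE' : forall c t, T t && (dim t == n%:Z - l) ->
  eM' (f' c) t = Bd o (eL' c) t.
Hypothesis gE' : forall c t, T t && (dim t == n%:Z - l - 1) ->
  eP' (g' c) t = Bd o (eM' c) t.
Variable hh : M -> M'.
Hypothesis hE : forall c t, T t && (dim t == n%:Z - l) ->
  eM' (hh c) t = cut_sum o (entries (eM c)) t.

Let gP c : g c = 0 <-> forall s, S s -> Cob o (eM c) s = 0.
Proof. exact: (model_cycle_cob mM mP gE erefl). Qed.

Let g'P c : g' c = 0 <-> forall t, T t -> Bd o (eM' c) t = 0.
Proof. exact: (model_cycle_bd mM' mP' gE' erefl). Qed.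

Let fS c s : S s -> eM (f c) s = Cob o (eL c) s.
Proof. by apply: (model_cob mL mM fE); rewrite subrK. Qed.

Let f'T c t : T t -> eM' (f' c) t = Bd o (eL' c) t.
Proof. by apply: (model_bd mL' mM' fE'); rewrite addrK. Qed.

Let hT c : eM' (hh c) = cut_sum o (entries (eM c)).
Proof.
apply: bprodP => t.
have [c1|c1] := boolP (T t && (dim t == n%:Z - l)); first exact: hE.
rewrite (model_out mM')//.
by rewrite (cut_sum_supp (entries_supp (model_out mM c)) c1).
Qed.

Lemma induces_iso_cut_sum : induces_iso f g f' g' hh.
Proof.
have fineM c : finF fin (eM c) by exact: model_fin mM c.
apply: induces_isoP.
- move=> a c c'; apply: (model_inj mM'); apply: bprodP => t.
  by rewrite bihom_linear !hT bihom_linear cut_sum_entries_linear.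
- move=> b c; apply: (model_inj mM'); apply: bprodP => t.
  by rewrite bihom_rscale !hT bihom_rscale cut_sum_entries_rscale.
- move=> z /gP gz; apply/g'P => t Tt; rewrite hT.
  rewrite (bd_cut_sum_entries (model_out mM z) Tt) (_ : cob_on _ _ _ = 0).
    rewrite /cut_sum big1 ?mul0rz// => a _; apply: big1 => s _.
    by rewrite /entries !bihom0 mul0rz.
  apply: bprodP => s; rewrite /cob_on.
  by case: ifP => // /gz.
- move=> y; have sy := model_out mL y.
  (* The witness contains the sign of [bd_cut_sum_entries] in degree [l - 1], so that the two
     cancel. *)
  have [|| y' y'E] := model_surj mL' (x := fun t => cut_sum o (entries (eL y)) t *~ int_sign (n%:Z - (l - 1))).
  + move=> t nt; rewrite (cut_sum_supp (entries_supp sy)) ?mul0rz//.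
    by rewrite opprB addrA [n%:Z + 1]addrC -addrA addrC in nt *.
  + move=> finT; have := cut_sum_fin o (entries_fin (model_fin mL y)) finT.
    by apply: sub_finite_set => t; exact: mulz_neq0l.
  exists y'; apply: (model_inj mM'); apply: bprodP => t.
  have [Tt|nT] := boolP (T t); last first.
    by rewrite !(model_out mM') ?(negbTE nT).
  rewrite f'T// y'E Bd_mulz (bd_cut_sum_entries sy Tt) -mulrzA int_sign_sqr mulr1z.
  rewrite hT; congr (cut_sum o (entries _) t); apply: bprodP => s.
  rewrite /cob_on; have [Ss|nS] := boolP (S s); first exact: fS.
  by rewrite (model_out mM)// (negbTE nS).
- move=> z y' /gP gz hz.
  have [||t Tt|psi [spsi fpsi psiE]] :=
      cut_sum_entries_inj Uconv exact_S (model_out mM z) (fineM z) gz (y := eL' y').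
  + exact: model_out mL' y'.
  + exact: model_fin mL' y'.
  + by rewrite -hT hz f'T.
  have [y yE] := model_surj mL spsi fpsi.
  exists y; apply: (model_inj mM); apply: bprodP => s.
  have [Ss|nS] := boolP (S s); first by rewrite fS// yE psiE.
  by rewrite !(model_out mM) ?(negbTE nS).
- move=> z' /g'P gz'.
  have [phi [y' [sphi fphi cphi [sy' fy'] yE]]] :=
    cut_sum_entries_surj Uconv exact_S (model_out mM' z') (model_fin mM' z') gz'.
  have [z zE] := model_surj mM sphi fphi.
  have [w wE] := model_surj mL' sy' fy'.
  exists z, w; split; first by apply/gP; rewrite zE.
  apply: (model_inj mM'); apply: bprodP => t.
  have [Tt|nT] := boolP (T t); last by rewrite !(model_out mM') ?(negbTE nT).
  by rewrite f'T// wE -yE// bihomB -zE -hT.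
Qed.

End CosheafTransport.

(** * Sheaf coefficients *)

Section SheafResolution.
Variables (V : choiceType) (n : nat) (X : lfcomplex V n) (o : orientation X).
Variables (A B : pzRingType) (F : sheaf X A B).
Variables (U : pred V) (fin : bool).
Hypothesis Uconv : order_convex o U.
Implicit Types (s t u r a b k : simplex X) (m l : int).
Local Notation S := (first_in o U).
Local Notation T := (last_in o U).
Local Notation inc := (inc o).
Local Notation Cob := (@Cob _ _ X o A B F).
Local Notation fam2 := (fam2 F).
Local Notation supp2 := (@supp2 _ _ _ _ _ F T).
Local Notation fin2 := (@fin2 _ _ _ _ _ F fin).
Local Notation suppS := (@supp1 _ _ _ _ _ F S).
Local Notation finF := (finF fin).
Local Notation cobS := (@cob_on _ _ _ o _ _ _ S).
Implicit Types (x w z : fam2) (y : bprod F).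

(** The sign is now attached to [t], not to the total degree. With this choice [front_back] commutes
    with the differentials without sign, and a single operator squares to zero. *)
Definition dim_sign t : int := int_sign (dim t).

Lemma dim_sign_sqr t : dim_sign t * dim_sign t = 1. Proof. exact: int_sign_sqr. Qed.

Lemma dim_sign_inc t r : inc t r != 0 -> dim_sign r = - dim_sign t.
Proof. by move=> /inc_dim tr; rewrite /dim_sign tr int_signD1. Qed.

Definition bd_left x : fam2 := fun t a => if T t && sle t a
  then \sum_(r <- faces a) x r a *~ inc t r else 0.
Definition cob_right x : fam2 := fun t a => if T t && sle t a then Cob (x t) a else 0.
Definition tot_cob x : fam2 := fun t a => (cob_right x t a - bd_left x t a) *~ dim_sign t.

Lemma bd_left_neq0 x t a : bd_left x t a != 0 ->
  exists r, [/\ T t, sle t a, inc t r != 0 & x r a != 0 /\ sle r a].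
Proof.
rewrite /bd_left; case: ifP => [/andP[Tt ta]|]; last by rewrite eqxx.
move=> x0; apply/not_existsP => no; case/eqP: x0.
rewrite big_seq; apply: big1 => r; rewrite mem_faces => ra.
apply/eqP/negPn/negP => xr; apply: (no r); split=> //.
  exact: mulz_neq0r xr.
by split=> //; exact: mulz_neq0l xr.
Qed.

Lemma cob_right_neq0 x t a : cob_right x t a != 0 ->
  exists b, [/\ T t, sle t a, inc b a != 0 & x t b != 0].
Proof.
rewrite /cob_right; case: ifP => [/andP[Tt ta]|]; last by rewrite eqxx.
move=> x0; apply/not_existsP => no; case/eqP: x0; apply: big1 => b _.
apply/eqP/negPn/negP => xb; apply: (no b); split=> //.
  exact: mulz_neq0r xb.
by apply: contra_neq xb => ->; rewrite bihom0 mul0rz.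
Qed.

Lemma bd_left_supp m x : supp2 m x -> supp2 (m + 1) (bd_left x).
Proof.
move=> sx t a; apply: contraNeq => /bd_left_neq0[r [Tt ta tr [/(supp2_cell sx) c _]]].
move: c; rewrite /cell => /and3P[_ _ /eqP ->]; rewrite Tt ta (inc_dim tr) /=.
by apply/eqP; ring.
Qed.

Lemma cob_right_supp m x : supp2 m x -> supp2 (m + 1) (cob_right x).
Proof.
move=> sx t a; apply: contraNeq => /cob_right_neq0[b [Tt ta ba /(supp2_cell sx)]].
rewrite /cell Tt ta => /and3P[_ _]; rewrite (inc_dim ba) /= => /eqP ->.
by rewrite addrA.
Qed.

Lemma tot_cob_supp m x : supp2 m x -> supp2 (m + 1) (tot_cob x).
Proof.
by move=> sx s a c; rewrite /tot_cob (bd_left_supp sx c) (cob_right_supp sx c) subr0 mul0rz.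
Qed.

Lemma tot_cob_supp' m x : supp2 (m - 1) x -> supp2 m (tot_cob x).
Proof. by move=> /tot_cob_supp; rewrite subrK. Qed.

Lemma bd_left_fin x : fin2 x -> fin2 (bd_left x).
Proof.
move=> fx; apply: (fin2_near fx) => t a /bd_left_neq0[r [_ ta tr [xr ra]]].
by exists r, a.
Qed.

Lemma cob_right_fin x : fin2 x -> fin2 (cob_right x).
Proof.
move=> fx; apply: (fin2_op fx fx) => t xt _.
apply: bprodP => a; apply/eqP/negPn/negP.
by move=> /cob_right_neq0[b [_ _ _]]; rewrite xt eqxx.
Qed.

Lemma tot_cob_fin x : fin2 x -> fin2 (tot_cob x).
Proof.
move=> fx; apply: (fin2_op (bd_left_fin fx) (cob_right_fin fx)) => t e1t e2t.
by apply: bprodP => a; rewrite /tot_cob e1t e2t subr0 mul0rz.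
Qed.

Lemma bd_leftB x x' t a : bd_left (x - x') t a = bd_left x t a - bd_left x' t a.
Proof.
rewrite /bd_left; case: ifP => _; last by rewrite subr0.
by rewrite -sumrB; apply: eq_bigr => r _; rewrite -mulrzBl.
Qed.

Lemma cob_rightB x x' t a : cob_right (x - x') t a = cob_right x t a - cob_right x' t a.
Proof.
rewrite /cob_right; case: ifP => _; last by rewrite subr0.
by rewrite -CobB.
Qed.

Lemma tot_cobB x x' : tot_cob (x - x') = tot_cob x - tot_cob x'.
Proof.
apply: fam2E => t a; rewrite -[RHS]/(tot_cob x t a - tot_cob x' t a) /tot_cob bd_leftB cob_rightB -mulrzBl.
by rewrite !opprD opprK addrACA.
Qed.

Lemma tot_cob0 : tot_cob 0 = 0.
Proof. by have := tot_cobB 0 0; rewrite !subrr. Qed.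

Lemma tot_cobN x : tot_cob (- x) = - tot_cob x.
Proof. by rewrite -[- x]sub0r tot_cobB tot_cob0 sub0r. Qed.

Lemma tot_cobD x x' : tot_cob (x + x') = tot_cob x + tot_cob x'.
Proof. by rewrite -{1}[x']opprK tot_cobB tot_cobN opprK. Qed.

Lemma bd_left_scale2 e x t a : bd_left (scale2 e x) t a = bd_left x t a *~ e.
Proof.
rewrite /bd_left; case: ifP => _; last by rewrite mul0rz.
by rewrite mulrz_suml; apply: eq_bigr => r _; rewrite mulrzAC.
Qed.

Lemma cob_right_scale2 e x t a : cob_right (scale2 e x) t a = cob_right x t a *~ e.
Proof. by rewrite /cob_right; case: ifP => _; rewrite ?mul0rz// -Cob_mulz. Qed.

Lemma tot_cob_scale2 e x : tot_cob (scale2 e x) = scale2 e (tot_cob x).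
Proof.
by apply: fam2E => t a; rewrite /tot_cob /scale2 bd_left_scale2 cob_right_scale2 -mulrzBl mulrzAC.
Qed.

(** Precomposing with this sign turns [tot_cob] into [cob_right + bd_left]; the families used as
    corrections are twisted so that signs disappear. *)
Definition twist x : fam2 := fun t a => x t a *~ dim_sign t.

Lemma twist_supp m x : supp2 m x -> supp2 m (twist x).
Proof. by move=> sx s a /sx; rewrite /twist => ->; rewrite mul0rz. Qed.

Lemma twist_fin x : fin2 x -> fin2 (twist x).
Proof.
move=> fx; apply: (fin2_op fx fx) => t xt _.
by apply: bprodP => a; rewrite /twist xt mul0rz.
Qed.

Lemma bd_left_twist x t a : bd_left (twist x) t a = - (bd_left x t a *~ dim_sign t).
Proof.
rewrite /bd_left; case: ifP => _; last by rewrite mul0rz oppr0.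
rewrite mulrz_suml -sumrN; apply: eq_bigr => r _; rewrite /twist.
have [->|tr] := eqVneq (inc t r) 0; first by rewrite !mulr0z mul0rz oppr0.
by rewrite (dim_sign_inc tr) mulrNz mulNrz mulrzAC.
Qed.

Lemma cob_right_twist x t a : cob_right (twist x) t a = cob_right x t a *~ dim_sign t.
Proof. by rewrite /cob_right; case: ifP => _; rewrite ?mul0rz// -Cob_mulz. Qed.

Lemma tot_cob_twist x t a : tot_cob (twist x) t a = cob_right x t a + bd_left x t a.
Proof.
rewrite /tot_cob bd_left_twist cob_right_twist opprK -mulrzDl -mulrzA dim_sign_sqr.
by rewrite mulr1z.
Qed.

Lemma bd_left_bd_left m x t a : supp2 m x -> bd_left (bd_left x) t a = 0.
Proof.
move=> sx; rewrite {1}/bd_left; case: ifP => // /andP[Tt ta].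
transitivity (\sum_(r <- faces a)
    (\sum_(q <- faces a) x q a *~ inc r q) *~ inc t r).
  rewrite [LHS]big_seq [RHS]big_seq; apply: eq_bigr => r; rewrite mem_faces => ra.
  have [->|tr] := eqVneq (inc t r) 0; first by rewrite !mulr0z.
  congr (_ *~ _); rewrite /bd_left ra andbT; case: ifPn => // nT.
  rewrite big1// => q _; apply/eqP; apply: contraNT nT => xq.
  have /and3P[Tq _ _] := supp2_cell sx (mulz_neq0l xq).
  exact: (last_convex Uconv (inc_sle tr) (inc_sle (mulz_neq0r xq))).
rewrite sum_sum_mulrz big_seq big1// => q; rewrite mem_faces => qa.
by under eq_bigr do rewrite mulrC; rewrite inc_inc ?mulr0z.
Qed.

Lemma cob_right_cob_right m x t a : supp2 m x -> cob_right (cob_right x) t a = 0.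
Proof.
move=> sx; rewrite {1}/cob_right; case: ifP => // /andP[Tt ta].
rewrite -[RHS](Cob_Cob o (x t) a); apply: eq_Cob => b _.
rewrite /cob_right Tt /=; case: ifPn => // tb; apply/esym/big1 => c _.
have [xc|/(supp2_cell sx)/and3P[_ tc _]] := eqVneq (x t c) 0.
  by rewrite xc bihom0 mul0rz.
have [->|/inc_sle cb] := eqVneq (inc c b) 0; first by rewrite mulr0z.
by case/negP: tb; exact: sle_trans tc cb.
Qed.

Lemma bd_left_cob_right m x t a : supp2 m x -> bd_left (cob_right x) t a = cob_right (bd_left x) t a.
Proof.
move=> sx; rewrite {1}/bd_left {2}/cob_right; case: ifP => // /andP[Tt ta].
transitivity (\sum_(r <- faces a) \sum_(b <- faces a)
    shm F b a (x r b) *~ inc b a *~ inc t r).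
  rewrite [LHS]big_seq [RHS]big_seq; apply: eq_bigr => r; rewrite mem_faces => ra.
  rewrite -mulrz_suml /cob_right ra andbT; case: ifPn => // nT.
  rewrite big1 ?mul0rz// => b _; apply/eqP; apply: contraNT nT => xb.
  have xrb : x r b != 0.
    by apply: contra_neq xb => ->; rewrite bihom0 mul0rz.
  by have /and3P[] := supp2_cell sx xrb.
rewrite exchange_big /= [LHS]big_seq [RHS]big_seq; apply: eq_bigr => b.
rewrite mem_faces => ba; rewrite /bd_left Tt /=; case: ifPn => [tb|tb].
  rewrite bihom_sum mulrz_suml (sum_faces_widen ba) => [|r].
    by apply: eq_bigr => r _; rewrite bihomMz mulrzAC.
  have [->|xr _] := eqVneq (x r b) 0; first by rewrite mul0rz bihom0 mul0rz eqxx.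
  by have /and3P[] := supp2_cell sx xr.
rewrite bihom0 mul0rz big1// => r _; apply/eqP; apply: contraNT tb => xr.
have tr := inc_sle (mulz_neq0r xr); apply: sle_trans tr _.
have xrb : x r b != 0.
  by apply: contra_neq xr => ->; rewrite bihom0 !mul0rz.
by have /and3P[] := supp2_cell sx xrb.
Qed.

Lemma tot_cob_tot_cob m x : supp2 m x -> tot_cob (tot_cob x) = 0.
Proof.
move=> sx; apply: fam2E => t a.
have -> : tot_cob x = twist (cob_right x - bd_left x) by [].
rewrite tot_cob_twist cob_rightB bd_leftB (bd_left_bd_left t a sx) (cob_right_cob_right t a sx) (bd_left_cob_right t a sx).
by rewrite sub0r subr0 addNr.
Qed.

(** The embedding of cochains: [y s] spreads to every [a] with back face [s] and is recorded at the
    complementary front face. Its classes are the cap product. *)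
Definition front_back y : fam2 := fun t a => if T t && sle t a
  then \sum_(s <- faces a) shm F s a (y s) *~ (chi o t s a)%:R else 0.

Lemma front_back_neq0 y t a : front_back y t a != 0 ->
  exists s, [/\ T t, sle t a, chi o t s a & y s != 0].
Proof.
rewrite /front_back; case: ifP => [/andP[Tt ta]|]; last by rewrite eqxx.
move=> x0; apply/not_existsP => no; case/eqP: x0; apply: big1 => s _.
case c: (chi o t s a); last by rewrite mulr0z.
have [->|ys] := eqVneq (y s) 0; first by rewrite bihom0 mul0rz.
by case: (no s).
Qed.

Lemma front_back_supp l y : suppS l y -> supp2 l (front_back y).
Proof.
move=> sy t a; apply: contraNeq => /front_back_neq0[s [Tt ta c]].
apply: contraNT => nc; apply/eqP/sy; apply: contra nc => /andP[_ /eqP sl].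
by rewrite /cell Tt ta (chi_dim c) sl /=.
Qed.

Lemma front_back_fin y : finF y -> fin2 (front_back y).
Proof.
move=> fy /fy finy; apply: (finite_near finy) => t /fam2_neq0[a /front_back_neq0[s [_ ta c ys]]].
by exists s => //; exists a => //; have [] := chi_sle c.
Qed.

Lemma cob_right_front_back y t a : T t -> sle t a ->
  cob_right (front_back y) t a = \sum_(r <- faces a)
    shm F r a (y r) *~ (\sum_(b <- faces a) (chi o t r b)%:R * inc b a).
Proof.
move=> Tt ta; rewrite /cob_right Tt ta /=.
transitivity (\sum_(b <- faces a) \sum_(r <- faces a)
    shm F r a (y r) *~ ((chi o t r b)%:R * inc b a)).
  rewrite [LHS]big_seq [RHS]big_seq; apply: eq_bigr => b; rewrite mem_faces => ba.
  rewrite /front_back Tt /=; case: ifPn => [tb|tb]; last first.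
    rewrite bihom0 mul0rz big1// => r _; case c: (chi o t r b); last by rewrite mul0r mulr0z.
    by have [tb' _] := chi_sle c; rewrite tb' in tb.
  rewrite bihom_sum mulrz_suml (sum_faces_widen ba) => [|r].
    apply: eq_bigr => r _; rewrite bihomMz -mulrzA.
    case c: (chi o t r b); last by rewrite !mul0r !mulr0z.
    by have [_ rb] := chi_sle c; rewrite shm_comp.
  case c: (chi o t r b); first by have [] := chi_sle c.
  by rewrite mulr0z bihom0 mul0rz eqxx.
rewrite exchange_big; apply: eq_bigr => r _ /=.
by rewrite -mulrz_sumr.
Qed.

Lemma bd_left_front_back l y t a : suppS l y -> T t -> sle t a ->
  bd_left (front_back y) t a = \sum_(r <- faces a)
    shm F r a (y r) *~ (\sum_(u <- faces a) (chi o u r a)%:R * inc t u).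
Proof.
move=> sy Tt ta; rewrite /bd_left Tt ta /=.
rewrite -sum_sum_mulrz big_seq [RHS]big_seq; apply: eq_bigr => u.
rewrite mem_faces => ua; congr (_ *~ _); rewrite /front_back ua andbT; case: ifPn => // nT.
apply/esym/big1 => r _; case c: (chi o u r a); last by rewrite mulr0z.
by rewrite sy ?bihom0 ?mul0rz// (first_last_chi U c) (negbTE nT).
Qed.

Lemma front_back_cob y t a : T t -> sle t a ->
  front_back (cobS y) t a = \sum_(r <- faces a)
    shm F r a (y r) *~ (\sum_(s <- faces a) (chi o t s a)%:R * inc r s).
Proof.
move=> Tt ta; rewrite /front_back Tt ta /=.
transitivity (\sum_(s <- faces a) (\sum_(r <- faces a)
    shm F r a (y r) *~ inc r s) *~ (chi o t s a)%:R).
  rewrite [LHS]big_seq [RHS]big_seq; apply: eq_bigr => s; rewrite mem_faces => sa.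
  case c: (chi o t s a); last by rewrite !mulr0z.
  congr (_ *~ _); rewrite /cob_on (first_last_chi U c) Tt bihom_sum.
  rewrite -(sum_faces_widen sa) => [|r /mulz_neq0r/inc_sle//].
  rewrite big_seq [RHS]big_seq; apply: eq_bigr => r; rewrite mem_faces => rs.
  by rewrite bihomMz shm_comp.
rewrite sum_sum_mulrz; apply: eq_bigr => r _.
by congr (_ *~ _); apply: eq_bigr => s _; rewrite mulrC.
Qed.

(** By [inc_chi], the row part minus the column part is the coboundary of [y] at the back face, up
    to the sign of [dim t], which [dim_sign] removes. *)
Lemma front_back_tot_cob l y : suppS l y -> tot_cob (front_back y) = front_back (cobS y).
Proof.
move=> sy; apply: fam2E => t a.
have [/andP[Tt ta]|nT] := boolP (T t && sle t a); last first.
  by rewrite /tot_cob /bd_left /cob_right /front_back (negbTE nT) subr0 mul0rz.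
rewrite /tot_cob cob_right_front_back// (bd_left_front_back sy)// front_back_cob// -sumrB mulrz_suml.
apply: eq_bigr => r _; rewrite -mulrzBr -mulrzA; congr (_ *~ _).
rewrite inc_chi opprB addrC subrK mulrC mulrA.
have -> : dim_sign t = (-1) ^+ #|` val t|.-1.
  rewrite /dim_sign /int_sign; congr (_ ^+ _); rewrite /dim.
  by have := simplex_card_gt0 t; lia.
by rewrite -expr2 sqrr_sign mul1r.
Qed.

(** The augmentation of the columns, dual to [vertex_col]. As a left inverse of [front_back] it is
    the way back to cochains. *)
Definition vertex_sum x : bprod F := fun a => if S a
  then \sum_(v <- faces a) x v a *~ (#|` val v| == 1%N)%:R else 0.

Lemma vertex_sum_neq0 x a : vertex_sum x a != 0 -> exists v,
  [/\ S a, sle v a, #|` val v| == 1%N & x v a != 0].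
Proof.
rewrite /vertex_sum; case: ifP => [Sa|]; last by rewrite eqxx.
move=> x0; apply/not_existsP => no; case/eqP: x0.
rewrite big_seq; apply: big1 => v; rewrite mem_faces => va.
have [v1|_] := boolP (#|` val v| == 1%N); last by rewrite mulr0z.
have [->|xv] := eqVneq (x v a) 0; first by rewrite mul0rz.
by case: (no v).
Qed.

Lemma vertex_sum_supp m x : supp2 m x -> suppS m (vertex_sum x).
Proof.
move=> sx a; apply: contraNeq => /vertex_sum_neq0[v [Sa va v1 /(supp2_cell sx)]].
by rewrite /cell Sa (dim_vertex v1) add0r => /and3P[].
Qed.

Lemma vertex_sum_fin x : fin2 x -> finF (vertex_sum x).
Proof.
move=> fx /fx finx; apply: (finite_near finx) => a /vertex_sum_neq0[v [_ va _ xv]].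
exists v; first by apply: contra_neq xv => ->.
by exists a => //; exact: sle_refl.
Qed.

Lemma vertex_sumB x x' : vertex_sum (x - x') = vertex_sum x - vertex_sum x'.
Proof.
apply: bprodP => a; rewrite -[RHS]/(vertex_sum x a - vertex_sum x' a) /vertex_sum.
case: ifP => _; last by rewrite subr0.
by rewrite -sumrB; apply: eq_bigr => v _; rewrite -mulrzBl.
Qed.

Lemma vertex_sum_front_back l y : suppS l y -> vertex_sum (front_back y) = y.
Proof.
move=> sy; apply: bprodP => a.
rewrite /vertex_sum; have [Sa|nS] := boolP (S a); last by rewrite sy// (negbTE nS).
have [p [q [aE pa _ Sp]]] := firstE o a.
have pq : subseq [:: p] (vertices o a) by rewrite sub1seq mem_vertices.
have [v vE va] := subseq_face pq isT; have [_ vv] := vertices_subseq pq vE.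
have cv : chi o v a a by apply: (chi_vertices (p := [::]) (x := p) (q := q)).
have v1 : #|` val v| == 1%N by rewrite -(size_vertices o v) vv.
have only r s : chi o r s a -> #|` val r| == 1%N -> s = a /\ r = v.
  move=> /chiP[p' [x [q' [ea er es]]]].
  rewrite -(size_vertices o) er size_cat addn1 eqSS size_eq0 => /eqP p0.
  split; apply/val_inj; first by rewrite -(fs_vertices o s) es -(fs_vertices o a) ea p0.
  rewrite -(fs_vertices o r) er p0 vE; move: ea; rewrite aE p0.
  by case=> ->.
rewrite (eq_big_supp (r2 := [:: v])) ?fset_uniq ?big_seq1//; first last.
- by move=> r; rewrite inE => /eqP -> _; rewrite mem_faces.
- move=> r _; have [r1|r1] := boolP (#|` val r| == 1%N); last by rewrite mulr0z eqxx.
  rewrite mulr1z => /front_back_neq0[s [_ _ c _]].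
  by have [_ ->] := only _ _ c r1; rewrite inE.
rewrite v1 mulr1z /front_back va -(first_last_chi U cv) Sa /=.
rewrite (eq_big_supp (r2 := [:: a])) ?fset_uniq ?big_seq1//; first last.
- by move=> r; rewrite inE => /eqP -> _; rewrite mem_faces sle_refl.
- move=> s _; case c: (chi o v s a); last by rewrite mulr0z eqxx.
  by have [-> _] := only _ _ c v1; rewrite inE.
by rewrite cv mulr1z shm_id.
Qed.

(** If [r] ends and [a] begins in [U], all vertices of [r] are in [U], so the augmentation kills the
    column boundary. At vertices [dim_sign] is [1], and the coboundary in [a] remains. *)
Lemma vertex_sum_tot_cob m x : supp2 m x -> vertex_sum (tot_cob x) = cobS (vertex_sum x).
Proof.
move=> sx; apply: bprodP => a; rewrite /vertex_sum /cob_on.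
have [Sa|//] := boolP (S a).
have e1_0 : \sum_(v <- faces a) bd_left x v a *~ (#|` val v| == 1%N)%:R = 0.
  transitivity (\sum_(v <- faces a) (\sum_(r <- faces a) x r a *~ inc v r) *~
      (#|` val v| == 1%N)%:R).
    rewrite big_seq [RHS]big_seq; apply: eq_bigr => v; rewrite mem_faces => va.
    have [v1|_] := boolP (#|` val v| == 1%N); last by rewrite !mulr0z.
    congr (_ *~ _); rewrite /bd_left va andbT; case: ifPn => // nT.
    apply/esym/big1 => r _; have [->|xr] := eqVneq (x r a) 0; first by rewrite mul0rz.
    have [->|/inc_sle vr] := eqVneq (inc v r) 0; first by rewrite mulr0z.
    have [p vp] := card1P v1; case/negP: nT; rewrite (last_in1 o U vp).
    have /and3P[Tr ra _] := supp2_cell sx xr.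
    apply: (between_in' Uconv ra Tr Sa); apply: (fsubsetP vr).
    by rewrite vp fset11.
  rewrite sum_sum_mulrz big_seq big1// => r; rewrite mem_faces => ra.
  under eq_bigr do rewrite mulrC.
  by rewrite sum_inc_vertex// mulr0z.
transitivity (\sum_(v <- faces a) cob_right x v a *~ (#|` val v| == 1%N)%:R).
  rewrite -[RHS]subr0 -[X in _ = _ - X]e1_0 -sumrB; apply: eq_bigr => v _.
  have [v1|_] := boolP (#|` val v| == 1%N); last by rewrite !mulr0z subr0.
  by rewrite /tot_cob /dim_sign (dim_vertex v1) /int_sign /= expr0 !mulr1z.
transitivity (\sum_(v <- faces a) \sum_(b <- faces a)
    shm F b a (x v b) *~ (#|` val v| == 1%N)%:R *~ inc b a).
  rewrite big_seq [RHS]big_seq; apply: eq_bigr => v; rewrite mem_faces => va.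
  under [RHS]eq_bigr do rewrite mulrzAC.
  rewrite -mulrz_suml; have [v1|_] := boolP (#|` val v| == 1%N); last by rewrite !mulr0z.
  congr (_ *~ _); rewrite /cob_right va andbT; case: ifPn => // nT.
  apply/esym/big1 => b _; rewrite sx ?bihom0 ?mul0rz// /cell (negbTE nT).
  by [].
rewrite exchange_big /= big_seq [RHS]big_seq; apply: eq_bigr => b.
rewrite mem_faces => ba; rewrite -mulrz_suml.
have [->|ba'] := eqVneq (inc b a) 0; first by rewrite !mulr0z.
congr (_ *~ _); have [Sb|nS] := boolP (S b).
  rewrite bihom_sum (sum_faces_widen ba) => [|v].
    by apply: eq_bigr => v _; rewrite bihomMz.
  have [->|xv _] := eqVneq (x v b) 0; first by rewrite mul0rz bihom0 eqxx.
  by have /and3P[] := supp2_cell sx xv.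
(* A face of [a] with a vertex in [U] begins in [U], because [a] does; so outside [S] there is
   nothing to sum. *)
rewrite bihom0 big1// => v _; have [v1|_] := boolP (#|` val v| == 1%N); last by rewrite mulr0z.
have [->|xv] := eqVneq (x v b) 0; first by rewrite bihom0 mul0rz.
have /and3P[Tv vb _] := supp2_cell sx xv.
have [p vp] := card1P v1; case/negP: nS; rewrite (last_in1 o U vp) in Tv.
apply: (first_in_face Uconv ba Sa _ Tv); apply: (fsubsetP vb).
by rewrite vp fset11.
Qed.

Lemma first_vertex_subproof a : exists v : V, [/\ v \in val a,
  {in val a, forall v', ord o a v v'} & S a = U v].
Proof. by have [v [_ [_ va vl vS]]] := firstE o a; exists v. Qed.

Definition first_vertex a : V := projT1 (cid (first_vertex_subproof a)).

Lemma first_vertexP a : [/\ first_vertex a \in val a,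
  {in val a, forall v, ord o a (first_vertex a) v} & S a = U (first_vertex a)].
Proof. exact: projT2 (cid (first_vertex_subproof a)). Qed.

Definition cone_first x : fam2 := fun t a => if T t && sle t a
  then \sum_(r <- faces a) x r a *~ cone o (first_vertex a) r t else 0.

Lemma cone_first_neq0 x t a : cone_first x t a != 0 -> exists r, [/\ T t, sle t a,
  sle r a, x r a != 0 & #|` val t| = #|` val r|.+1].
Proof.
rewrite /cone_first; case: ifP => [/andP[Tt ta]|]; last by rewrite eqxx.
move=> x0; apply/not_existsP => no; case/eqP: x0; rewrite big_seq big1// => r.
rewrite mem_faces => ra; apply/eqP/negPn/negP => xr.
have [_ wr tE _] := cone_neq0 (mulz_neq0r xr).
apply: (no r); split=> //; first exact: mulz_neq0l xr.
by rewrite tE cardfsU1 wr.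
Qed.

Lemma cone_first_supp m x : supp2 m x -> supp2 (m - 1) (cone_first x).
Proof.
move=> sx s a; apply: contraNeq => /cone_first_neq0[r [Ts sa ra xr rs]].
have /and3P[_ _ /eqP am] := supp2_cell sx xr.
rewrite /cell Ts sa am /= /dim rs intS; apply/eqP.
by ring.
Qed.

Lemma cone_first_fin x : fin2 x -> fin2 (cone_first x).
Proof.
move=> fx; apply: (fin2_near fx) => s a /cone_first_neq0[r [_ sa ra xr _]].
by exists r, a.
Qed.

(** On the kernel of the augmentation the projection term of [cone_homotopy] disappears. Coning onto
    the first vertex respects [T] by [last_in_cone]. *)
Lemma cone_first_homotopy m x : supp2 m x -> vertex_sum x = 0 ->
  x = bd_left (cone_first x) + cone_first (bd_left x).
Proof.
move=> sx epsx; apply: fam2E => t a.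
rewrite -[RHS]/(bd_left (cone_first x) t a + cone_first (bd_left x) t a).
have [/andP[Tt ta]|nT] := boolP (T t && sle t a); last first.
  rewrite /bd_left /cone_first (negbTE nT) addr0 sx//.
  by apply: contra nT => /and3P[-> ->].
have [wa wl Sw] := first_vertexP a.
have -> : bd_left (cone_first x) t a = \sum_(r <- faces a)
    x r a *~ (\sum_(k <- faces a) cone o (first_vertex a) r k * inc t k).
  rewrite -sum_sum_mulrz /bd_left Tt ta /= big_seq [RHS]big_seq; apply: eq_bigr => k.
  rewrite mem_faces => ka; congr (_ *~ _); rewrite /cone_first ka andbT; case: ifPn => // nT.
  apply/esym/big1 => r _; apply/eqP.
  apply: contraNT nT => xr; have [_ _ kE _] := cone_neq0 (mulz_neq0r xr).
  rewrite (last_in_cone U ka wa wl kE).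
  by have /and3P[] := supp2_cell sx (mulz_neq0l xr).
have -> : cone_first (bd_left x) t a = \sum_(r <- faces a)
    x r a *~ (\sum_(k <- faces a) cone o (first_vertex a) k t * inc k r).
  transitivity (\sum_(k <- faces a) (\sum_(r <- faces a) x r a *~ inc k r) *~
      cone o (first_vertex a) k t).
    rewrite /cone_first Tt ta /= big_seq [RHS]big_seq; apply: eq_bigr => k.
    rewrite mem_faces => ka; have [->|ck] := eqVneq (cone o (first_vertex a) k t) 0.
      by rewrite !mulr0z.
    have [_ _ tE _] := cone_neq0 ck.
    by rewrite /bd_left -(last_in_cone U ta wa wl tE) Tt ka.
  rewrite sum_sum_mulrz; apply: eq_bigr => r _; congr (_ *~ _).
  by apply: eq_bigr => k _; rewrite mulrC.
rewrite -big_split /=.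
transitivity (\sum_(r <- faces a) x r a *~ ((r == t)%:R -
    ((val t == [fset first_vertex a]%fset) && (#|` val r| == 1%N))%:R)); last first.
  rewrite big_seq [RHS]big_seq; apply: eq_bigr => r; rewrite mem_faces => ra.
  by rewrite -(cone_homotopy o wa ra ta) mulrzDr addrC.
under eq_bigr do rewrite mulrzBr.
rewrite sumrB (eq_big_supp (r2 := [:: t])) ?fset_uniq ?big_seq1 ?eqxx ?mulr1z//; first last.
- by move=> r; rewrite inE => /eqP -> _; rewrite mem_faces.
- by move=> r _; rewrite inE; have [//|_] := eqVneq r t; rewrite mulr0z eqxx.
have [tw|_] := eqVneq (val t) [fset first_vertex a]%fset; last first.
  by rewrite big1 ?subr0// => r _; rewrite mulr0z.
have Sa : S a by rewrite Sw -(last_in1 o U tw).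
have /(congr1 (fun f : bprod F => f a)) := epsx.
by rewrite /vertex_sum Sa /= => ->; rewrite subr0.
Qed.

Lemma tot_cob_eq0 x t a : tot_cob x = 0 -> cob_right x t a = bd_left x t a.
Proof.
move=> /(congr1 (fun f : fam2 => f t a)) Ex; apply/eqP; rewrite -subr_eq0.
by apply/eqP; apply: (mulz_sign_eq0 (dim_sign_sqr t)).
Qed.

Lemma cycle_vertex_sum m z : supp2 m z -> fin2 z -> tot_cob z = 0 -> vertex_sum z = 0 ->
  exists w, [/\ supp2 (m - 1) w, fin2 w & z = tot_cob w].
Proof.
(* Entries are cleared from the smallest [t] upwards. The bound on [j] ensures that every step
   clears the vertices, so the corrected family stays in the kernel of [vertex_sum]. *)
suff : forall j, (j <= n.+1)%N -> (forall t a, (#|` val t| + j < n.+2)%N -> z t a = 0) ->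
    supp2 m z -> fin2 z -> tot_cob z = 0 -> vertex_sum z = 0 ->
    exists w, [/\ supp2 (m - 1) w, fin2 w & z = tot_cob w].
  move=> H; apply: (H n.+1) => // t a; have := simplex_card_gt0 t; lia.
move=> j; elim: j z => [|j IHj] z jn zj sz fz Ez epsz.
  exists 0; split=> //; first exact: fin2_0.
  rewrite tot_cob0; apply: fam2E => t a; apply: zj.
  by rewrite addn0 ltnS; exact: sc_dim_le (valP t).
pose w1 := twist (cone_first z).
have sw1 : supp2 (m - 1) w1 by apply: twist_supp; exact: cone_first_supp.
have fw1 : fin2 w1 by apply: twist_fin; exact: cone_first_fin.
have z'j t a : (#|` val t| + j < n.+2)%N -> (z - tot_cob w1) t a = 0.
  move=> tj; have -> : (z - tot_cob w1) t a = cone_first (bd_left z) t a - cob_right (cone_first z) t a.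
    have zE : z t a = bd_left (cone_first z) t a + cone_first (bd_left z) t a.
      exact: (congr1 (fun f : fam2 => f t a) (cone_first_homotopy sz epsz)).
    rewrite -[LHS]/(z t a - tot_cob w1 t a) tot_cob_twist zE.
    by rewrite opprD addrA addrAC [bd_left _ _ _ + _]addrC addrK.
  have -> : cone_first (bd_left z) t a = 0.
    apply/eqP/negPn/negP => /cone_first_neq0[r [_ _ _ + tr]].
    rewrite -(tot_cob_eq0 r a Ez) => /cob_right_neq0[b [_ _ _]].
    by rewrite zj ?eqxx//; move: tj tr; lia.
  rewrite sub0r; apply/eqP; rewrite oppr_eq0; apply/negPn/negP.
  move=> /cob_right_neq0[b [_ _ _ /cone_first_neq0[r [_ _ _ + tr]]]].
  by rewrite zj ?eqxx//; move: tj tr; lia.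
have [||||||w [sw fw zw]] := IHj (z - tot_cob w1).
- exact: ltnW.
- exact: z'j.
- by apply: supp2B => //; exact: tot_cob_supp'.
- by apply: fin2B => //; exact: tot_cob_fin.
- by rewrite tot_cobB Ez (tot_cob_tot_cob sw1) subr0.
- apply: bprodP => a; rewrite /vertex_sum.
  case: ifP => // _; apply: big1 => v _.
  have [/eqP v1|_] := boolP (#|` val v| == 1%N); last by rewrite mulr0z.
  by rewrite z'j ?mul0rz// v1; move: jn; lia.
exists (w + w1); split; first exact: supp2D.
  exact: fin2D.
by rewrite tot_cobD -zw subrK.
Qed.

Hypothesis exact_T : forall t (k : int), T t -> k != n%:Z -> cob_exact o F t k.

(** Entries are removed from the largest [a] downwards. Rows are exact off dimension [n], and in
    dimension [n] the vanishing of classes replaces exactness. The solution avoids dimension [n], so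
    subtracting it will not change classes. *)
Lemma push_bot m z : supp2 m z -> fin2 z -> tot_cob z = 0 ->
  (forall t, T t -> dim t + m = n%:Z -> loc_class o F t (z t) = 0) ->
  exists w, [/\ supp2 (m - 1) w, fin2 w, z = tot_cob w &
    forall t a, dim a = n%:Z -> w t a = 0].
Proof.
suff : forall N, (N <= n.+1)%N -> (forall t a, (N < #|` val a|)%N -> z t a = 0) ->
    supp2 m z -> fin2 z -> tot_cob z = 0 ->
    (forall t, T t -> dim t + m = n%:Z -> loc_class o F t (z t) = 0) ->
    exists w, [/\ supp2 (m - 1) w, fin2 w, z = tot_cob w &
      forall t a, dim a = n%:Z -> w t a = 0].
  move=> H; apply: (H n.+1) => // t a; have := sc_dim_le (valP a); lia.
move=> N; elim: N z => [|N IHN] z Nn zN sz fz Ez clz.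
  exists 0; split=> //; first exact: fin2_0.
  rewrite tot_cob0; apply: fam2E => t a; apply: zN.
  exact: simplex_card_gt0.
have ex_w t : exists ws : bprod F,
   [/\ forall a, ~~ (T t && in_star t (dim t + m - 1) a) -> ws a = 0,
       z t = 0 -> ws = 0,
       forall a, (N < #|` val a|)%N -> ws a = 0 &
       forall a, sle t a -> (N < #|` val a|)%N -> Cob ws a = z t a].
  have [Tt|nT] := boolP (T t); last first.
    exists 0; split=> // a ta aN; rewrite Cob0 sz// /cell (negbTE nT).
    by [].
  have [zt|zt] := eqVneq (z t) 0.
    by exists 0; split=> // a ta aN; rewrite Cob0 zt.
  have [tN|tN] := eqVneq (dim t + m) N%:Z; last first.
    exists 0; split=> // a ta aN; rewrite Cob0; apply/esym/eqP.
    apply: contraNT tN => zta; have /and3P[_ _ /eqP am] := supp2_cell sz zta.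
    have : ~~ (N.+1 < #|` val a|)%N.
      by apply: contra zta => aN'; apply/eqP/zN.
    move: am aN; rewrite /dim; lia.
  have zstar a : ~~ in_star t N%:Z a -> z t a = 0.
    by move=> na; apply: sz; rewrite /cell Tt tN.
  have zcyc a : sle t a -> Cob (z t) a = 0.
    move=> ta; have [aN|aN] := eqVneq (dim a) (N%:Z + 1); last first.
      exact: star_Cob0 zstar aN.
    have := tot_cob_eq0 t a Ez; rewrite {1}/cob_right Tt ta /= => ->.
    apply/eqP/negPn/negP => /bd_left_neq0[r [_ _ _ [+ _]]]; rewrite zN ?eqxx//.
    by move: aN; rewrite /dim; lia.
  have [ws [w0 wC]] : exists ws : bprod F,
      (forall a, ~~ in_star t (N%:Z - 1) a -> ws a = 0) /\
      forall a, in_star t N a -> Cob ws a = z t a.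
    (* At the top of the row the primitive comes from a vanishing class, below it from exactness. *)
    have [Nn'|Nn'] := eqVneq N%:Z n%:Z.
      by rewrite Nn'; apply: loc_class_eq0; apply: clz; rewrite // tN.
    have [ws [w0 wC]] := exact_T Tt Nn' zstar zcyc.
    by exists ws; split=> // a /andP[ta _]; exact: wC.
  have wN a : (N < #|` val a|)%N -> ws a = 0.
    by move=> aN; apply: w0; apply: out_star_dim; move: aN; rewrite /dim; lia.
  exists ws; split=> //.
  - by move=> a; rewrite tN; exact: w0.
  - by move=> /eqP; rewrite (negbTE zt).
  - move=> a ta aN; have [aN'|aN'] := eqVneq (dim a) N%:Z.
      by apply: wC; rewrite /in_star ta aN' eqxx.
    rewrite (zstar _ (out_star_dim t aN')).
    have aN2 : dim a != N%:Z - 1 + 1 by rewrite subrK.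
    exact: star_Cob0 w0 aN2.
pose w : fam2 := fun t => projT1 (cid (ex_w t)).
have wP t : [/\ forall a, ~~ (T t && in_star t (dim t + m - 1) a) -> w t a = 0,
       z t = 0 -> w t = 0,
       forall a, (N < #|` val a|)%N -> w t a = 0 &
       forall a, sle t a -> (N < #|` val a|)%N -> Cob (w t) a = z t a].
  exact: projT2 (cid (ex_w t)).
have sw : supp2 (m - 1) w.
  move=> t a c; have [w0 _ _ _] := wP t; apply: w0; move: c.
  by rewrite /cell /in_star addrA.
have fw : fin2 w.
  by apply: (fin2_op fz fz) => t zt _; have [_ + _ _] := wP t; exact.
pose w1 := twist w.
have sw1 : supp2 (m - 1) w1 by exact: twist_supp.
have fw1 : fin2 w1 by exact: twist_fin.
have z'N t a : (N < #|` val a|)%N -> (z - tot_cob w1) t a = 0.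
  move=> aN; rewrite -[LHS]/(z t a - tot_cob w1 t a) tot_cob_twist.
  rewrite (_ : bd_left w t a = 0) ?addr0; last first.
    apply/eqP/negPn/negP => /bd_left_neq0[r [_ _ _ [+ _]]].
    by have [_ _ wN _] := wP r; rewrite wN ?eqxx.
  rewrite /cob_right; case: ifPn => [/andP[Tt ta]|nT].
    by have [_ _ _ wC] := wP t; rewrite wC// subrr.
  rewrite subr0 sz//; apply: contra nT.
  by rewrite /cell => /and3P[-> -> _].
have sz' : supp2 m (z - tot_cob w1) by apply: supp2B => //; exact: tot_cob_supp'.
have [||||||w' [sw' fw' zw' w'n]] := IHN (z - tot_cob w1).
- exact: ltnW.
- exact: z'N.
- exact: sz'.
- by apply: fin2B => //; exact: tot_cob_fin.
- by rewrite tot_cobB Ez (tot_cob_tot_cob sw1) subr0.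
(* After this step dimension [n] is empty, so the classes of the corrected family vanish
   trivially. *)
- move=> t Tt tm; rewrite (_ : (z - tot_cob w1) t = 0) ?bihom0//.
  apply: bprodP => a.
  have [an|an] := eqVneq (dim a) n%:Z.
    by apply: z'N; move: an Nn; rewrite /dim; lia.
  by apply: sz'; rewrite /cell tm (negbTE an) !andbF.
exists (w' + w1); split; [exact: supp2D|exact: fin2D| |].
  by rewrite tot_cobD -zw' subrK.
move=> t a an; rewrite -[LHS]/(w' t a + w t a *~ dim_sign t) w'n// add0r.
have [_ _ wN _] := wP t; rewrite wN ?mul0rz//.
by move: an Nn; rewrite /dim; lia.
Qed.

Local Notation h := (loc_cohom_cosheaf o F n).
Local Notation suppT := (@supp1 _ _ _ _ _ h T).

Definition class_bihom t : bihom (bprod F) (h t) := loc_class o F t.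

Definition classes x : bprod h := fun t => class_bihom t (x t).

Lemma classes_supp m x : supp2 m x -> suppT (n%:Z - m) (classes x).
Proof.
move=> sx t nt; rewrite -[RHS](bihom0 (class_bihom t)); apply: eq_loc_class => a.
move=> /andP[ta /eqP an]; apply: sx; apply: contra nt.
by rewrite /cell => /and3P[-> _ /eqP tm]; rewrite -an tm addrK eqxx.
Qed.

Lemma classes_fin x : fin2 x -> finF (classes x).
Proof.
move=> fx /fx; apply: sub_finite_set => t /=; apply: contra_neq => xt.
by rewrite /classes xt bihom0.
Qed.

Lemma classesB x x' t : classes (x - x') t = classes x t - classes x' t.
Proof. exact: bihomB. Qed.

(** The row part is a coboundary and has zero class. In the column part, extending a cochain by zero
    to a larger star is the structure map of the cosheaf, so a boundary of classes appears. *)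
Lemma classes_tot_cob m x t : supp2 m x -> T t ->
  classes (tot_cob x) t = - (Bd o (classes x) t *~ dim_sign t).
Proof.
move=> sx Tt.
have xs r a : ~~ sle r a -> x r a = 0.
  by move=> ra; apply: sx; rewrite /cell (negbTE ra) andbF.
pose x1 : bprod F := \sum_(r <- star t) x r *~ inc t r.
have -> : Bd o (classes x) t = class_bihom t x1.
  rewrite /Bd /x1 bihom_sum big_seq [RHS]big_seq; apply: eq_bigr => r.
  rewrite mem_star => tr; rewrite bihomMz; congr (_ *~ _).
  by apply: loc_class_map => // a; exact: xs.
have -> : classes (tot_cob x) t = class_bihom t ((Cob (x t) - x1) *~ dim_sign t).
  apply: eq_loc_class => a /andP[ta _].
  rewrite bprod_mulz -[RHS]/((Cob (x t) a - x1 a) *~ dim_sign t) /tot_cob.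
  rewrite /bd_left /cob_right Tt ta /=; congr ((_ - _) *~ _).
  rewrite /x1 bprod_sum; under [RHS]eq_bigr do rewrite bprod_mulz.
  apply/esym; apply: sum_star_faces => r rx.
  rewrite (inc_sle (mulz_neq0r rx)) /=.
  by apply: contraNT (mulz_neq0l rx) => /xs ->.
rewrite bihomMz bihomB (_ : class_bihom t (Cob (x t)) = 0); last first.
  by apply: loc_class_Cob => a; exact: xs.
by rewrite sub0r mulNrz.
Qed.

(** Representatives are chosen row by row, zero for the zero class so that finiteness is not
    lost. *)
Lemma classes_lift l (c : bprod h) : suppT l c -> finF c ->
  exists x, [/\ supp2 (n%:Z - l) x, fin2 x & classes x = c].
Proof.
move=> sc fc.
have ex_z t : exists z : bprod F, [/\ forall a, ~~ in_star t n a -> z a = 0,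
    c t = 0 -> z = 0 & class_bihom t z = c t].
  have [ct|ct] := eqVneq (c t) 0; first by exists 0; rewrite ct bihom0.
  have [z [z0 zc]] := loc_class_surj (c t : loc_cohom o F n t).
  by exists z; split=> // /eqP; rewrite (negbTE ct).
pose x : fam2 := fun t => projT1 (cid (ex_z t)).
have xP t : [/\ forall a, ~~ in_star t n a -> x t a = 0,
    c t = 0 -> x t = 0 & class_bihom t (x t) = c t].
  exact: projT2 (cid (ex_z t)).
exists x; split.
- move=> t a nc; have [x0 xc _] := xP t.
  have [/andP[Tt /eqP tl]|nT] := boolP (T t && (dim t == l)); last first.
    by rewrite xc// sc.
  apply: x0; apply: contra nc; rewrite /cell Tt tl => /andP[-> /eqP ->].
  by rewrite addrC subrK eqxx.
- move=> /fc; apply: sub_finite_set => t /=; apply: contra_neq => ct.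
  by have [_ + _] := xP t; exact.
- by apply: bprodP => t; have [_ _] := xP t.
Qed.

Lemma bd_classes_front_back l y t : suppS l y -> T t ->
  Bd o (classes (front_back y)) t = - (classes (front_back (cobS y)) t *~ dim_sign t).
Proof.
move=> sy Tt; rewrite -(front_back_tot_cob sy) (classes_tot_cob (front_back_supp sy) Tt).
by rewrite mulNrz opprK -mulrzA dim_sign_sqr mulr1z.
Qed.

Lemma Bd_lift_out l (c : bprod h) t : suppT l c -> dim t != l - 1 -> Bd o c t = 0.
Proof.
move=> sc tl; apply: big1 => r _; have [->|tr] := eqVneq (inc t r) 0.
  by rewrite mulr0z.
rewrite sc ?bihom0 ?mul0rz//; apply: contra tl => /andP[_ /eqP <-].
by rewrite (inc_dim tr) addrK.
Qed.

(** A lift [x] of [c] corrects [front_back y] so that its classes vanish; [push_bot] then bounds it,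
    and [vertex_sum] returns a primitive of [y]. *)
Lemma classes_front_back_inj l y (c : bprod h) : suppS l y -> finF y ->
  (forall s, S s -> Cob y s = 0) -> suppT (n%:Z - l + 1) c -> finF c ->
  (forall t, T t -> classes (front_back y) t = Bd o c t) ->
  exists y', [/\ suppS (l - 1) y', finF y' & forall s, S s -> Cob y' s = y s].
Proof.
move=> sy fy cy sc fc yc; have [x [sx fx xc]] := classes_lift sc fc.
have lE : n%:Z - (n%:Z - l + 1) = l - 1 by ring.
rewrite lE in sx; set e := int_sign (n%:Z - l).
have cy0 : cobS y = 0.
  by apply: bprodP => s; rewrite /cob_on; case: ifP => // /cy.
have Espl : tot_cob (front_back y) = 0.
  rewrite (front_back_tot_cob sy) cy0; apply: fam2E => t a; rewrite /front_back.
  by case: ifP => // _; apply: big1 => s _; rewrite bihom0 mul0rz.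
(* On the rows with [dim t + l = n] the sign of [t] is [e], so this factor compensates the sign in
   [classes_tot_cob]. *)
pose xe := scale2 e x; have sxe : supp2 (l - 1) xe by exact: scale2_supp.
have fxe : fin2 xe by exact: scale2_fin.
have [||||w [sw fw zw _]] := @push_bot l (front_back y + tot_cob xe).
- by apply: supp2D; [exact: front_back_supp|exact: tot_cob_supp'].
- by apply: fin2D; [exact: front_back_fin|exact: tot_cob_fin].
- by rewrite tot_cobD Espl (tot_cob_tot_cob sxe) addr0.
- move=> t Tt tl; rewrite -[LHS]/(classes (front_back y + tot_cob xe) t).
  rewrite -[tot_cob xe]opprK classesB -tot_cobN.
  have -> : tot_cob (- xe) = scale2 (- e) (tot_cob x).
    by rewrite -tot_cob_scale2; congr tot_cob; apply: fam2E => t' a'; rewrite /scale2 mulrNz.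
  have -> : classes (scale2 (- e) (tot_cob x)) t = classes (tot_cob x) t *~ (- e).
    rewrite /classes -bihomMz; congr (class_bihom t _).
    by apply: bprodP => a; rewrite bprod_mulz.
  rewrite (classes_tot_cob sx Tt) xc yc// mulrNz mulNrz opprK -mulrzA.
  have -> : dim_sign t = e by rewrite /dim_sign /e -tl addrK.
  by rewrite int_sign_sqr mulr1z subrr.
have splE : front_back y = tot_cob (w - xe) by rewrite tot_cobB -zw addrK.
exists (vertex_sum (w - xe)); split.
- by apply: vertex_sum_supp; exact: supp2B.
- by apply: vertex_sum_fin; exact: fin2B.
- move=> s Ss; have swx : supp2 (l - 1) (w - xe) by exact: supp2B.
  by rewrite -[in RHS](vertex_sum_front_back sy) splE (vertex_sum_tot_cob swx) /cob_on Ss.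
Qed.

(** A lift of the cycle [c] is closed up by [push_bot] and its augmentation is [y]; the difference
    with [front_back y] is in the kernel of the augmentation, where [cycle_vertex_sum] bounds it. *)
Lemma classes_front_back_surj l (c : bprod h) : suppT (n%:Z - l) c -> finF c ->
  (forall t, T t -> Bd o c t = 0) ->
  exists y (c' : bprod h), [/\ suppS l y, finF y, (forall s, S s -> Cob y s = 0),
    suppT (n%:Z - l + 1) c' /\ finF c' &
    forall t, T t -> c t - classes (front_back y) t = Bd o c' t].
Proof.
move=> sc fc cc; have [x [sx fx xc]] := classes_lift sc fc.
have lE : n%:Z - (n%:Z - l) = l by ring.
rewrite lE in sx.
have [||||w [sw fw xw wn]] := @push_bot (l + 1) (tot_cob x).
- exact: tot_cob_supp.
- exact: tot_cob_fin.
- exact: (tot_cob_tot_cob sx).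
- move=> t Tt _; rewrite -[LHS]/(classes (tot_cob x) t) (classes_tot_cob sx Tt) xc cc//.
  by rewrite mul0rz oppr0.
rewrite addrK in sw; pose x' := x - w.
have sx' : supp2 l x' by exact: supp2B.
have fx' : fin2 x' by exact: fin2B.
have Ex' : tot_cob x' = 0 by rewrite tot_cobB -xw subrr.
have xc' : classes x' = c.
  apply: bprodP => t; rewrite classesB xc.
  rewrite (_ : classes w t = 0) ?subr0// -[RHS](bihom0 (class_bihom t)).
  by apply: eq_loc_class => a /andP[_ /eqP an]; exact: wn.
pose y := vertex_sum x'; have sy : suppS l y by exact: vertex_sum_supp.
have cy : cobS y = 0.
  by rewrite -(vertex_sum_tot_cob sx') Ex'; apply: bprodP => a;
    rewrite /vertex_sum; case: ifP => // _; apply: big1 => v _; rewrite mul0rz.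
have fy : finF y by exact: vertex_sum_fin.
have [||||w' [sw' fw' yw']] := @cycle_vertex_sum l (x' - front_back y).
- by apply: supp2B => //; exact: front_back_supp.
- by apply: fin2B => //; exact: front_back_fin.
- rewrite tot_cobB Ex' (front_back_tot_cob sy) cy sub0r; apply: fam2E => t a.
  rewrite -[LHS]/(- front_back 0 t a) /front_back; case: ifP => _; last by rewrite oppr0.
  by rewrite big1 ?oppr0// => s _; rewrite bihom0 mul0rz.
- by rewrite vertex_sumB (vertex_sum_front_back sy) subrr.
set e := int_sign (n%:Z - l).
have spw := classes_supp sw'.
have lE' : n%:Z - (l - 1) = n%:Z - l + 1 by ring.
rewrite lE' in spw.
exists y, (fun t => classes w' t *~ (- e)); split.
- exact: sy.
- exact: fy.
- move=> s Ss; have : cobS y s = 0 by rewrite cy.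
  by rewrite /cob_on Ss.
- by split; [exact: supp1_mulz|exact: finF_mulz (classes_fin fw')].
- move=> t Tt; rewrite Bd_mulz -xc' -classesB yw' (classes_tot_cob sw' Tt) mulrNz.
  have [tl|tl] := eqVneq (dim t) (n%:Z - l); first by rewrite /dim_sign tl.
  by rewrite (Bd_lift_out spw) ?mul0rz// addrK.
Qed.

End SheafResolution.

(** * The cap product on chain groups, for a sheaf *)

Section SheafTransport.
Variables (V : choiceType) (n : nat) (X : lfcomplex V n) (o : orientation X).
Variables (A B : pzRingType) (F : sheaf X A B).
Implicit Types (s t u r a b : simplex X) (l : int).
Variable U : pred V.
Local Notation S := (first_in o U).
Local Notation T := (last_in o U).
Local Notation h := (loc_cohom_cosheaf o F n).

Lemma cap_loc_cohom_funE (K K' : subcomplex X) l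
    (psi : bprod (fun s : simp K l => F (val s))) (t : simp K' (n%:Z - l)) :
  T (val t) -> cap_loc_cohom_fun o psi t = classes o (front_back o U (ext_fun psi)) (val t).
Proof.
move=> Tt; rewrite /classes /class_bihom loc_classE; congr (hclass _ _ _).
apply: (model_inj (rel_cochains_star_model F (val t) n)).
apply: bprodP => a; rewrite star_cochain_ext.
case: ifPn => [/andP[ta an]|na]; last first.
  exact: (model_out (rel_cochains_star_model F (val t) n)).
have /andP[_ /eqP td] : (val t \in sub_mem K') && (dim (val t) == n%:Z - l).
  exact: (valP t).
have tk : `|n%:Z - l|%N = #|` val (val t)|.-1.
  by move: td (simplex_card_gt0 (val t)); rewrite /dim; lia.
have [[a1 aE]|] := simp_case (full_sub X) n a; last by rewrite an.
rewrite -aE in ta an *; rewrite [LHS]ext_val.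
rewrite -[LHS]/(cap_gen_cohom o n (val a1) a1 psi (val t)) /cap_gen_cohom tk.
rewrite /front_back Tt ta /= /chi.
have [ft|nf] := boolP (front o #|` val (val t)|.-1 (val a1) == val (val t)); last first.
  by rewrite big1.
case E: (find_simp K l _) => [tau|] /=.
  have tauE := find_simpE E.
  have tau_a : sle (val tau) (val a1) by rewrite /sle tauE back_sub.
  rewrite (eq_big_supp (r2 := [:: val tau])) ?fset_uniq ?big_seq1//.
  - by rewrite -tauE eqxx mulr1z ext_val.
  - move=> s _ /mulz_neq0r; rewrite -tauE inE val_eqE [s == _]eq_sym.
    by case: (val tau == s).
  - by move=> s; rewrite inE => /eqP-> _; rewrite mem_faces.
rewrite big1// => s _; case: eqP => [bs|_]; last by rewrite mulr0z.
rewrite ext_out ?bihom0 ?mul0rz//.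
apply/negP => sK; have := find_simpK (exist _ s sK : simp K l).
by rewrite /= -bs E.
Qed.

Lemma front_back_linear (c : A) (phi psi : bprod F) t :
  front_back o U (c *: phi + psi) t = c *: front_back o U phi t + front_back o U psi t.
Proof.
apply: bprodP => a.
rewrite -[RHS]/(c *: front_back o U phi t a + front_back o U psi t a) /front_back.
case: ifP => _; last by rewrite scaler0 addr0.
rewrite scaler_sumr -big_split; apply: eq_bigr => s _ /=.
case: (chi o t s a); last by rewrite !mulr0z scaler0 addr0.
by rewrite !mulr1z bprodDE bprodZE bihom_linear.
Qed.

Lemma front_back_rscale (c : B) (phi : bprod F) t :
  front_back o U (rscale phi c) t = rscale (front_back o U phi t) c.
Proof.
apply: bprodP => a.
rewrite -[RHS]/(rscale (front_back o U phi t a) c) /front_back.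
case: ifP => _; last by rewrite rscale0l.
rewrite rscale_sum; apply: eq_bigr => s _ /=.
case: (chi o t s a); last by rewrite !mulr0z rscale0l.
by rewrite !mulr1z bprodRE bihom_rscale.
Qed.

Variables (fin : bool) (l : int).
Hypothesis Uconv : order_convex o U.
Hypothesis exact_T : forall t (k : int), T t -> k != n%:Z -> cob_exact o F t k.

Variables (L M P L' M' P' : bimodType A B).
Variables (f : bihom L M) (g : bihom M P) (f' : bihom L' M') (g' : bihom M' P').
Variables (eL : bihom L (bprod F)) (eM : bihom M (bprod F)) (eP : bihom P (bprod F)).
Variables (eL' : bihom L' (bprod h)) (eM' : bihom M' (bprod h)) (eP' : bihom P' (bprod h)).
Hypothesis mL : is_model fin (fun s => S s && (dim s == l - 1)) eL.
Hypothesis mM : is_model fin (fun s => S s && (dim s == l)) eM.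
Hypothesis mP : is_model fin (fun s => S s && (dim s == l + 1)) eP.
Hypothesis mL' : is_model fin (fun t => T t && (dim t == n%:Z - l + 1)) eL'.
Hypothesis mM' : is_model fin (fun t => T t && (dim t == n%:Z - l)) eM'.
Hypothesis mP' : is_model fin (fun t => T t && (dim t == n%:Z - l - 1)) eP'.
Hypothesis fE : forall c s, S s && (dim s == l) -> eM (f c) s = Cob o (eL c) s.
Hypothesis gE : forall c s, S s && (dim s == l + 1) -> eP (g c) s = Cob o (eM c) s.
Hypothesis fE' : forall c t, T t && (dim t == n%:Z - l) ->
  eM' (f' c) t = Bd o (eL' c) t.
Hypothesis gE' : forall c t, T t && (dim t == n%:Z - l - 1) ->
  eP' (g' c) t = Bd o (eM' c) t.
Variable hh : M -> M'.
Hypothesis hE : forall c t, T t && (dim t == n%:Z - l) ->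
  eM' (hh c) t = classes o (front_back o U (eM c)) t.

Let gP c : g c = 0 <-> forall s, S s -> Cob o (eM c) s = 0.
Proof. exact: (model_cycle_cob mM mP gE erefl). Qed.

Let g'P c : g' c = 0 <-> forall t, T t -> Bd o (eM' c) t = 0.
Proof. exact: (model_cycle_bd mM' mP' gE' erefl). Qed.

Let fS c s : S s -> eM (f c) s = Cob o (eL c) s.
Proof. by apply: (model_cob mL mM fE); rewrite subrK. Qed.

Let f'T c t : T t -> eM' (f' c) t = Bd o (eL' c) t.
Proof. by apply: (model_bd mL' mM' fE'); rewrite addrK. Qed.

Let hT c : eM' (hh c) = classes o (front_back o U (eM c)).
Proof.
apply: bprodP => t.
have [c1|c1] := boolP (T t && (dim t == n%:Z - l)); first exact: hE.
rewrite (model_out mM')//.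
by rewrite (classes_supp (front_back_supp (model_out mM c)) c1).
Qed.

Lemma induces_iso_classes : induces_iso f g f' g' hh.
Proof.
have fineM c : finF fin (eM c) by exact: model_fin mM c.
apply: induces_isoP.
- move=> a c c'; apply: (model_inj mM'); apply: bprodP => t.
  rewrite bihom_linear !hT bihom_linear /classes front_back_linear.
  exact: bihom_linear.
- move=> b c; apply: (model_inj mM'); apply: bprodP => t.
  rewrite bihom_rscale !hT bihom_rscale /classes front_back_rscale.
  exact: bihom_rscale.
- move=> z /gP gz; apply/g'P => t Tt; rewrite hT.
  rewrite (bd_classes_front_back (model_out mM z) Tt) (_ : cob_on _ _ _ = 0).
    rewrite /classes (_ : front_back o U (0 : bprod F) t = 0) ?bihom0 ?mul0rz ?oppr0//.
    apply: bprodP => a; rewrite /front_back; case: ifP => // _.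
    by apply: big1 => s _; rewrite bihom0 mul0rz.
  apply: bprodP => s; rewrite /cob_on.
  by case: ifP => // /gz.
- move=> y; have sy := model_out mL y.
  have sps := classes_supp (front_back_supp sy).
  have lE : n%:Z - (l - 1) = n%:Z - l + 1 by ring.
  rewrite lE in sps.
  have [|| y' y'E] := model_surj mL' (x := fun t => classes o (front_back o U (eL y)) t *~ (- int_sign (n%:Z - l))).
  + by move=> t nt; rewrite sps// mul0rz.
  + move=> finT; have := classes_fin o (front_back_fin o U (model_fin mL y)) finT.
    by apply: sub_finite_set => t; exact: mulz_neq0l.
  exists y'; apply: (model_inj mM'); apply: bprodP => t.
  have [/andP[Tt /eqP tl]|nT] := boolP (T t && (dim t == n%:Z - l)); last first.
    by rewrite !(model_out mM').
  rewrite f'T// y'E Bd_mulz (bd_classes_front_back sy Tt) mulNrz mulrNz opprK -mulrzA.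
  rewrite /dim_sign tl int_sign_sqr mulr1z hT; congr (classes o (front_back o U _) t).
  apply: bprodP => s.
  rewrite /cob_on; have [Ss|nS] := boolP (S s); first exact: fS.
  by rewrite (model_out mM)// (negbTE nS).
- move=> z y' /gP gz hz.
  have [||t Tt|psi [spsi fpsi psiE]] :=
      classes_front_back_inj Uconv exact_T (model_out mM z) (fineM z) gz (c := eL' y').
  + exact: model_out mL' y'.
  + exact: model_fin mL' y'.
  + by rewrite -hT hz f'T.
  have [y yE] := model_surj mL spsi fpsi.
  exists y; apply: (model_inj mM); apply: bprodP => s.
  have [Ss|nS] := boolP (S s); first by rewrite fS// yE psiE.
  by rewrite !(model_out mM) ?(negbTE nS).
- move=> z' /g'P gz'.
  have [phi [y' [sphi fphi cphi [sy' fy'] yE]]] :=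
    classes_front_back_surj Uconv exact_T (model_out mM' z') (model_fin mM' z') gz'.
  have [z zE] := model_surj mM sphi fphi.
  have [w wE] := model_surj mL' sy' fy'.
  exists z, w; split; first by apply/gP; rewrite zE.
  apply: (model_inj mM'); apply: bprodP => t.
  have [Tt|nT] := boolP (T t); last by rewrite !(model_out mM') ?(negbTE nT).
  by rewrite f'T// wE -yE// bihomB -zE -hT.
Qed.

End SheafTransport.

(** * Constant coefficients *)

Section ConstantCoefficients.
Variables (V : choiceType) (n : nat) (X : lfcomplex V n) (o : orientation X).
Variables (R : pzRingType) (t : simplex X).
Implicit Types (s r a b c d : simplex X).
Local Notation inc := (inc o).
Local Notation cR := (const_cosheaf X R^o : cosheaf X R R).
Local Notation sR := (const_sheaf X R^o : sheaf X R R).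

Lemma Bd_const (z : simplex X -> R) b :
  Bd o (z : bprod cR) b = \sum_(d <- star b) z d *~ inc b d :> R.
Proof.
apply: eq_bigr => d _; have [->|/inc_sle bd] := eqVneq (inc b d) 0.
  by rewrite !mulr0z.
by rewrite (coshmE _ bd).
Qed.

Lemma Cob_const (z : simplex X -> R) b :
  Cob o (z : bprod sR) b = \sum_(d <- faces b) z d *~ inc d b :> R.
Proof.
apply: eq_bigr => d _; have [->|/inc_sle db] := eqVneq (inc d b) 0.
  by rewrite !mulr0z.
by rewrite (shmE _ db).
Qed.

Hypothesis exact_t : forall k : int, k != n%:Z -> bd_exact o cR t k.

(* sg a is the value of a chain contraction at the basis element a *)
Definition splits (sg : simplex X -> simplex X -> R) a :=
  (forall b, ~~ in_star t (dim a + 1) b -> sg a b = 0) /\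
  forall b, sle t b ->
    \sum_(d <- star b) sg a d *~ inc b d +
    \sum_(c <- faces a | sle t c) sg c b *~ inc c a = (a == b)%:R.

(** By increasing dimension: [a] minus the contraction of its boundary is a cycle, and exactness
    gives a chain bounding it, taken as the value at [a]. Freeness makes a choice on basis elements
    sufficient. *)
Lemma splitting : exists sg, forall a, sle t a -> dim a != n -> splits sg a.
Proof.
suff [sg sgP] : exists sg, forall a, (#|` val a| < n.+2)%N -> sle t a ->
    dim a != n -> splits sg a.
  by exists sg => a; apply: sgP; rewrite ltnS; exact: sc_dim_le (valP a).
elim: n.+2 => [|N [sg sgP]]; first by exists (fun _ _ => 0).
have ex_w a : exists w : simplex X -> R, #|` val a| = N -> sle t a -> dim a != n ->
    (forall b, ~~ in_star t (dim a + 1) b -> w b = 0) /\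
    forall b, sle t b -> \sum_(d <- star b) w d *~ inc b d =
      (a == b)%:R - \sum_(c <- faces a | sle t c) sg c b *~ inc c a.
  have [aN|aN] := eqVneq #|` val a| N; last by exists (fun=> 0) => /eqP; rewrite (negbTE aN).
  have [ta|ta] := boolP (sle t a); last by exists (fun=> 0).
  have [an|an] := boolP (dim a != n); last by exists (fun=> 0).
  pose z b : R := (a == b)%:R - \sum_(c <- faces a | sle t c) sg c b *~ inc c a.
  (* A facet never has dimension [n], as [a] would have dimension [n + 1]; so the contraction is
     already known on it. *)
  have sgc c : inc c a != 0 -> sle t c -> splits sg c.
    move=> ca tc; apply: sgP => //; first by move: (inc_card ca); lia.
    have := dim_le_top a; rewrite (inc_dim ca); apply: contra => /eqP ->.
    by rewrite eqxx.
  have [b nb|b tb|w [w0 wB]] := exact_t an (z := z).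
  - rewrite /z; have [ab|_] := eqVneq a b.
      by rewrite /in_star -ab ta eqxx in nb.
    rewrite big1 ?subr0// => c tc; have [->|ca] := eqVneq (inc c a) 0.
      by rewrite mulr0z.
    have [-> //] := sgc c ca tc; first by rewrite mul0rz.
    by rewrite -(inc_dim ca).
  - rewrite Bd_const /z; under eq_bigr do rewrite mulrzBl.
    rewrite sumrB.
    have -> : \sum_(d <- star b) (a == d)%:R *~ inc b d = (inc b a)%:~R :> R.
      have [ba|ba] := boolP (sle b a).
        rewrite (eq_big_supp (r2 := [:: a])) ?fset_uniq ?big_seq1 ?eqxx//.
          by move=> d _; rewrite inE; have [//|_] := eqVneq a d; rewrite mul0rz eqxx.
        by move=> d; rewrite inE => /eqP -> _; rewrite mem_star.
      have -> : inc b a = 0 by apply/eqP; apply: contraNT ba => /inc_sle.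
      rewrite big_seq big1// => d; rewrite mem_star => bd.
      have [ad|_] := eqVneq a d; last by rewrite mul0rz.
      by rewrite ad bd in ba.
    under eq_bigr do rewrite mulrz_suml.
    rewrite exchange_big /=.
    (* The identity on the facets [c] moves the boundary past the contraction; the copies of
       [inc b a] then cancel and the rest vanishes by square-zero. *)
    transitivity ((inc b a)%:~R - \sum_(c <- faces a | sle t c)
        ((c == b)%:R - \sum_(d <- faces c | sle t d) sg d b *~ inc d c) *~ inc c a : R).
      congr (_ - _); apply: eq_bigr => c tc.
      have [ca|ca] := eqVneq (inc c a) 0.
        by rewrite ca mulr0z big1// => d _; rewrite mulr0z mul0rz.
      have [_ /(_ b tb) <-] := sgc c ca tc.
      rewrite addrK mulrz_suml; apply: eq_bigr => d _.
      by rewrite mulrzAC.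
    under eq_bigr do rewrite mulrzBl.
    rewrite sumrB opprB addrCA.
    have -> : \sum_(c <- faces a | sle t c) (c == b)%:R *~ inc c a = (inc b a)%:~R :> R.
      rewrite big_mkcond /=.
      have [ba|ba] := boolP (sle b a).
        rewrite (eq_big_supp (r2 := [:: b])) ?fset_uniq ?big_seq1 ?eqxx ?tb//.
          move=> d _; rewrite inE; have [//|_] := eqVneq d b; rewrite mul0rz.
          by case: ifP; rewrite eqxx.
        by move=> d; rewrite inE => /eqP -> _; rewrite mem_faces.
      have -> : inc b a = 0 by apply/eqP; apply: contraNT ba => /inc_sle.
      rewrite big_seq big1// => d; rewrite mem_faces => da.
      have [db|_] := eqVneq d b; last by rewrite mul0rz; case: ifP.
      by rewrite -db da in ba.
    rewrite subrr addr0.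
    transitivity (\sum_(c <- faces a) (\sum_(d <- faces a | sle t d)
        sg d b *~ inc d c) *~ inc c a).
      rewrite big_mkcond /= big_seq [RHS]big_seq; apply: eq_bigr => c.
      rewrite mem_faces => ca; case: ifPn => [tc|tc]; last first.
        rewrite big1 ?mul0rz// => d td; have [->|/inc_sle dc] := eqVneq (inc d c) 0.
          by rewrite mulr0z.
        by rewrite (sle_trans td dc) in tc.
      congr (_ *~ _); rewrite big_mkcond [RHS]big_mkcond /=.
      apply: (sum_faces_widen ca) => d; case: ifP => _; last by rewrite eqxx.
      by move=> /mulz_neq0r/inc_sle.
    under eq_bigr do rewrite mulrz_suml.
    rewrite exchange_big big1 //= => d _.
    under eq_bigr do rewrite -mulrzA.
    by rewrite -mulrz_sumr inc_inc ?mulr0z// sle_refl.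
  exists w => _ _ _; split=> // b tb; rewrite -Bd_const.
  exact: wB.
have [W WP] := choice ex_w.
exists (fun a => if #|` val a| == N then W a else sg a).
move=> a aN ta an.
have faceE c b : inc c a != 0 ->
    (if #|` val c| == N then W c else sg c) b = sg c b.
  move=> /inc_card ca; have [cN|//] := eqVneq #|` val c| N.
  by move: aN ca; rewrite cN; lia.
have sumE b : \sum_(c <- faces a | sle t c)
      (if #|` val c| == N then W c else sg c) b *~ inc c a =
    \sum_(c <- faces a | sle t c) sg c b *~ inc c a.
  apply: eq_bigr => c _; have [->|/faceE->//] := eqVneq (inc c a) 0.
  by rewrite !mulr0z.
have [aN'|aN'] := eqVneq #|` val a| N; last first.
  have [|s0 sB] := sgP a _ ta an; first by move: aN aN'; lia.
  split=> [b nb|b tb]; first by rewrite (negbTE aN') s0.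
  by rewrite sumE (negbTE aN') sB.
have [w0 wB] := WP a aN' ta an.
split=> [b nb|b tb]; first by rewrite aN' eqxx; exact: w0.
by rewrite sumE aN' eqxx wB// subrK.
Qed.

(** The transpose of a contraction contracts the dual complex. Its coefficients multiply on the left
    and the differentials are integral, so this makes sense over a noncommutative [R]. *)
Lemma const_cob_exact (k : int) : k != n%:Z -> cob_exact o sR t k.
Proof.
move=> kn z z0 zC; have [sg sgP] := splitting.
pose w b : R := if in_star t (k - 1) b
  then \sum_(d <- star t) sg b d * (z d : R) else 0.
exists w; split=> [b /negbTE nb|a ta]; first by rewrite /w nb.
have [ak|ak] := eqVneq (dim a) k; last first.
  rewrite (z0 _ (out_star_dim t ak)).
  rewrite (@star_Cob0 _ _ _ o _ _ sR w t (k - 1))// ?subrK//.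
  by move=> b /negbTE nb; rewrite /w nb.
have an : dim a != n by rewrite ak.
have [_ sgB] := sgP a ta an.
rewrite Cob_const.
transitivity (\sum_(c <- faces a | sle t c)
    \sum_(d <- star t) (sg c d *~ inc c a) * (z d : R)).
  rewrite [RHS]big_mkcond /=; apply: eq_bigr => c _.
  have [ca|ca] := eqVneq (inc c a) 0.
    rewrite ca mulr0z; case: ifP => // _; rewrite big1// => d _.
    by rewrite mulr0z mul0r.
  rewrite /w /in_star -ak (inc_dim ca) addrK eqxx andbT.
  case: ifP => _; last by rewrite mul0rz.
  by rewrite mulrz_suml; apply: eq_bigr => d _; rewrite mulrzAl.
rewrite exchange_big /=.
transitivity (\sum_(d <- star t) ((a == d)%:R -
    \sum_(b <- star d) sg a b *~ inc d b) * (z d : R)).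
  rewrite big_seq [RHS]big_seq; apply: eq_bigr => d; rewrite mem_star => td.
  by rewrite -mulr_suml -(sgB d td) addrAC subrr add0r.
under eq_bigr do rewrite mulrBl.
rewrite sumrB (eq_big_supp (r2 := [:: a])) ?fset_uniq ?big_seq1 ?eqxx ?mul1r//; first last.
- by move=> d; rewrite inE => /eqP -> _; rewrite mem_star.
- by move=> d _; rewrite inE; have [//|_] := eqVneq a d; rewrite mul0r eqxx.
rewrite (_ : \sum_(d <- star t) _ = 0) ?subr0//.
transitivity (\sum_(d <- star t) \sum_(b <- star t) sg a b * ((z d : R) *~ inc d b)).
  rewrite big_seq [RHS]big_seq; apply: eq_bigr => d; rewrite mem_star => td.
  rewrite mulr_suml -(sum_star_widen td) => [|b].
    by apply: eq_bigr => b _; rewrite mulrzAl mulrzAr.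
  have [->|/inc_sle//] := eqVneq (inc d b) 0; by rewrite mulr0z mulr0 eqxx.
(* This is the transposed contraction applied to the coboundary of [z], which vanishes. *)
rewrite exchange_big big_seq big1 //= => b; rewrite mem_star => tb.
rewrite -mulr_sumr -[RHS](mulr0 (sg a b)); congr (_ * _).
rewrite -[RHS](zC b tb) Cob_const; apply: sum_star_faces => d zd.
rewrite (inc_sle (mulz_neq0r zd)) andbT.
by apply: contraNT (mulz_neq0l zd) => td; apply/eqP/z0/out_star_sle.
Qed.

End ConstantCoefficients.

(** * Full subcomplexes *)

Section FullSubcomplex.
Variables (V : choiceType) (n : nat) (X : lfcomplex V n) (o : orientation X).
Variable L : subcomplex X.
Hypotheses (L_full : is_full L) (Lvc_before : is_before o (vertex_complement L) L).
Implicit Types (s t a : simplex X) (l : int).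
Local Notation Lvc := (vertex_complement L).
Local Notation UL := (vertex_of L).
Local Notation Uc := (predC (vertex_of L)).

Lemma LvcP s : reflect {in val s, forall v, ~~ UL v} (s \in sub_mem Lvc).
Proof. exact: asboolP. Qed.

Lemma vertex_of_Lvc s v : v \in val s -> ~~ UL v -> vertex_of Lvc v.
Proof.
move=> vs nv.
have qs : subseq [:: v] (vertices o s) by rewrite sub1seq mem_vertices.
have [t tE _] := subseq_face qs isT.
apply/asboolP; exists t; last by rewrite tE in_fs mem_head.
by apply/LvcP => w; rewrite tE in_fs inE => /eqP ->.
Qed.

Lemma before_L a v w : v \in val a -> w \in val a -> ~~ UL v -> UL w ->
  ord o a v w /\ ~~ ord o a w v.
Proof.
move=> va wa nv Lw; have [vw avw] := Lvc_before va wa (vertex_of_Lvc va nv) Lw.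
split=> //; apply: contra vw => awv; apply/eqP.
by apply: (ord_anti (o := o) (s := a)) => //; rewrite avw.
Qed.

(** The vertices of [L] form a final segment of every simplex and the others an initial one; both
    are intervals. *)
Lemma convex_UL : order_convex o UL.
Proof.
move=> a x y z xa ya za xy yz Lx _; apply/negPn/negP => ny.
by have [_] := before_L ya xa ny Lx; rewrite xy.
Qed.

Lemma convex_Uc : order_convex o Uc.
Proof.
move=> a x y z xa ya za xy yz _ /= nz; apply/negP => Ly.
by have [_] := before_L za ya nz Ly; rewrite yz.
Qed.

(** A simplex beginning in [L] continues in [L], and fullness then puts it in the subcomplex.
    Membership thus becomes a condition on the first vertex. *)
Lemma mem_L s : (s \in sub_mem L) = first_in o UL s.
Proof.
have [x [_ [_ xs sx ->]]] := firstE o s.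
apply/idP/idP => [sL|Lx]; first by apply/asboolP; exists s.
apply: L_full => y ys; apply/negPn/negP => ny.
by have [_] := before_L ys xs ny Lx; rewrite sx.
Qed.

Lemma mem_Lvc t : (t \in sub_mem Lvc) = ~~ last_in o UL t.
Proof.
have [x [_ [_ xt tx ->]]] := lastE o t.
apply/LvcP/idP => [|nx y yt]; first exact.
apply/negP => Ly.
by have [_] := before_L xt yt nx Ly; rewrite tx.
Qed.

Lemma first_in_Uc s : first_in o Uc s = ~~ first_in o UL s.
Proof. by have [x [_ [_ _ _ E]]] := firstE o s; rewrite !E. Qed.

Lemma last_in_Uc s : last_in o Uc s = ~~ last_in o UL s.
Proof. by have [x [_ [_ _ _ E]]] := lastE o s; rewrite !E. Qed.

Lemma notin_L s : (s \notin sub_mem L) = first_in o Uc s.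
Proof. by rewrite mem_L first_in_Uc. Qed.

Lemma notin_Lvc t : (t \notin sub_mem Lvc) = last_in o UL t.
Proof. by rewrite mem_Lvc negbK. Qed.

Lemma mem_Lvc' t : (t \in sub_mem Lvc) = last_in o Uc t.
Proof. by rewrite mem_Lvc last_in_Uc. Qed.

Lemma ext_full (A B : pzRingType) (M : simplex X -> bimodType A B) (fin : bool) k
    (c : dsum fin (fun s : simp (full_sub X) k => M (val s))) t
    (z : bprod M) : dim t == k ->
  (forall s : simp (full_sub X) k, coeff c s = z (val s)) ->
  ext (full_sub X) k M fin c t = z t.
Proof.
move=> tk cz; have [[s <-]|] := simp_case (full_sub X) k t; last by rewrite tk.
by rewrite [LHS]ext_val; exact: cz.
Qed.

Section Cosheaf.
Variables (A B : pzRingType) (G : cosheaf X A B) (fin : bool) (l : int).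

Lemma cap_iso_1a_CM : CM_at_cosheaf o G L -> cap_iso_1a o fin L G l.
Proof.
move=> CM.
have mS k : is_model fin (fun s => first_in o UL s && (dim s == k))
    (ext L k (loc_hom_sheaf o G n) fin).
  by apply: ext_model => s; rewrite mem_L.
have mT k : is_model fin (fun t => last_in o UL t && (dim t == k))
    (rel_chains_ext fin G Lvc k).
  by apply: rel_chains_model => t; rewrite notin_Lvc.
have ex s (k : int) : first_in o UL s -> k != n%:Z -> bd_exact o G s k.
  by rewrite -mem_L; exact: CM_bd_exact.
apply: (induces_iso_cut_sum convex_UL ex (mS (l - 1)) (mS l) (mS (l + 1))
  (mT (n%:Z - l + 1)) (mT (n%:Z - l)) (mT (n%:Z - l - 1))).
- by move=> c s; rewrite ext_cobound mem_L => ->.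
- by move=> c s; rewrite ext_cobound mem_L => ->.
- by move=> c t; rewrite rel_chains_ext_bound notin_Lvc => ->.
- by move=> c t; rewrite rel_chains_ext_bound notin_Lvc => ->.
- move=> c t /andP[Tt tl]; rewrite rel_chains_ext_pi /off_fun.
  have /negbTE -> : t \notin sub_mem Lvc by rewrite notin_Lvc.
  by apply: ext_full => // s; exact: cap_loc_hom_funE.
Qed.

(** Here [U] consists of the vertices outside [L]. The simplices in [S] are those not in [L], which
    may still have vertices in [L]; local homology is resolved on all of them. *)
Lemma cap_iso_1b_CM : CM_at_cosheaf o G (full_sub X) -> cap_iso_1b o fin L G l.
Proof.
move=> CM.
have mS k : is_model fin (fun s => first_in o Uc s && (dim s == k))
    (rel_cochains_ext fin (loc_hom_sheaf o G n) L k).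
  by apply: rel_cochains_model => s; rewrite notin_L.
have mT k : is_model fin (fun t => last_in o Uc t && (dim t == k))
    (ext Lvc k G fin).
  by apply: ext_model => t; rewrite mem_Lvc'.
have ex s (k : int) : first_in o Uc s -> k != n%:Z -> bd_exact o G s k.
  by move=> _; exact: (CM_bd_exact CM).
apply: (induces_iso_cut_sum convex_Uc ex (mS (l - 1)) (mS l) (mS (l + 1))
  (mT (n%:Z - l + 1)) (mT (n%:Z - l)) (mT (n%:Z - l - 1))).
- by move=> c s; rewrite rel_cochains_ext_cobound notin_L => ->.
- by move=> c s; rewrite rel_cochains_ext_cobound notin_L => ->.
- by move=> c t; rewrite ext_bound mem_Lvc' => ->.
- by move=> c t; rewrite ext_bound mem_Lvc' => ->.
- move=> c t c1; have [[s <-]|] := simp_case Lvc (n%:Z - l) t; last by rewrite mem_Lvc' c1.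
  by rewrite [LHS]ext_val; exact: cap_loc_hom_funE.
Qed.

End Cosheaf.

Section Sheaf.
Variables (A B : pzRingType) (F : sheaf X A B) (fin : bool) (l : int).

(** Exactness is the hypothesis so that one lemma serves sheaves, where it comes from local
    cohomology, and constant coefficients, where it is derived from local homology. *)
Lemma cap_iso_2a_exact :
  (forall t (k : int), t \in sub_mem Lvc -> k != n%:Z -> cob_exact o F t k) ->
  cap_iso_2a o fin L F l.
Proof.
move=> CM.
have mS k : is_model fin (fun s => first_in o Uc s && (dim s == k))
    (rel_cochains_ext fin F L k).
  by apply: rel_cochains_model => s; rewrite notin_L.
have mT k : is_model fin (fun t => last_in o Uc t && (dim t == k))
    (ext Lvc k (loc_cohom_cosheaf o F n) fin).
  by apply: ext_model => t; rewrite mem_Lvc'.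
have ex t (k : int) : last_in o Uc t -> k != n%:Z -> cob_exact o F t k.
  by rewrite -mem_Lvc'; exact: CM.
apply: (induces_iso_classes convex_Uc ex (mS (l - 1)) (mS l) (mS (l + 1))
  (mT (n%:Z - l + 1)) (mT (n%:Z - l)) (mT (n%:Z - l - 1))).
- by move=> c s; rewrite rel_cochains_ext_cobound notin_L => ->.
- by move=> c s; rewrite rel_cochains_ext_cobound notin_L => ->.
- by move=> c t; rewrite ext_bound mem_Lvc' => ->.
- by move=> c t; rewrite ext_bound mem_Lvc' => ->.
- move=> c t c1; have [[s sE]|] := simp_case Lvc (n%:Z - l) t; last by rewrite mem_Lvc' c1.
  move: c1; rewrite -sE [ext _ _ _ _ _ _]ext_val => /andP[Ts _].
  exact: cap_loc_cohom_funE.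
Qed.

Lemma cap_iso_2b_exact :
  (forall t (k : int), k != n%:Z -> cob_exact o F t k) -> cap_iso_2b o fin L F l.
Proof.
move=> CM.
have mS k : is_model fin (fun s => first_in o UL s && (dim s == k))
    (ext L k F fin).
  by apply: ext_model => s; rewrite mem_L.
have mT k : is_model fin (fun t => last_in o UL t && (dim t == k))
    (rel_chains_ext fin (loc_cohom_cosheaf o F n) Lvc k).
  by apply: rel_chains_model => t; rewrite notin_Lvc.
have ex t (k : int) : last_in o UL t -> k != n%:Z -> cob_exact o F t k.
  by move=> _; exact: CM.
apply: (induces_iso_classes convex_UL ex (mS (l - 1)) (mS l) (mS (l + 1))
  (mT (n%:Z - l + 1)) (mT (n%:Z - l)) (mT (n%:Z - l - 1))).
- by move=> c s; rewrite ext_cobound mem_L => ->.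
- by move=> c s; rewrite ext_cobound mem_L => ->.
- by move=> c t; rewrite rel_chains_ext_bound notin_Lvc => ->.
- by move=> c t; rewrite rel_chains_ext_bound notin_Lvc => ->.
- move=> c t /andP[Tt tl]; rewrite rel_chains_ext_pi /off_fun.
  have /negbTE -> : t \notin sub_mem Lvc by rewrite notin_Lvc.
  have [[s sE]|] := simp_case (full_sub X) (n%:Z - l) t; last by rewrite tl.
  rewrite -sE in Tt *; rewrite [LHS]ext_val.
  exact: cap_loc_cohom_funE.
Qed.

End Sheaf.
End FullSubcomplex.

Theorem theorem4p26 (R : pzRingType) (V : choiceType) (n : nat)
    (X : lfcomplex V n) (L : subcomplex X) (o : orientation X)
    (L_full : is_full L)
    (Lvc_before : is_before o (vertex_complement L) L) :
  let Lvc := vertex_complement L in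
  let cR : cosheaf X R R := const_cosheaf X R^o in
  let sR : sheaf X R R := const_sheaf X R^o in
  [/\ (* 1.a *)
      CM_at_cosheaf o cR L -> forall l : int,
        cap_iso_1a o true L cR l /\ cap_iso_1a o false L cR l,
      (* 1.b *)
      CM_at_cosheaf o cR (full_sub X) -> forall l : int,
        cap_iso_1b o true L cR l /\ cap_iso_1b o false L cR l,
      (* 2.a *)
      CM_at_cosheaf o cR Lvc -> forall l : int,
        cap_iso_2a o true L sR l /\ cap_iso_2a o false L sR l
    & (* 2.b *)
      CM_at_cosheaf o cR (full_sub X) -> forall l : int,
        cap_iso_2b o true L sR l /\ cap_iso_2b o false L sR l]
  /\ (forall G : right_cosheaf X R,
        (CM_at_cosheaf o G L -> forall l : int,
           cap_iso_1a o true L G l /\ cap_iso_1a o false L G l)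
     /\ (CM_at_cosheaf o G (full_sub X) -> forall l : int,
           cap_iso_1b o true L G l /\ cap_iso_1b o false L G l))
  /\ (forall F : left_sheaf X R,
        (CM_at_sheaf o F Lvc -> forall l : int,
           cap_iso_2a o true L F l /\ cap_iso_2a o false L F l)
     /\ (CM_at_sheaf o F (full_sub X) -> forall l : int,
           cap_iso_2b o true L F l /\ cap_iso_2b o false L F l)).
Proof.
move=> Lvc cR sR; split; [split|split=> [G|F]; split] => CM l.
- by split; exact: cap_iso_1a_CM.
- by split; exact: cap_iso_1b_CM.
(* The hypothesis concerns local homology over [R]; splitting the free local complexes converts it
   into exactness for cochains. *)
- have ex t (k : int) : t \in sub_mem Lvc -> k != n%:Z -> cob_exact o sR t k.
    by move=> tL; apply: const_cob_exact => k'; exact: (CM_bd_exact CM).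
  by split; exact: cap_iso_2a_exact.
- have ex t (k : int) : k != n%:Z -> cob_exact o sR t k.
    by apply: const_cob_exact => k'; exact: (CM_bd_exact CM).
  by split; exact: cap_iso_2b_exact.
- by split; exact: cap_iso_1a_CM.
- by split; exact: cap_iso_1b_CM.
- by split; apply: cap_iso_2a_exact => // t k; exact: (CM_cob_exact CM).
- by split; apply: cap_iso_2b_exact => // t k; exact: (CM_cob_exact CM).
Qed.
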